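(* Let $B$ be a simple maximal symmetric operator in a Hilbert space $(\mathfrak H,(\cdot,\cdot))$ with $\ker(B^*-iI)=\{0\}$ and $\ker(B^*+iI)\neq\{0\}$. Let $\mathcal P$ be a unitary involution and $\mathcal T$ a conjugation in $\mathfrak H$ with $\mathcal P\mathcal T=\mathcal T\mathcal P$, and suppose $\mathcal P B=B\mathcal P$ and $\mathcal T B=-B\mathcal T$. Let $Q$ be a bounded self-adjoint operator in $\mathfrak H$ with $\mathcal PQ=-Q\mathcal P$, $\mathcal TQ=-Q\mathcal T$, such that $\mathcal C=e^{-Q}\mathcal P$ satisfies $\mathcal C B=B\mathcal C$. Let $\rho\ge 0$ and let $H$ be a $\mathcal{PT}$-symmetric $\rho$-perturbed operator in $\mathfrak H$ whose spectrum is real and nonnegative, with $0\notin\sigma_p(H)$, and which is self-adjoint in the Hilbert space $(\mathfrak H,(e^{Q}\cdot,\cdot))$. Then the $S$-matrix $\mathbb S(k)$ of $H$ is defined for all $k\in\mathbb C_+$ by $$\mathbb S(k)=[I-2(1-ik)T_k][I-2(1+ik)T_k]^{-1},$$ it is an analytic operator-valued function in $\mathbb C_+$ (with values bounded operators in $\mathcal H=\ker((B_\rho^* )^2+I)$), and for all $k\in\mathbb C_+$: (i) $e^{Q}\,\mathbb S(-\overline k)=\mathbb S^*(k)\,e^{Q}$; (ii) $e^{Q}\,\mathbb S(-\overline k)\,\mathbb S(k)\le e^{Q}$; (iii) $\mathcal{PT}\,\mathbb S(-\overline k)=\mathbb S(k)\,\mathcal{PT}$. Here $e^Q$ and $\mathcal{PT}$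 are restricted to $\mathcal H$ (which reduces them), and the adjoint $\mathbb S^*(k)$ and the inequality in (ii) are taken in $\mathcal H$ with respect to the initial inner product $(\cdot,\cdot)$.
   Context: Operator identities $XA=BX$ with $X$ bounded (linear or antilinear) and $A,B$ possibly unbounded are understood on $\mathcal D(A)$: $X\mathcal D(A)\subset\mathcal D(B)$ and $XAu=BXu$ for $u\in\mathcal D(A)$. $\mathbb C_+=\{k:\operatorname{Im}k>0\}$; $\rho(A)$ is the resolvent set of an operator $A$. A symmetric operator $B$ is simple if it does not induce a self-adjoint operator in any nonzero (reducing) subspace of $\mathfrak H$; it is maximal symmetric if one of its defect numbers $m_\pm=\dim\ker(B^*\pm iI)$ is zero; throughout $m_-=0<m_+$. A unitary involution is a linear $\mathcal P$ with $\mathcal P^2=I$, $(\mathcal Pf,\mathcal Pg)=(f,g)$. A conjugation is an antilinear $\mathcal T$ with $\mathcal T^2=I$, $(\mathcal Tf,\mathcal Tg)=(g,f)$. A closed densely defined $H$ is $\mathcal{PT}$-symmetric if $\mathcal{PT}H=H\mathcal{PT}$ (on $\mathcal D(H)$). $V(t)=e^{iBt}$, $t\ge0$, is the semigroup of isometries generated by $iB$; $\mathfrak H_\rho=V(\rho)\mathfrak H$; $B_\rho=B\upharpoonright_{V(\rho)\mathcal D(B)}$ is a simple maximal symmetric operator in $\mathfrak H_\rho$, and $B_\rho^*$ is its adjoint in $\mathfrak H_\rho$; one has $(B_\rho^2)^*=(B_\rho^* )^2$. A closed densely defined operator $H$ in $\mathfrak H$ is $\rho$-perturbed if $Hu=B_\rho^2u$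 and $H^*u=B_\rho^2u$ for all $u\in\mathcal D(B_\rho^2)$ (so both $H$ and $H^*$ extend $B_\rho^2$). Image set: let $P_\rho$ be the orthogonal projection of $\mathfrak H$ onto $\mathfrak H_\rho$, $\Lambda_+=\{k\in\mathbb C_+: k^2\in\rho(H)\}$, and for $k\in\Lambda_+$ put $H_k=(B_\rho^* )^2\upharpoonright_{\mathcal D(H_k)}$, $\mathcal D(H_k)=P_\rho(H-k^2I)^{-1}\mathfrak H_\rho$. Boundary triplet: $\mathcal H=\ker((B_\rho^* )^2+I)$; $\mathcal D((B_\rho^* )^2)=\mathcal D(B_\rho^*B_\rho)\dot+\mathcal H$, and for $f=u+h$ with $u\in\mathcal D(B_\rho^*B_\rho)$, $h\in\mathcal H$, set $\Gamma_0f=h$, $\Gamma_1f=P_{\mathcal H}(B_\rho^*B_\rho+I)u$, where $P_{\mathcal H}$ is the orthogonal projection of $\mathfrak H_\rho$ onto $\mathcal H$. $S$-matrix: for $k\in\Lambda_+$, $\mathbb S(k)$ exists if there is a bounded operator $T_k$ in $\mathcal H$ with $\mathcal D(H_k)=\{f\in\mathcal D((B_\rho^* )^2): T_k\Gamma_1f=\Gamma_0f\}$ and $0\in\rho(I-2(1+ik)T_k)$; then $\mathbb S(k):=[I-2(1-ik)T_k][I-2(1+ik)T_k]^{-1}$, a bounded operator in $\mathcal H$. *)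

(* Defs.v *)
(* MathComp-Analysis. A complex Hilbert space is a complete normed module [E]
   over [R[i]] (with [R : realType]) whose norm is the one of an inner product
   [dot : {dot E for Num.conj}], linear in its first argument. *)
From HB Require Import structures.
From mathcomp Require Import all_boot all_order all_algebra.
From mathcomp Require Import sesquilinear.
From mathcomp.real_closed Require Import complex.
From mathcomp Require Import all_classical all_reals all_analysis.
Set Implicit Arguments.
Unset Strict Implicit.
Unset Printing Implicit Defensive.
Import Order.TTheory GRing.Theory Num.Theory.
Import numFieldNormedType.Exports.
Local Open Scope classical_set_scope.
Local Open Scope complex_scope.
Local Open Scope ring_scope.

(* A possibly unbounded operator is identified with its graph: [A (u, v)]
   reads "[u] is in the domain of [A] and [A u = v]". *)
Section Operators.
Variables (R : realType) (E : completeNormedModType R[i]).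
Variable dot : {dot E for Num.conj}.
Implicit Types (A B : set (E * E)) (M : set E) (X : E -> E) (z k : R[i]).

Definition is_subspace (U : lmodType R[i]) (M : set U) : Prop :=
  M 0 /\ forall (a : R[i]) x y, M x -> M y -> M (a *: x + y).

Definition is_operator A : Prop :=
  is_subspace A /\ forall v, A (0, v) -> v = 0.

Definition opdom A : set E := [set u | exists v, A (u, v)].

Definition opcomp A B : set (E * E) :=
  [set p | exists2 w, B (p.1, w) & A (w, p.2)].

Definition opscale (a : R[i]) A : set (E * E) :=
  [set p | exists2 v, A (p.1, v) & p.2 = a *: v].

Definition graph_on M X : set (E * E) := [set p | M p.1 /\ p.2 = X p.1].

(* [ker (A - z I)] *)
Definition opker A z : set E := [set u | A (u, z *: u)].

(* [X A = B X] on the domain of [A] *)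
Definition intertwines X A B : Prop :=
  forall u v, A (u, v) -> B (X u, X v).

Definition closed_densely_defined A : Prop :=
  [/\ is_operator A, closed A & closure (opdom A) = setT].

(* Adjoint, within the subspace [M], with respect to the form [b]. *)
Definition adjoint (b : E -> E -> R[i]) M A : set (E * E) :=
  [set p | [/\ M p.1, M p.2 & forall u v, A (u, v) -> b v p.1 = b u p.2]].

Definition selfadjoint (b : E -> E -> R[i]) M A : Prop :=
  [/\ is_operator A, M `<=` closure (opdom A) & adjoint b M A = A].

Definition oproj M : set (E * E) :=
  [set p | M p.2 /\ forall m, M m -> dot (p.1 - p.2) m = 0].

(* [P A] is contained in [A P], for [P] the orthogonal projection onto [M]. *)
Definition reduces M A : Prop :=
  forall u v p q, A (u, v) -> oproj M (u, p) -> oproj M (v, q) -> A (p, q).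

Definition part_in M A : set (E * E) := A `&` (M `*` M).

Definition simple_op A : Prop :=
  forall M, is_subspace M -> closed M -> reduces M A ->
    selfadjoint dot M (part_in M A) -> M = [set 0].

Definition maximal_symmetric A : Prop :=
  [/\ closed_densely_defined A, A `<=` adjoint dot setT A &
      opker (adjoint dot setT A) 'i = [set 0] \/
      opker (adjoint dot setT A) (- 'i) = [set 0]].

Definition bounded_in M X : Prop :=
  [/\ forall f, M f -> M (X f),
      forall (a : R[i]) f g, M f -> M g -> X (a *: f + g) = a *: X f + X g &
      exists c : R[i], forall f, M f -> `|X f| <= c * `|f|].

(* [W = (A - z I)^-1], everywhere defined and bounded in [M] *)
Definition is_resolvent M A z X : Prop :=
  [/\ bounded_in M X,
      forall f, M f -> A (X f, f + z *: X f) &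
      forall u v, A (u, v) -> X (v - z *: u) = u].

Definition resolvent_set M A : set R[i] :=
  [set z | exists W, is_resolvent M A z W].

Definition point_spectrum A : set R[i] :=
  [set z | exists2 u, u != 0 & A (u, z *: u)].

Definition expop X (f : E) : E :=
  limn (series (fun n => (n`!%:R : R[i])^-1 *: iter n X f)).

(* [V] is the strongly continuous semigroup of isometries with generator [A];
   the values [V t] for [t < 0] are irrelevant. *)
Definition isometric_semigroup (V : R -> {linear E -> E}) A : Prop :=
  [/\ forall f, V 0 f = f,
      forall s t f, 0 <= s -> 0 <= t -> V (s + t) f = V s (V t f),
      forall t f, 0 <= t -> `|V t f| = `|f|,
      forall f, V t f @[t --> 0^'+] --> f &
      forall u v, A (u, v) <->
        ((t%:C)^-1 *: (V t u - u)) @[t --> (0 : R)^'+] --> v].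

Definition upper_half_plane : set R[i] := [set k | 0 < complex.Im k].

(* In the definitions below, [M] is [H_rho] and [A] is [B_rho]. *)

Definition sub_range (V : R -> {linear E -> E}) (rho : R) : set E :=
  range (V rho).

Definition sub_op (V : R -> {linear E -> E}) (rho : R) B : set (E * E) :=
  [set p | B p /\ (V rho @` opdom B) p.1].

Definition rho_perturbed A (H : set (E * E)) : Prop :=
  [/\ closed_densely_defined H, opcomp A A `<=` H &
      opcomp A A `<=` adjoint dot setT H].

Definition adj_square M A : set (E * E) :=
  opcomp (adjoint dot M A) (adjoint dot M A).

Definition bspace M A : set E := opker (adj_square M A) (-1).

Definition Gamma0 M A : set (E * E) :=
  [set p | exists u, [/\ opdom (opcomp (adjoint dot M A) A) u,
    bspace M A p.2 & p.1 = u + p.2]].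

Definition Gamma1 M A : set (E * E) :=
  [set p | exists u v h, [/\ opcomp (adjoint dot M A) A (u, v),
    bspace M A h, p.1 = u + h & oproj (bspace M A) (v + u, p.2)]].

Definition Lambda_plus (H : set (E * E)) : set R[i] :=
  [set k | upper_half_plane k /\ resolvent_set setT H (k ^+ 2)].

(* [P_rho (H - k^2 I)^-1 H_rho] *)
Definition image_domain M (H : set (E * E)) k : set E :=
  [set f | exists u v, [/\ H (u, v), M (v - k ^+ 2 *: u) & oproj M (u, f)]].

(* [D(H_k)] for the restriction [H_k] of [(A^* )^2] to [image_domain] is the
   left-hand side of the equation below. *)
Definition is_boundary_param M A (H : set (E * E)) k (T : E -> E) : Prop :=
  bounded_in (bspace M A) T /\
  image_domain M H k =
    [set f | opdom (adj_square M A) f /\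
      exists g, Gamma1 M A (f, g) /\ Gamma0 M A (f, T g)].

(* Only the restriction of [S] to [bspace M A] is determined. *)
Definition is_Smatrix M A (H : set (E * E)) k (S : E -> E) : Prop :=
  Lambda_plus H k /\
  exists T W : E -> E,
    [/\ is_boundary_param M A H k T,
        is_resolvent (bspace M A)
          (graph_on (bspace M A)
             (fun f => f - (2 * (1 + 'i * k)) *: T f)) 0 W &
        forall f, bspace M A f ->
          S f = W f - (2 * (1 - 'i * k)) *: T (W f)].

(* Complex differentiability on [D], for the norm of bounded operators in [M]. *)
Definition analytic_in M (D : set R[i]) (S : R[i] -> E -> E) : Prop :=
  forall k, D k -> bounded_in M (S k) /\
    exists2 S' : E -> E, bounded_in M S' &
      forall e : R[i], 0 < e -> \forall h \near (0 : R[i]^o)^',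
        forall f, M f ->
          `|h^-1 *: (S (k + h) f - S k f) - S' f| <= e * `|f|.

End Operators.

(* Main.v *)
(* Idea.  Let N = ker(B_rho^* + i), which is the space bspace of the statement,
   P_N and P the orthogonal projections onto N and H_rho, and for k in C_+ let
   F(k) = P_N (H - k^2)^-1 restricted to N.  Since m_- = 0, B_rho + k and
   B_rho^* - k are onto for k in C_+, so H_rho = ran(B_rho^2 - k^2) + N, and
   every f in D(H_k) is the sum of an element of D(B_rho^2), which has zero
   boundary values, and of some P (H - k^2)^-1 n with n in N, for which
     Gamma_1 f = G n := n + (1 + k^2) F(k) n,
     2i Gamma_0 f = (k + i) F(k) n + (k + i)^-1 n.
   H is nonnegative in the metric of e^Q, and G is the compression to N of
   (H + 1)(H - k^2)^-1, hence invertible by the Lax-Milgram lemma; this gives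
   T_k = Gamma_0 G^-1 and
     S(k) = (1 - ik) - ik (k + i)^2 F(k).
   Analyticity, (i) and (iii) are read off this formula, as e^Q and PT commute
   with P_N.  The latter holds because an operator commuting with B also commutes
   with the semigroup V, hence with B_rho and N.  For (ii), with u = (H - k^2)^-1 n,
   the energy <Hu, u> - |B_rho^* P u|^2 is nonnegative, since H >= 0 on u - w
   with w in D(B_rho^2) and B_rho w can approach B_rho^* P u; by Green's
   identity it is a function of the boundary values, and its sign is (ii). *)
Require Import Defs.
From HB Require Import structures.
From mathcomp Require Import all_boot all_order all_algebra.
From mathcomp Require Import sesquilinear.
From mathcomp.real_closed Require Import complex.
From mathcomp Require Import all_classical all_reals all_analysis.
From mathcomp Require Import ring lra.
Import Order.TTheory GRing.Theory Num.Theory.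
Import numFieldNormedType.Exports.
Local Open Scope classical_set_scope.
Local Open Scope complex_scope.
Local Open Scope ring_scope.

Set Implicit Arguments.
Unset Strict Implicit.
Unset Printing Implicit Defensive.

(** * Complex scalars and real-valued norms *)

(** The quotient defining [S(k)] collapses because [G - 2(1+ik) Gamma_0] is the scalar [2i/(k+i)] on
    N. The factor to be inverted is therefore this scalar times [G^-1], the invertibility of G is
    the only issue, and the numerator gives [S(k) n = n + 2k(k+i) Gamma_0 n]. The squares of k and
    of [- conj k] are conjugate, so their resolvents are adjoint to each other in the metric and
    exchanged by PT: (i) and (iii) become a comparison of scalar coefficients, and (i) turns the
    left side of (ii) into the squared metric norm of [S(k) n]. That e^Q commutes with B comes from
    PQ = -QP: this gives P e^-Q P = e^Q, that is, e^Q = PC. The spectral hypothesis only yields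
    bounded resolvents, so H >= 0 is extracted from them by an infimum argument. The commutation
    with V is proved for real-linear operators, in order to treat e^Q and the antilinear PT
    together. *)

Section ComplexScalars.
Variable R : realType.
Implicit Types a b : R[i].

Lemma ReD a b : complex.Re (a + b) = complex.Re a + complex.Re b.
Proof. by case: a b => [? ?] [? ?]. Qed.

Lemma ImD a b : complex.Im (a + b) = complex.Im a + complex.Im b.
Proof. by case: a b => [? ?] [? ?]. Qed.

Lemma ReN a : complex.Re (- a) = - complex.Re a.
Proof. by case: a. Qed.

Lemma ImN a : complex.Im (- a) = - complex.Im a.
Proof. by case: a. Qed.

Lemma ReM a b :
  complex.Re (a * b) = complex.Re a * complex.Re b - complex.Im a * complex.Im b.
Proof. by case: a b => [? ?] [? ?]. Qed.

Lemma ImM a b :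
  complex.Im (a * b) = complex.Re a * complex.Im b + complex.Im a * complex.Re b.
Proof. by case: a b => [? ?] [? ?]. Qed.

Lemma ReJ a : complex.Re (a^*) = complex.Re a.
Proof. by case: a. Qed.

Lemma ImJ a : complex.Im (a^*) = - complex.Im a.
Proof. by case: a. Qed.

Lemma Re_i : complex.Re ('i : R[i]) = 0.
Proof. by rewrite -complexiE. Qed.

Lemma Im_i : complex.Im ('i : R[i]) = 1.
Proof. by rewrite -complexiE. Qed.

Lemma complex_ext a b :
  complex.Re a = complex.Re b -> complex.Im a = complex.Im b -> a = b.
Proof. by case: a b => [? ?] [? ?] /= -> ->. Qed.

Lemma conjC_realC (r : R) : (r%:C : R[i])^* = r%:C.
Proof. by apply: complex_ext; rewrite ?ReJ ?ImJ //= oppr0. Qed.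

Definition ReImE := (ReD, ImD, ReN, ImN, ReM, ImM, ReJ, ImJ, Re_i, Im_i).

(** The modulus and the norm take values in [R[i]], whose order is partial; [cabs], and [nrm] below,
    move them to [R], where [lra] and [nra] apply. *)
Definition cabs a : R := complex.Re `|a|.

Lemma cabsE a : `|a| = (cabs a)%:C.
Proof. by rewrite /cabs RRe_real // normr_real. Qed.

Lemma cabs_ge0 a : 0 <= cabs a.
Proof. by rewrite -lecR -cabsE normr_ge0. Qed.

Lemma cabs_sqr a : cabs a ^+ 2 = complex.Re a ^+ 2 + complex.Im a ^+ 2.
Proof. by apply: complexI; rewrite add_Re2_Im2 cabsE !rmorphXn. Qed.

Lemma cabs_eq0 a : cabs a = 0 -> a = 0.
Proof. by move=> a0; apply: normr0_eq0; rewrite cabsE a0. Qed.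

Lemma cabsM a b : cabs (a * b) = cabs a * cabs b.
Proof. by apply: complexI; rewrite rmorphM /= -!cabsE normrM. Qed.

Lemma cabsD a b : cabs (a + b) <= cabs a + cabs b.
Proof. by rewrite -lecR rmorphD /= -!cabsE ler_normD. Qed.

Lemma cabsV a : cabs a^-1 = (cabs a)^-1.
Proof. by apply: complexI; rewrite fmorphV /= -!cabsE normfV. Qed.

Lemma cabsN a : cabs (- a) = cabs a.
Proof. by rewrite /cabs normrN. Qed.

Lemma cabs_real (r : R) : cabs r%:C = `|r|.
Proof.
apply/eqP; rewrite -(@eqrXn2 _ 2) ?cabs_ge0 //.
by rewrite cabs_sqr /= expr0n addr0 real_normK // num_real.
Qed.

Lemma Re_le_cabs a : complex.Re a <= cabs a.
Proof.
have := cabs_sqr a; have := cabs_ge0 a; have := sqr_ge0 (complex.Im a).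
by move: (complex.Re a) (complex.Im a) (cabs a) => x y c; nra.
Qed.

(* [V], [q], [c] and [D1 - D2] are the quantities of the energy balance in
   [scattering_contraction]; taking the imaginary part of the balance divided by
   [k] gives the sign. *)
Lemma passivity_le0 (k V q c D1 D2 : R[i]) (s := 2 * k * (k + 'i)) :
  0 < complex.Im k -> complex.Im V = 0 -> 0 <= complex.Re V ->
  complex.Im q = 0 -> 0 <= complex.Re q ->
  complex.Im D1 = 0 -> complex.Im D2 = 0 -> complex.Re D2 <= complex.Re D1 ->
  D1 - D2 = k * k * V + 2 * 'i * (k * q + c) ->
  complex.Re (s^* * ((k + 'i) * c) + s * ((k + 'i) * c)^* + s * (s^* * q)) <= 0.
Proof.
rewrite {}/s -complexiE; case: k V q c D1 D2 => [p r] [V v] [q q'] [x y] [d1 d1'] [d2 d2'].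
move=> /= r0 -> V0 -> q0 -> -> d21 [e1 e2].
(* The combination [p * e2 - r * e1] is the imaginary part of the balance multiplied by the
   conjugate of [k]; it reads [2 Z = - r (d1 - d2) - r |k|^2 V], with [Z] the quantity bounded in
   [Z0]. *)
have a1 := congr1 ( *%R r) e1; have a2 := congr1 ( *%R p) e2.
have a3 : 0 <= r * (d1 - d2) by rewrite mulr_ge0 ?subr_ge0 // ltW.
have a4 : 0 <= r * (p * p + r * r) * V.
  by rewrite mulr_ge0 // mulr_ge0 ?(ltW r0) // addr_ge0 // -expr2 sqr_ge0.
have Z0 : p * x + r * y + (p * p + r * r) * q <= 0 by lra.
(* The factor comes from [conj s (k + i) = 2 |k + i|^2 conj k]. *)
rewrite (_ : _ + _ = 4 * (p * p + (r + 1) * (r + 1)) *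
  (p * x + r * y + (p * p + r * r) * q)); last by ring.
by rewrite mulr_ge0_le0 // mulr_ge0 // addr_ge0 // -expr2 sqr_ge0.
Qed.

End ComplexScalars.

Section Norm.
Variables (R : realType) (E : completeNormedModType R[i]).
Implicit Types (x y : E) (e : R).

Definition nrm x : R := complex.Re `|x|.

Lemma nrmE x : `|x| = (nrm x)%:C.
Proof. by rewrite /nrm RRe_real // normr_real. Qed.

Lemma nrm_ge0 x : 0 <= nrm x.
Proof. by rewrite -lecR -nrmE normr_ge0. Qed.

Lemma nrm0 : nrm 0 = 0.
Proof. by apply: complexI; rewrite -nrmE normr0. Qed.

Lemma nrm_eq0 x : nrm x = 0 -> x = 0.
Proof. by move=> x0; apply: normr0_eq0; rewrite nrmE x0. Qed.

Lemma nrm_gt0 x : x != 0 -> 0 < nrm x.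
Proof. by move=> x0; rewrite -ltcR -nrmE normr_gt0. Qed.

Lemma nrmD x y : nrm (x + y) <= nrm x + nrm y.
Proof. by rewrite -lecR rmorphD /= -!nrmE ler_normD. Qed.

Lemma nrmN x : nrm (- x) = nrm x.
Proof. by rewrite /nrm normrN. Qed.

Lemma nrmB x y : nrm (x - y) = nrm (y - x).
Proof. by rewrite /nrm distrC. Qed.

Lemma nrmZ (a : R[i]) x : nrm (a *: x) = cabs a * nrm x.
Proof. by apply: complexI; rewrite rmorphM /= -cabsE -!nrmE normrZ. Qed.

Lemma nrm_small x : (forall e, 0 < e -> nrm x < e) -> x = 0.
Proof.
move=> h; apply: nrm_eq0; apply/eqP; rewrite eq_le nrm_ge0 andbT leNgt.
by apply/negP => /h; rewrite ltxx.
Qed.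

Lemma nrm_sqr_le0 x : nrm x ^+ 2 <= 0 -> x = 0.
Proof.
move=> h; apply: nrm_eq0; apply/eqP; rewrite -sqrf_eq0.
by rewrite eq_le h sqr_ge0.
Qed.

Lemma near_nrm x (P : set E) :
  nbhs x P <-> exists2 e, 0 < e & forall y, nrm (x - y) < e -> P y.
Proof.
split=> [/nbhs_normP[e /= e0 eP]|[e e0 eP]].
  have eR : e = (complex.Re e)%:C by rewrite RRe_real // gtr0_real.
  exists (complex.Re e); first by rewrite -ltcR -eR.
  by move=> y xy; apply: eP; rewrite /= nrmE eR ltcR.
apply/nbhs_normP; exists e%:C => /=; first by rewrite ltcR.
by move=> y /=; rewrite nrmE ltcR => /eP.
Qed.

Lemma closure_nrm (S : set E) x :
  closure S x <-> forall e, 0 < e -> exists2 y, S y & nrm (x - y) < e.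
Proof.
split=> [clx e e0|h B /near_nrm[e /h[y Sy xy] eB]].
  have /clx[y [Sy xy]] : nbhs x [set y | nrm (x - y) < e].
    by apply/near_nrm; exists e.
  by exists y.
by exists y; split=> //; apply: eB.
Qed.

Lemma closed_nrm (S : set E) x : closed S ->
  (forall e, 0 < e -> exists2 y, S y & nrm (x - y) < e) -> S x.
Proof. by move=> clS h; apply: clS; apply/closure_nrm. Qed.

Lemma closed_pair_nrm (A : set (E * E)) u v : closed A ->
  (forall e, 0 < e -> exists p : E * E,
     [/\ A p, nrm (u - p.1) < e & nrm (v - p.2) < e]) -> A (u, v).
Proof.
move=> clA h; apply: clA => B [[B1 B2] /= [nB1 nB2] B12].
have [e1 e10 hB1] := (near_nrm _ _).1 nB1.
have [e2 e20 hB2] := (near_nrm _ _).1 nB2.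
have [p [Ap p1 p2]] := h (Num.min e1 e2) ltac:(by rewrite lt_min e10).
exists p; split=> //; rewrite [p]surjective_pairing; apply: B12; split => /=.
  by apply: hB1; rewrite (lt_le_trans p1) // ge_min lexx.
by apply: hB2; rewrite (lt_le_trans p2) // ge_min lexx orbT.
Qed.

Lemma closed_graph_nrm (A : set (E * E)) :
  (forall u v, (forall e, 0 < e -> exists p : E * E,
     [/\ A p, nrm (u - p.1) < e & nrm (v - p.2) < e]) -> A (u, v)) ->
  closed A.
Proof.
move=> h [u v] cl; apply: h => e e0.
have [] := cl [set p : E * E | nrm (u - p.1) < e /\ nrm (v - p.2) < e].
  exists ([set y | nrm (u - y) < e], [set y | nrm (v - y) < e]) => /=.
    by split; apply/near_nrm; exists e.
  by case=> y1 y2 /= [].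
by move=> p [Ap [p1 p2]]; exists p.
Qed.

Lemma cvg_nrm (u_ : nat -> E) (l : E) : u_ @ \oo --> l <->
  forall e, 0 < e -> exists N, forall n, (N <= n)%N -> nrm (l - u_ n) < e.
Proof.
split=> [ul e e0|h].
  have /ul[N _ hN] : nbhs l [set y | nrm (l - y) < e].
    by apply/near_nrm; exists e.
  by exists N => n /hN.
move=> B /near_nrm[e /h[N hN] eB].
by exists N => // n /= /hN /eB.
Qed.

Lemma complete_nrm (u_ : nat -> E) :
  (forall e, 0 < e -> exists N, forall m n, (N <= m)%N -> (N <= n)%N ->
     nrm (u_ m - u_ n) < e) ->
  exists l : E, u_ @ \oo --> l.
Proof.
move=> h; apply/cvg_ex; apply: cauchy_cvg; apply/cauchy_exP => e e0.
have eR : e = (complex.Re e)%:C by rewrite RRe_real // gtr0_real.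
have [N hN] := h (complex.Re e) ltac:(by rewrite -ltcR -eR).
exists (u_ N); exists N => // n /= Nn.
by rewrite -ball_normE /= nrmE eR ltcR; apply: hN.
Qed.

End Norm.

(** * Orthogonal projections *)

Section CauchySchwarz.
Variables (R : realType) (U : lmodType R[i]) (s : U -> U -> R[i]).
Hypothesis s_lin : forall a x y z, s (a *: x + y) z = a * s x z + s y z.
Hypothesis s_herm : forall x y, s y x = (s x y)^*.
Hypothesis s_ge0 : forall x, 0 <= complex.Re (s x x).

(** The polynomial [key] is the form at [t x - s(x, y) y]. The form may be degenerate: besides the
    inner product it will be [b((W - m) x, y)], with [m] the bottom of a numerical range. *)
Lemma sesqui_cauchy_schwarz x y :
  cabs (s x y) ^+ 2 <= complex.Re (s x x) * complex.Re (s y y).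
Proof.
have s0 z : s 0 z = 0.
  have := s_lin 1 0 0 z; rewrite scaler0 addr0 mul1r => /eqP.
  by rewrite -subr_eq0 opprD addrA subrr add0r oppr_eq0 => /eqP.
have sZ a u v : s (a *: u) v = a * s u v by rewrite -[a *: u]addr0 s_lin s0 addr0.
have sc a u v : s u (a *: v) = a^* * s u v.
  by rewrite s_herm sZ rmorphM /= -s_herm.
have sD u v w : s u (v + w) = s u v + s u w.
  by rewrite s_herm -[v]scale1r s_lin mul1r rmorphD /= -!s_herm scale1r.
have sxx z : complex.Im (s z z) = 0.
  by have := congr1 (@complex.Im _) (s_herm z z); rewrite ImJ; lra.
set a := complex.Re (s x x); set c := complex.Re (s y y).
have key (t : R) : 0 <= a * t ^+ 2 - 2 * cabs (s x y) ^+ 2 * t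
    + cabs (s x y) ^+ 2 * c.
  have := s_ge0 (t%:C *: x + (- s x y) *: y).
  rewrite sD !sc !s_lin !sZ (s_herm x y) !ReImE /= !(sxx x) !(sxx y) cabs_sqr.
  rewrite -/a -/c.
  by move: (complex.Re (s x y)) (complex.Im (s x y)) => p q; nra.
have a0 : 0 <= a by exact: s_ge0.
have c0 : 0 <= c by exact: s_ge0.
have B0 : 0 <= cabs (s x y) ^+ 2 by exact: sqr_ge0.
move: (cabs (s x y) ^+ 2) key B0 => B key B0.
have [a_eq0|an0] := eqVneq a 0.
  by have := key (c + 1); rewrite a_eq0; nra.
have a_gt0 : 0 < a by rewrite lt_def an0.
(* The minimizer of the polynomial. *)
have := key (B / a).
have -> : a * (B / a) ^+ 2 - 2 * B * (B / a) + B * c = B * (a * c - B) / a.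
  by field.
rewrite pmulr_lge0 ?invr_gt0 //.
have [->|Bn0] := eqVneq B 0; first by move=> _; exact: mulr_ge0.
by rewrite pmulr_rge0 ?subr_ge0 // lt_def Bn0.
Qed.

End CauchySchwarz.

Section Hilbert.
Variables (R : realType) (E : completeNormedModType R[i]).
Variable dot : {dot E for Num.conj}.
Hypothesis dot_norm : forall x, dot x x = `|x| ^+ 2.
Implicit Types (x y z : E) (a : R[i]) (M : set E).

Lemma dotDl x y z : dot (x + y) z = dot x z + dot y z.
Proof. exact: linearDl. Qed.

Lemma dotDr x y z : dot z (x + y) = dot z x + dot z y.
Proof. exact: linearDr. Qed.

Lemma dotNl x z : dot (- x) z = - dot x z.
Proof. exact: linearNl. Qed.

Lemma dotNr x z : dot z (- x) = - dot z x.
Proof. exact: linearNr. Qed.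

Lemma dotZl a x z : dot (a *: x) z = a * dot x z.
Proof. exact: linearZl_LR. Qed.

Lemma dotZr a x z : dot z (a *: x) = a^* * dot z x.
Proof. exact: linearZr_LR. Qed.

Lemma dot0l z : dot 0 z = 0.
Proof. exact: linear0l. Qed.

Lemma dot0r z : dot z 0 = 0.
Proof. exact: linear0r. Qed.

Definition dotE := (dotDl, dotDr, dotNl, dotNr, dotZl, dotZr).

Lemma dotC x y : dot y x = (dot x y)^*.
Proof. by rewrite hermC expr0 mul1r. Qed.

Lemma dot_nrm x : dot x x = (nrm x ^+ 2)%:C.
Proof. by rewrite dot_norm nrmE rmorphXn. Qed.

Lemma Re_dot_nrm x : complex.Re (dot x x) = nrm x ^+ 2.
Proof. by rewrite dot_nrm. Qed.

Lemma dot_cauchy_schwarz x y : cabs (dot x y) <= nrm x * nrm y.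
Proof.
rewrite -(@ler_pXn2r _ 2) ?nnegrE ?cabs_ge0 ?mulr_ge0 ?nrm_ge0 //.
rewrite exprMn -!Re_dot_nrm; apply: sesqui_cauchy_schwarz => [b u v w|u v|u].
- by rewrite !dotE.
- exact: dotC.
- by rewrite Re_dot_nrm sqr_ge0.
Qed.

Lemma dot_eq0 x : dot x x = 0 -> x = 0.
Proof.
rewrite dot_nrm => /(congr1 (@complex.Re _)) /= /eqP.
by rewrite expf_eq0 /= => /eqP/nrm_eq0.
Qed.

Lemma nrm_sqrD x y :
  nrm (x + y) ^+ 2 = nrm x ^+ 2 + nrm y ^+ 2 + 2 * complex.Re (dot x y).
Proof. by rewrite -!Re_dot_nrm !dotE !ReImE (dotC x y) ReJ; lra. Qed.

Lemma dot_approx0 x y c : 0 <= c ->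
  (forall e, 0 < e -> cabs (dot x y) <= c * e) -> dot x y = 0.
Proof.
move=> c0 h; apply: cabs_eq0; apply/eqP; rewrite eq_le cabs_ge0 andbT leNgt.
apply/negP => d0; have := h (cabs (dot x y) / (2 * (c + 1))).
rewrite divr_gt0 ?mulr_gt0 ?ltr_wpDl // => /(_ isT).
rewrite mulrCA -ler_pdivrMl // mulVf ?gt_eqF //.
by rewrite ler_pdivlMr ?mulr_gt0 ?ltr_wpDl //; lra.
Qed.

Lemma subspace_comb M a b x y : is_subspace M -> M x -> M y ->
  M (a *: x + b *: y).
Proof. by move=> [M0 Ml] Mx My; apply: (Ml) => //; rewrite -[b *: y]addr0; apply: Ml. Qed.

Lemma subspaceD M x y : is_subspace M -> M x -> M y -> M (x + y).
Proof. by move=> [_ Ml] Mx My; rewrite -[x]scale1r; apply: Ml. Qed.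

Lemma subspaceZ M a x : is_subspace M -> M x -> M (a *: x).
Proof. by move=> [M0 Ml] Mx; rewrite -[_ *: _]addr0; apply: Ml. Qed.

Lemma subspaceN M x : is_subspace M -> M x -> M (- x).
Proof. by move=> sM Mx; rewrite -scaleN1r; apply: subspaceZ. Qed.

Lemma subspaceB M x y : is_subspace M -> M x -> M y -> M (x - y).
Proof. by move=> sM Mx My; apply: subspaceD => //; apply: subspaceN. Qed.

Lemma closure_subspace M : is_subspace M -> is_subspace (closure M).
Proof.
move=> sM; have [M0 Ml] := sM.
split=> [|a x y /closure_nrm Mx /closure_nrm My]; first exact: subset_closure.
apply/closure_nrm => e e0.
have d0 : 0 < e / (2 * (cabs a + 1)).
  by rewrite divr_gt0 ?mulr_gt0 ?ltr_wpDl ?cabs_ge0.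
have [x' Mx' xx'] := Mx _ d0.
have [y' My' yy'] := My (e / 2) ltac:(by rewrite divr_gt0).
exists (a *: x' + y'); first exact: Ml.
have -> : a *: x + y - (a *: x' + y') = a *: (x - x') + (y - y').
  by rewrite scalerBr opprD addrACA.
rewrite (le_lt_trans (nrmD _ _)) // nrmZ (splitr e) ler_ltD //.
have := cabs_ge0 a => a0.
rewrite (le_trans (ler_wpM2l a0 (ltW xx'))) // mulrA ler_pdivrMr ?mulr_gt0 ?ltr_wpDl //.
have -> : e / 2 * (2 * (cabs a + 1)) = cabs a * e + e by field.
by rewrite lerDl ltW.
Qed.

Lemma parallelogram x y :
  nrm (x + y) ^+ 2 + nrm (x - y) ^+ 2 = 2 * nrm x ^+ 2 + 2 * nrm y ^+ 2.
Proof. by rewrite !nrm_sqrD nrmN dotNr ReN; lra. Qed.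

(** A minimizing sequence for the distance to [M] is Cauchy by the parallelogram identity, because
    midpoints stay in [M]; orthogonality is the first variation at the limit. *)
Lemma orthogonal_projection M x : is_subspace M -> closed M ->
  exists2 p, M p & forall m, M m -> dot (x - p) m = 0.
Proof.
move=> sM clM; have [M0 Ml] := sM.
pose D := [set r : R | exists2 y, M y & r = nrm (x - y) ^+ 2].
have D0 : has_inf D.
  split; first by exists (nrm (x - 0) ^+ 2), 0.
  by exists 0 => r [y _ ->]; exact: sqr_ge0.
pose d := inf D.
have d_le y : M y -> d <= nrm (x - y) ^+ 2.
  by move=> My; apply: ge_inf; [exact: D0.2 | exists y].
have [u_ u_P] : {u_ : nat -> E & forall n,
    M (u_ n) /\ nrm (x - u_ n) ^+ 2 < d + n.+1%:R^-1}.
  apply: (@boolp.choice nat E (fun n y => M y /\ nrm (x - y) ^+ 2 < d + n.+1%:R^-1)) => n.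
  have [r [y My ->] ry] : exists2 r, D r & r < d + n.+1%:R^-1.
    by apply: inf_adherent => //; rewrite invr_gt0.
  by exists y.
have near_min y z e : M y -> M z -> nrm (x - y) ^+ 2 < d + e ->
    nrm (x - z) ^+ 2 < d + e -> nrm (y - z) ^+ 2 < 4 * e.
  move=> My Mz xy xz.
  have := parallelogram (x - y) (x - z).
  have -> : x - y + (x - z) = 2 *: (x - (2^-1 *: y + 2^-1 *: z)).
    rewrite scalerBr scalerDr !scalerA divff ?pnatr_eq0 // !scale1r.
    by rewrite -[2]/(1 + 1) scalerDl scale1r opprD addrACA.
  have -> : x - y - (x - z) = z - y by rewrite opprB addrC addrA subrK.
  rewrite nrmZ exprMn (nrmB z y).
  have -> : cabs (2 : R[i]) = 2 by rewrite /cabs normr_nat.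
  have := d_le _ (subspace_comb 2^-1 2^-1 sM My Mz).
  nra.
have [p up] : exists p : E, u_ @ \oo --> p.
  apply: complete_nrm => e e0.
  have e40 : 0 < e ^+ 2 / 4 by rewrite divr_gt0 ?exprn_gt0.
  pose N := Num.truncn (e ^+ 2 / 4)^-1.
  have hN k : (N <= k)%N -> k.+1%:R^-1 <= e ^+ 2 / 4.
    move=> Nk; rewrite -[e ^+ 2 / 4]invrK lef_pV2 ?posrE ?invr_gt0 //.
    rewrite ltW // (lt_le_trans (truncnS_gt _)) // ler_nat ltnS //.
  exists N => m n Nm Nn.
  rewrite -(@ltr_pXn2r _ 2) ?nnegrE ?nrm_ge0 ?ltW //.
  have [[Mm xm] [Mn xn]] := (u_P m, u_P n).
  have -> : e ^+ 2 = 4 * (e ^+ 2 / 4) by field.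
  by apply: near_min => //; [apply: (lt_le_trans xm)|apply: (lt_le_trans xn)];
    rewrite lerD2l hN.
have Mp : M p.
  apply: closed_nrm => // e /((cvg_nrm _ _).1 up)[N /(_ N (leqnn N)) h].
  by exists (u_ N) => //; exact: (u_P N).1.
exists p => // m Mm.
have p_min t : nrm (x - p) ^+ 2 <= nrm (x - p - t *: m) ^+ 2.
  apply: (@le_trans _ _ d); last first.
    by rewrite -addrA -opprD; apply: d_le; rewrite addrC; apply: Ml.
  (* The limit attains the infimum: if [|x - u_k| <= |x - p|], the squares differ by at most
     [2 |x - p| |p - u_k|], whence the factor [1 + 2 |x - p|]. *)
  apply/ler_addgt0Pr => e e0.
  have na0 := nrm_ge0 (x - p).
  have d0 : 0 < 1 + 2 * nrm (x - p) by lra.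
  have e10 : 0 < e / (1 + 2 * nrm (x - p)) by rewrite divr_gt0.
  have [N hN] := (cvg_nrm _ _).1 up _ e10.
  have [k [Nk ke]] : exists k, (N <= k)%N /\
      k.+1%:R^-1 <= e / (1 + 2 * nrm (x - p)).
    exists (N + Num.truncn ((e / (1 + 2 * nrm (x - p)))^-1)%R)%N.
    split; first exact: leq_addr.
    rewrite -[leRHS]invrK lef_pV2 ?posrE ?invr_gt0 //.
    by rewrite ltW // (lt_le_trans (truncnS_gt _)) // ler_nat ltnS leq_addl.
  have := hN _ Nk; have [_] := u_P k.
  have := nrmD (x - u_ k) (u_ k - p).
  rewrite addrA subrK (nrmB (u_ k)); have := nrm_ge0 (x - u_ k).
  move: ke e10; have -> : e = (e / (1 + 2 * nrm (x - p))) * (1 + 2 * nrm (x - p)).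
    by rewrite divfK // gt_eqF.
  rewrite mulfK ?gt_eqF //.
  move: (e / _) na0 => e1 na0.
  move: (nrm (x - p)) (nrm (x - u_ k)) (nrm (p - u_ k)) k.+1%:R^-1 na0 => a b c q.
  by move=> *; have [?|?] := leP a b; nra.
set a := dot (x - p) m.
(* The variation is taken along [t <x - p, m> m] and divided by [t]; the choice
   [t = 1 / (|m|^2 + 1)] below forces [<x - p, m> = 0]. *)
have key (t : R) : 0 < t -> 2 * cabs a ^+ 2 <= t * cabs a ^+ 2 * nrm m ^+ 2.
  move=> t0; have := p_min (t%:C * a).
  rewrite (nrm_sqrD (x - p)) nrmN nrmZ cabsM cabs_real gtr0_norm // dotNr dotZr -/a.
  rewrite !ReImE /= !exprMn cabs_sqr -/a.
  move: (complex.Re a) (complex.Im a) (nrm m ^+ 2) => r s n.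
  rewrite mul0r subr0 => h.
  have := h; nra.
apply: cabs_eq0; suff /eqP : cabs a ^+ 2 = 0 by rewrite expf_eq0 /= => /eqP.
have n0 : 0 < nrm m ^+ 2 + 1 by rewrite ltr_wpDl // sqr_ge0.
have := key (nrm m ^+ 2 + 1)^-1; rewrite invr_gt0 => /(_ n0).
have a0 := sqr_ge0 (cabs a).
rewrite -mulrA ler_pdivlMl //.
move: (cabs a ^+ 2) a0 (sqr_ge0 (nrm m)) => b *.
by apply/eqP; rewrite eq_le; apply/andP; split; nra.
Qed.

End Hilbert.

(** * Closed subspaces of a Hilbert space *)

Section Subspaces.
Variables (R : realType) (E : completeNormedModType R[i]).
Variable dot : {dot E for Num.conj}.
Hypothesis dot_norm : forall x, dot x x = `|x| ^+ 2.
Implicit Types (x y z : E) (a : R[i]) (M : set E).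

Lemma bounded_inP M (X : E -> E) : bounded_in M X <->
  [/\ forall f, M f -> M (X f),
      forall (a : R[i]) f g, M f -> M g -> X (a *: f + g) = a *: X f + X g &
      exists2 c : R, 0 <= c & forall f, M f -> nrm (X f) <= c * nrm f].
Proof.
split=> -[XM Xl]; last first.
  case=> c c0 cP; split=> //; exists c%:C => f /cP.
  by rewrite !nrmE -rmorphM lecR.
case=> c cP; split=> //; exists (cabs c) => [|f /cP]; first exact: cabs_ge0.
rewrite !nrmE lecE => /andP[_ /= h]; apply: (le_trans h).
rewrite ReM /= mulr0 subr0 ler_wpM2r ?nrm_ge0 //; exact: Re_le_cabs.
Qed.

Lemma bounded_in_id M : bounded_in M id.
Proof. by split=> //; exists 1 => f _; rewrite mul1r. Qed.

Lemma bounded_in_comb M (a c : R[i]) (X Y : E -> E) : is_subspace M ->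
  bounded_in M X -> bounded_in M Y -> bounded_in M (fun f => a *: X f + c *: Y f).
Proof.
move=> sM /bounded_inP[XM Xl [cX cX0 Xc]] /bounded_inP[YM Yl [cY cY0 Yc]].
apply/bounded_inP; split=> [f Mf|d f g Mf Mg|].
- by apply: subspace_comb; [|exact: XM|exact: YM].
- rewrite Xl // Yl // !scalerDr !scalerA addrACA.
  by rewrite (mulrC a d) (mulrC c d).
exists (cabs a * cX + cabs c * cY) => [|f Mf].
  by rewrite addr_ge0 ?mulr_ge0 ?cabs_ge0.
rewrite (le_trans (nrmD _ _)) // !nrmZ mulrDl -!mulrA.
by apply: lerD; apply: ler_wpM2l; rewrite ?cabs_ge0 ?Xc ?Yc.
Qed.

Lemma bounded_in_comp M (X Y : E -> E) :
  bounded_in M X -> bounded_in M Y -> bounded_in M (fun f => X (Y f)).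
Proof.
move=> /bounded_inP[XM Xl [cX cX0 Xc]] /bounded_inP[YM Yl [cY cY0 Yc]].
apply/bounded_inP; split=> [f /YM/XM //|d f g Mf Mg|].
  by rewrite Yl // Xl //; exact: YM.
exists (cX * cY) => [|f Mf]; first exact: mulr_ge0.
by rewrite (le_trans (Xc _ (YM _ Mf))) // -mulrA ler_wpM2l // Yc.
Qed.

Lemma eq_bounded_in M (X Y : E -> E) : is_subspace M -> (forall f, M f -> X f = Y f) ->
  bounded_in M X -> bounded_in M Y.
Proof.
move=> sM XY [XM Xl [c Xc]]; split=> [f Mf|a f g Mf Mg|].
- by rewrite -XY //; exact: XM.
- by rewrite -!XY //; [exact: Xl|exact: sM.2].
by exists c => f Mf; rewrite -XY //; exact: Xc.
Qed.

Lemma dot_closed_orthogonal x : closed [set y | dot y x = 0].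
Proof.
move=> y /closure_nrm h.
apply: (@dot_approx0 _ _ dot y x (nrm x) (nrm_ge0 _)) => e /h[z zx yz].
rewrite -[y](subrK z) dotDl zx addr0 (le_trans (dot_cauchy_schwarz dot_norm _ _)) //.
by rewrite mulrC ler_wpM2l ?nrm_ge0 // ltW.
Qed.

Lemma closure_orthogonal (K : set E) x y :
  (forall v, K v -> dot v y = 0) -> closure K x -> dot x y = 0.
Proof.
move=> h clx; have := dot_closed_orthogonal (x := y).
by apply; apply: closureS clx => v /h.
Qed.

(** The difference of [y] and its projection on the closure of [K] is a vector of [M] orthogonal to
    [K], hence by hypothesis to [y], and so to itself. *)
Lemma closure_approx (K M : set E) y : is_subspace K -> closed M -> is_subspace M ->
  K `<=` M -> M y -> (forall p, M p -> (forall v, K v -> dot v p = 0) ->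
  dot y p = 0) -> closure K y.
Proof.
move=> sK clM sM KM My h.
have sK' := closure_subspace sK.
have [p Kp py] := orthogonal_projection dot_norm y sK' (@closed_closure _ K).
have Mp : M p by apply: clM; apply: closureS Kp.
have yp : dot y (y - p) = 0.
  apply: h => [|v Kv]; first exact: subspaceB.
  by rewrite dotC py ?rmorph0 //; exact: subset_closure.
have /(dot_eq0 dot_norm)/eqP : dot (y - p) (y - p) = 0.
  by rewrite dotDl yp add0r dotNl dotC py // rmorph0 oppr0.
by rewrite subr_eq0 => /eqP ->.
Qed.

(** The last hypothesis makes the range dense in [M]; the lower bound makes the preimages of a
    convergent sequence Cauchy, and the closed graph contains the limit. It serves for [A + k], for
    Lax-Milgram and for the range of [V rho]. *)
Lemma closed_range (S : set (E * E)) M (c : R) : is_subspace S -> closed S ->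
  is_subspace M -> closed M -> (forall u v, S (u, v) -> M v) ->
  0 < c -> (forall u v, S (u, v) -> c * nrm u <= nrm v) ->
  (forall p, M p -> (forall u v, S (u, v) -> dot v p = 0) -> p = 0) ->
  forall y, M y -> exists u, S (u, y).
Proof.
move=> sS clS sM clM SM c0 Sc Sperp y My.
pose K := [set v | exists u, S (u, v)].
have sK : is_subspace K.
  split=> [|a v w [u Suv] [t Stw]]; first by exists 0; exact: sS.1.
  by exists (a *: u + t); exact: (sS.2 a _ _ Suv Stw).
have clKy : closure K y.
  apply: (closure_approx sK clM sM) => // [v [u /SM] //|p Mp hp].
  rewrite (Sperp p Mp) ?dot0r // => u v Suv; apply: hp; by exists u.
have [w_ w_P] : {w_ : nat -> E * E & forall n,
    S (w_ n) /\ nrm (y - (w_ n).2) < n.+1%:R^-1}.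
  apply: (@boolp.choice nat (E * E)
    (fun n w => S w /\ nrm (y - w.2) < n.+1%:R^-1)) => n.
  have [v [u Suv] yv] := (closure_nrm _ _).1 clKy n.+1%:R^-1 ltac:(by rewrite invr_gt0).
  by exists (u, v).
have small e : 0 < e -> exists N, forall n, (N <= n)%N -> nrm (y - (w_ n).2) < e.
  move=> e0; exists (Num.truncn e^-1) => n Nn.
  rewrite (lt_le_trans (w_P n).2) // -[leRHS]invrK lef_pV2 ?posrE ?invr_gt0 //.
  by rewrite ltW // (lt_le_trans (truncnS_gt _)) // ler_nat ltnS.
have [u uP] : exists u : E, (fun n => (w_ n).1) @ \oo --> u.
  apply: complete_nrm => e e0.
  have [N hN] := small (c * e / 2) ltac:(by rewrite divr_gt0 ?mulr_gt0).
  exists N => m n Nm Nn; rewrite -(ltr_pM2l c0).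
  have Sd : S ((w_ m).1 - (w_ n).1, (w_ m).2 - (w_ n).2).
    by have := sS.2 (-1) _ _ (w_P n).1 (w_P m).1; rewrite !scaleN1r addrC.
  rewrite (le_lt_trans (Sc _ _ Sd)) //.
  have -> : (w_ m).2 - (w_ n).2 = (y - (w_ n).2) - (y - (w_ m).2).
    by rewrite opprB [RHS]addrC addrA subrK.
  rewrite (le_lt_trans (nrmD _ _)) // nrmN.
  by have := hN _ Nm; have := hN _ Nn; lra.
exists u; apply: closed_pair_nrm => // e e0.
have [N1 h1] := (cvg_nrm _ _).1 uP _ e0; have [N2 h2] := small _ e0.
exists (w_ (maxn N1 N2)); split; [exact: (w_P _).1| |].
  by apply: h1; exact: leq_maxl.
by apply: h2; exact: leq_maxr.
Qed.

Lemma closed_graph_bounded M (X : E -> E) : is_subspace M -> closed M -> bounded_in M X ->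
  closed (graph_on M X).
Proof.
move=> sM clM /bounded_inP[XM Xl [c c0 Xc]].
apply: closed_graph_nrm => u v h.
have Mu : M u by apply: closed_nrm => // e /h[p [[Mp _] up _]]; exists p.1.
split=> //=; apply/eqP; rewrite -subr_eq0; apply/eqP; apply: nrm_small => e e0.
have e10 : 0 < e / (c + 1) by rewrite divr_gt0 // ltr_wpDl.
have [[p q] [[Mp /= ->] up vp]] := h _ e10.
rewrite -[v](subrK (X p)) -addrA.
have -> : X p - X u = X (-1 *: u + p) by rewrite Xl // scaleN1r addrC.
rewrite (le_lt_trans (nrmD _ _)) //.
have := Xc (-1 *: u + p) (sM.2 _ _ _ Mu Mp).
rewrite scaleN1r addrC nrmB; move: vp up => /=.
have -> : e = e / (c + 1) * (c + 1) by rewrite divfK // gt_eqF // ltr_wpDl.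
rewrite mulfK ?gt_eqF ?ltr_wpDl //; move: (e / _) e10 => e1 e10.
move: (nrm _) (nrm (u - p)) (nrm (X _)) => r s t.
by nra.
Qed.

(** Coercivity bounds [G] below and shows that a vector orthogonal to its range is zero, so
    [closed_range] applies. It is asked of the modulus of the form, because the numerical range to
    come lies in a rotated half-plane. *)
Lemma lax_milgram (N : set E) (G : E -> E) (d : R) : is_subspace N -> closed N ->
  bounded_in N G -> 0 < d ->
  (forall n, N n -> d * nrm n ^+ 2 <= cabs (dot (G n) n)) ->
  (forall n, N n -> d * nrm n <= nrm (G n)) /\
  forall y, N y -> exists2 x, N x & G x = y.
Proof.
move=> sN clN bG d0 coer.
have low n : N n -> d * nrm n <= nrm (G n).
  move=> Nn; have [/eqP|nn0] := eqVneq n 0.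
    by move/eqP ->; rewrite nrm0 mulr0 nrm_ge0.
  rewrite -(ler_pM2r (nrm_gt0 nn0)) -mulrA -expr2.
  exact: le_trans (coer _ Nn) (dot_cauchy_schwarz dot_norm _ _).
split=> // y Ny.
have /bounded_inP[GN Gl _] := bG.
have [u [Nu yu]] : exists u, graph_on N G (u, y).
  apply: (@closed_range _ N d) (y) Ny => // [||||p Np h].
  - split=> [|a [u1 v1] [u2 v2] [/= N1 ->] [/= N2 ->]].
      split=> //=; first exact: sN.1.
      have := Gl 1 0 0 sN.1 sN.1; rewrite !scale1r addr0.
      by move=> /eqP; rewrite -subr_eq0 opprD addrA subrr sub0r oppr_eq0 => /eqP.
    by split=> /=; [exact: sN.2 | rewrite Gl].
  - exact: closed_graph_bounded.
  - by move=> u v [/= Nu ->]; exact: GN.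
  - by move=> u v [/= Nu ->]; exact: low.
  have := coer _ Np; rewrite (h p (G p)) // /cabs normr0 /= => h0.
  apply: nrm_eq0; apply/eqP; rewrite eq_le nrm_ge0 andbT leNgt; apply/negP => p0.
  have : 0 < d * nrm p ^+ 2 by rewrite mulr_gt0 ?exprn_gt0.
  by lra.
by exists u.
Qed.

(** The orthogonal complement in [M] of the kernel of [phi] is spanned by [p]. Linearity is asked on
    [M] only, since [adj_range] supplies a choice function that is meaningful on [M] alone. *)
Lemma riesz M (phi : E -> R[i]) (c : R) : is_subspace M -> closed M ->
  0 <= c -> (forall a x y, M x -> M y -> phi (a *: x + y) = a * phi x + phi y) ->
  (forall x, M x -> cabs (phi x) <= c * nrm x) ->
  exists2 y, M y & forall x, M x -> phi x = dot x y.
Proof.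
move=> sM clM c0 phil phic.
have [h|] := pselect (forall x, M x -> phi x = 0).
  by exists 0 => [|x /h ->]; [exact: sM.1 | rewrite dot0r].
move=> /existsNP[x0 /not_implyP[Mx0 /eqP x0n]].
pose K := [set x | M x /\ phi x = 0].
have phi0 : phi 0 = 0.
  have := phil 1 0 0 sM.1 sM.1; rewrite scaler0 addr0 mul1r.
  by move=> /eqP; rewrite -subr_eq0 opprD addrA subrr sub0r oppr_eq0 => /eqP.
have sK : is_subspace K.
  split=> [|a x y [Mx px] [My py]]; first by split=> //; exact: sM.1.
  by split; [exact: sM.2 | rewrite phil // px py mulr0 addr0].
have clK : closed K.
  move=> x /closure_nrm h.
  have Mx : M x by apply: closed_nrm => // e /h[y [My _] xy]; exists y.
  split=> //; apply: cabs_eq0; apply/eqP; rewrite eq_le cabs_ge0 andbT.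
  apply/ler_addgt0Pr => e e0; rewrite add0r.
  have d0 : 0 < c + 1 by rewrite ltr_wpDl.
  have [y [My py] xy] := h (e / (c + 1)) ltac:(by rewrite divr_gt0).
  have Mxy : M (x - y) by exact: subspaceB.
  have -> : phi x = phi (x - y).
    by rewrite -[x - y]addrC -scaleN1r phil // py mulr0 add0r.
  rewrite (le_trans (phic _ Mxy)) //.
  move: xy; rewrite ltr_pdivlMr // => xy.
  by have := nrm_ge0 (x - y); nra.
have [k Kk kp] := orthogonal_projection dot_norm x0 sK clK.
pose p := x0 - k.
have Mp : M p by apply: subspaceB => //; exact: Kk.1.
have pp : phi p = phi x0.
  by rewrite /p addrC -scaleN1r phil ?Kk.2 ?mulr0 ?add0r //; exact: Kk.1.
have pn : phi p != 0 by rewrite pp.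
have dn : dot p p != 0.
  apply: contraNneq pn => /(dot_eq0 dot_norm) ->; exact/eqP.
exists (((phi p) / dot p p)^* *: p) => [|x Mx]; first exact: subspaceZ.
have : dot p (x - (phi x / phi p) *: p) = 0.
  apply: kp; split; first by apply: subspaceB => //; exact: subspaceZ.
  by rewrite addrC -scaleNr phil // mulNr divfK // addNr.
rewrite dotDr dotNr dotZr => /eqP; rewrite subr_eq0 => /eqP xp.
rewrite dotZr conjCK (dotC dot p x) xp rmorphM /= conjCK -(dotC dot p p).
by field; rewrite pn dn.
Qed.

Lemma dot_ext x y : (forall z, dot x z = dot y z) -> x = y.
Proof.
move=> h; apply/eqP; rewrite -subr_eq0; apply/eqP; apply: (dot_eq0 dot_norm).
by rewrite dotDl dotNl h subrr.
Qed.

(** [oproj] as a function; the default value 0 stands for no projection, a case that does not occur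
    for a closed subspace. *)
Definition proj M x : E := xget 0 [set p | oproj dot M (x, p)].

Section Projection.
Variable M : set E.
Hypotheses (sM : is_subspace M) (clM : closed M).

Lemma projP x : oproj dot M (x, proj M x).
Proof.
have [p Mp xp] := orthogonal_projection dot_norm x sM clM.
by rewrite /proj; apply: (@xgetPex _ 0 [set q | oproj dot M (x, q)]); exists p.
Qed.

Lemma proj_in x : M (proj M x).
Proof. exact: (projP x).1. Qed.

Lemma dot_proj x m : M m -> dot (proj M x) m = dot x m.
Proof.
move=> Mm; have := (projP x).2 m Mm; rewrite /= dotDl dotNl => /eqP.
by rewrite subr_eq0 => /eqP.
Qed.

Lemma dot_projr x m : M m -> dot m (proj M x) = dot m x.
Proof. by move=> Mm; rewrite dotC dot_proj // -dotC. Qed.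

Lemma subspace_ext x y : M x -> M y -> (forall m, M m -> dot x m = dot y m) -> x = y.
Proof.
move=> Mx My h; apply/eqP; rewrite -subr_eq0; apply/eqP.
apply: (dot_eq0 dot_norm).
by rewrite dotDl dotNl h ?subrr //; exact: subspaceB.
Qed.

Lemma proj_uniq x p : oproj dot M (x, p) -> p = proj M x.
Proof.
move=> [/= Mp xp]; apply: subspace_ext => // [|m Mm]; first exact: proj_in.
rewrite dot_proj //; have := xp m Mm; rewrite dotDl dotNl => /eqP.
by rewrite subr_eq0 => /eqP.
Qed.

Lemma proj_id x : M x -> proj M x = x.
Proof. by move=> Mx; apply/esym/proj_uniq; split=> //= m _; rewrite subrr dot0l. Qed.

Lemma proj_linear a x y : proj M (a *: x + y) = a *: proj M x + proj M y.
Proof.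
apply/esym/proj_uniq; split=> /= [|m Mm].
  by apply: sM.2; exact: proj_in.
by rewrite !(dotDl, dotNl, dotZl) !dot_proj // subrr.
Qed.

Lemma nrm_proj x : nrm (proj M x) <= nrm x.
Proof.
rewrite -(@ler_pXn2r _ 2) ?nnegrE ?nrm_ge0 //.
rewrite -[in leRHS](subrK (proj M x) x) (nrm_sqrD dot_norm).
by rewrite (projP x).2 ?mulr0 ?addr0 ?lerDr ?sqr_ge0 //; exact: proj_in.
Qed.

End Projection.

End Subspaces.

(* Linear identities between vectors become ring identities after pairing both
   sides with an arbitrary vector. *)
Ltac vec dot_norm :=
  apply: (dot_ext dot_norm) => ?; rewrite ?(dotDl, dotNl, dotZl, dot0l); try ring.

(** * Maximal symmetric operators *)

(* The setting of [M = H_rho] and [A = B_rho]; [ms_defect] says [m_- = 0]. *)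
Record maximal_symmetric_in (R : realType) (E : completeNormedModType R[i])
    (dot : {dot E for Num.conj}) (M : set E) (A : set (E * E)) : Prop :=
  MaximalSymmetricIn {
    ms_dot_norm : forall x, dot x x = `|x| ^+ 2;
    ms_subspace : is_subspace M;
    ms_closed : closed M;
    ms_in : forall u v, A (u, v) -> M u /\ M v;
    ms_op_subspace : is_subspace A;
    ms_op_closed : closed A;
    ms_dense : M `<=` closure (opdom A);
    ms_symmetric : A `<=` adjoint dot M A;
    ms_defect : forall p, adjoint dot M A (p, 'i *: p) -> p = 0
  }.

Section SymmetricOperator.
Variables (R : realType) (E : completeNormedModType R[i]).
Variables (dot : {dot E for Num.conj}) (M : set E) (A : set (E * E)).
Hypothesis A_ms : maximal_symmetric_in dot M A.

Let dot_norm := ms_dot_norm A_ms.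
Let sM := ms_subspace A_ms.
Let clM := ms_closed A_ms.
Let AM u v (Auv : A (u, v)) : M u /\ M v := ms_in A_ms Auv.
Let sA := ms_op_subspace A_ms.
Let clA := ms_op_closed A_ms.
Let dA := ms_dense A_ms.
Let symA := ms_symmetric A_ms.
Let defA p (Ap : adjoint dot M A (p, 'i *: p)) : p = 0 := ms_defect A_ms Ap.

Local Notation As := (adjoint dot M A).
Local Notation i := ('i : R[i]).
Implicit Types (k : R[i]) (u v w f g h p : E).

Lemma i_sqr : i * i = -1.
Proof. by rewrite -expr2 sqrCi. Qed.

Lemma i_neq0 : i != 0.
Proof. exact: neq0Ci. Qed.

Lemma i_conj : i^* = - i.
Proof. exact: conjCi. Qed.

Lemma adj_sub p q a p' q' : As (p, q) -> As (p', q') ->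
  As (a *: p + p', a *: q + q').
Proof.
move=> [/= Mp Mq h] [/= Mp' Mq' h']; split=> /= [||u v Auv]; try exact: sM.2.
by rewrite !dotDr !dotZr (h _ _ Auv) (h' _ _ Auv).
Qed.

Lemma adj_subspace : is_subspace As.
Proof.
split=> [|a [p q] [p' q']]; last exact: adj_sub.
by split=> /=; [exact: sM.1|exact: sM.1|move=> u v _; rewrite !dot0r].
Qed.

Lemma adj_add p q p' q' : As (p, q) -> As (p', q') -> As (p + p', q + q').
Proof. by move=> h h'; have := adj_sub 1 h h'; rewrite !scale1r. Qed.

Lemma adj_scale p q a : As (p, q) -> As (a *: p, a *: q).
Proof. by move=> h; have := adj_sub a h adj_subspace.1; rewrite !addr0. Qed.

Lemma adj_diff p q p' q' : As (p, q) -> As (p', q') -> As (p - p', q - q').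
Proof.
by move=> h h'; have := adj_sub (-1) h' h; rewrite !scaleN1r ![- _ + _]addrC.
Qed.

Lemma op_add u v u' v' : A (u, v) -> A (u', v') -> A (u + u', v + v').
Proof. by move=> h h'; have := sA.2 1 _ _ h h'; rewrite scale1r. Qed.

Lemma op_diff u v u' v' : A (u, v) -> A (u', v') -> A (u - u', v - v').
Proof.
by move=> h h'; have := sA.2 (-1) _ _ h' h; rewrite scaleN1r addrC.
Qed.

Lemma op_scale u v a : A (u, v) -> A (a *: u, a *: v).
Proof. by move=> h; have := sA.2 a _ _ h sA.1; rewrite addr0. Qed.

Lemma adj_dot p q u v : As (p, q) -> A (u, v) -> dot v p = dot u q.
Proof. by move=> [_ _ h] /h. Qed.

Lemma adj_dotr p q u v : As (p, q) -> A (u, v) -> dot p v = dot q u.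
Proof. by move=> Apq Auv; rewrite dotC (adj_dot Apq Auv) -dotC. Qed.

Lemma op_dense p : M p -> (forall u v, A (u, v) -> dot u p = 0) -> p = 0.
Proof.
move=> Mp h; apply: (dot_eq0 dot_norm).
apply: (closure_orthogonal dot_norm _ (dA Mp)) => u [v]; exact: h.
Qed.

Lemma adj_fun p q q' : As (p, q) -> As (p, q') -> q = q'.
Proof.
move=> h h'; apply/eqP; rewrite -subr_eq0; apply/eqP; apply: op_dense.
  by apply: subspaceB => //; [case: h | case: h'].
by move=> u v Auv; rewrite dotDr dotNr -(adj_dot h Auv) -(adj_dot h' Auv) subrr.
Qed.

Lemma op_fun u v v' : A (u, v) -> A (u, v') -> v = v'.
Proof. by move=> /symA h /symA h'; exact: adj_fun h h'. Qed.

Lemma op_sym u v u' v' : A (u, v) -> A (u', v') -> dot v u' = dot u v'.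
Proof. by move=> Auv /symA h; exact: adj_dot h Auv. Qed.

(** Symmetry makes [<A u, u>] real, so the imaginary part of [<(A + k) u, u>] is [Im k |u|^2]. *)
Lemma op_lower_bound k u v : A (u, v) -> 0 < complex.Im k ->
  complex.Im k * nrm u <= nrm (v + k *: u).
Proof.
move=> Auv k0; have [->|un0] := eqVneq u 0.
  by rewrite nrm0 mulr0 nrm_ge0.
rewrite -(ler_pM2r (nrm_gt0 un0)) (le_trans _ (dot_cauchy_schwarz dot_norm _ _)) //.
rewrite -mulrA -expr2 -(Re_dot_nrm dot_norm).
have -> : complex.Im k * complex.Re (dot u u) = complex.Im (dot (v + k *: u) u).
  rewrite dotDl dotZl !ReImE.
  have := op_sym Auv Auv; rewrite (dotC dot v u) => /(congr1 (@complex.Im _)).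
  rewrite ImJ (dot_nrm dot_norm) /= => h.
  by have -> : complex.Im (dot v u) = 0; lra.
have := Re_le_cabs (- i * dot (v + k *: u) u).
by rewrite cabsM cabsN /cabs normCi mul1r !ReImE; lra.
Qed.

(** A vector orthogonal to the range of [A + k] is an eigenvector of [A^*] for [- conj k], so
    [closed_range] applies to the graph of [A + k]. *)
Lemma op_range k : 0 < complex.Im k ->
  (forall p, As (p, - k^* *: p) -> p = 0) ->
  forall g, M g -> exists u, A (u, g - k *: u).
Proof.
move=> k0 hk g Mg.
pose S := [set p : E * E | A (p.1, p.2 - k *: p.1)].
suff [u Su] : exists u, S (u, g) by exists u.
apply: (@closed_range _ _ dot dot_norm S M (complex.Im k)) => // [||||p Mp h].
- split=> [|a [u v] [u' v'] /= h h']; first by rewrite /S /= scaler0 subr0; exact: sA.1.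
  rewrite /S /=; have := sA.2 a _ _ h h'; congr (A _); congr (_, _) => /=.
  by rewrite scalerBr scalerDr !scalerA (mulrC a) opprD addrACA.
- apply: closed_graph_nrm => u v h; apply: (closed_pair_nrm clA) => e e0.
  have e10 : 0 < e / (cabs k + 1) by rewrite divr_gt0 // ltr_wpDl // cabs_ge0.
  have [[u1 v1] [Su /= uu vv]] := h _ e10.
  have e1e : e / (cabs k + 1) <= e.
    by rewrite ler_pdivrMr ?ltr_wpDl ?cabs_ge0 // mulrDr mulr1 lerDr mulr_ge0 ?cabs_ge0 // ltW.
  exists (u1, v1 - k *: u1); split=> //=; first exact: lt_le_trans uu e1e.
  have -> : v - k *: u - (v1 - k *: u1) = (v - v1) + (- k) *: (u - u1).
    by vec dot_norm.
  rewrite (le_lt_trans (nrmD _ _)) // nrmZ cabsN.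
  have -> : e = e / (cabs k + 1) * (cabs k + 1).
    by rewrite divfK // gt_eqF // ltr_wpDl // cabs_ge0.
  have := cabs_ge0 k; have := nrm_ge0 (u - u1); move: uu vv.
  by move: (nrm (u - u1)) (nrm (v - v1)) (cabs k) (e / _) => *; nra.
- move=> u v Suv; have [Mu Mv] := AM Suv; rewrite -[v](subrK (k *: u)).
  by apply: subspaceD => //; apply: subspaceZ.
- by move=> u v Suv; have := op_lower_bound Suv k0; rewrite /= subrK.
- apply: hk; split=> //= [|u v Auv]; first exact: subspaceZ.
  have : S (u, v + k *: u) by rewrite /S /= addrK.
  move=> /h; rewrite dotDl dotZl dotZr rmorphN /= conjCK mulNr => /eqP.
  by rewrite addr_eq0 => /eqP.
Qed.

Definition defect h := As (h, - i *: h).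

Lemma defect_in h : defect h -> M h.
Proof. by case. Qed.

Lemma defect_dot h u v : defect h -> A (u, v) -> dot v h = i * dot u h.
Proof. by move=> Nh /(adj_dot Nh) ->; rewrite dotZr rmorphN /= i_conj opprK. Qed.

Lemma defect_subspace : is_subspace defect.
Proof.
split=> [|a h h' Nh Nh']; first by rewrite /defect scaler0; exact: adj_subspace.1.
rewrite /defect scalerDr scalerA mulrC -scalerA; exact: adj_sub.
Qed.

Lemma defect_closed : closed defect.
Proof.
move=> h /closure_nrm clh.
have Mh : M h by apply: closed_nrm => // e /clh[h' /defect_in Mh' hh']; exists h'.
split=> //= [|u v Auv]; first exact: subspaceZ.
rewrite dotZr rmorphN /= i_conj opprK.
have : dot h (v - i *: u) = 0.
  apply: (dot_closed_orthogonal dot_norm); apply/closure_nrm => e /clh[h' Nh' hh'].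
  exists h' => //=; rewrite dotC dotDl dotNl dotZl (defect_dot Nh' Auv) subrr.
  by rewrite rmorph0.
rewrite dotC dotDl dotNl dotZl => /(congr1 Num.conj); rewrite /= conjCK rmorph0.
by move=> /eqP; rewrite subr_eq0 => /eqP.
Qed.

Lemma range_plus_i g : M g -> exists u, A (u, g - i *: u).
Proof.
apply: op_range => [|p]; first by rewrite Im_i ltr01.
by rewrite i_conj opprK; exact: defA.
Qed.

(** Von Neumann's formula when [m_- = 0]: if [u] solves [(A + i) u = (A^* + i) f], then [f - u] lies
    in the defect space. *)
Lemma adj_decomp f g : As (f, g) -> exists u v h,
  [/\ A (u, v), defect h, f = u + h & g = v - i *: h].
Proof.
move=> Afg; have Mf : M f by case: Afg.
have Mg : M g by case: Afg.
have [u Au] := range_plus_i (subspaceD sM Mg (subspaceZ i sM Mf)).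
exists u, (g + i *: f - i *: u), (f - u); split=> //.
- have := adj_diff Afg (symA Au).
  by rewrite /defect; congr (As (_, _)); vec dot_norm.
- by vec dot_norm.
- by vec dot_norm.
Qed.

(** [A] is symmetric, so only the defect components survive. *)
Lemma green u v h u' v' h' : A (u, v) -> defect h -> A (u', v') -> defect h' ->
  dot (v - i *: h) (u' + h') - dot (u + h) (v' - i *: h') = - (2 * i) * dot h h'.
Proof.
move=> Auv Nh Auv' Nh'.
have e1 := op_sym Auv Auv'; have e2 := defect_dot Nh' Auv.
have e3 : dot h v' = - i * dot h u' by rewrite (adj_dotr Nh Auv') dotZl.
rewrite !dotDl !dotDr !dotNl !dotNr !dotZl !dotZr e1 e2 e3 i_conj.
by ring.
Qed.

(** Carries [m_- = 0] from [i] to the whole upper half-plane: Green's identity at [p] reads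
    [Im w |p|^2 = - |h|^2], where [h] is the defect component of [p]. *)
Lemma adj_eigen p (w : R[i]) : As (p, w *: p) -> 0 < complex.Im w -> p = 0.
Proof.
move=> Ap w0; have [u [v [h [Auv Nh pE wE]]]] := adj_decomp Ap.
have := green Auv Nh Auv Nh; rewrite -pE -wE dotZl dotZr.
rewrite !(dot_nrm dot_norm) => /(congr1 (@complex.Im _)); rewrite !ReImE /= => e.
apply: nrm_sqr_le0.
have : complex.Im w * nrm p ^+ 2 = - nrm h ^+ 2 by lra.
have := sqr_ge0 (nrm h); have := sqr_ge0 (nrm p).
move: (nrm p ^+ 2) (nrm h ^+ 2) => a b *.
by nra.
Qed.

(** When [A^* p = 0], Green's identity at [p] kills its defect component. *)
Lemma adj_ker0 p : As (p, 0) -> A (p, 0).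
Proof.
move=> Ap; have [u [v [h [Auv Nh pE wE]]]] := adj_decomp Ap.
have := green Auv Nh Auv Nh; rewrite -pE -wE dot0l dot0r subrr => /esym/eqP.
rewrite mulf_eq0 oppr_eq0 mulf_eq0 pnatr_eq0 (negbTE i_neq0) /= => /eqP.
move/(dot_eq0 dot_norm) => h0; move: pE wE; rewrite h0 scaler0 subr0 addr0.
by move=> -> ->.
Qed.

Lemma range_plus k g : 0 < complex.Im k -> M g -> exists u, A (u, g - k *: u).
Proof.
move=> k0 Mg; apply: op_range => // p Ap; apply: (adj_eigen Ap).
by rewrite ImN ImJ opprK.
Qed.

(** With [k' = - conj k], the operator [A + k'] has a bounded inverse [r] on [M]; [y] is the adjoint
    of [r] applied to [g], that is, it represents the functional [<r x, g>] of [x]. *)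
Lemma adj_range k g : 0 < complex.Im k -> M g -> exists y, As (y, g + k *: y).
Proof.
move=> k0 Mg; pose k' := - k^*.
have k'0 : 0 < complex.Im k' by rewrite ImN ImJ opprK.
have [r rP] : {r : E -> E & forall x, M x -> A (r x, x - k' *: r x)}.
  apply: (@boolp.choice E E (fun x y => M x -> A (y, x - k' *: y))) => x.
  have [/(range_plus k'0)[u Au]|nMx] := pselect (M x); first by exists u.
  by exists 0.
have r_uniq x u : A (u, x - k' *: u) -> M x -> u = r x.
  move=> Au Mx; have := op_lower_bound (op_diff Au (rP _ Mx)) k'0.
  have -> : x - k' *: u - (x - k' *: r x) + k' *: (u - r x) = 0 by vec dot_norm.
  rewrite nrm0 pmulr_rle0 // => h.
  by apply/eqP; rewrite -subr_eq0; apply/eqP/nrm_eq0/eqP; rewrite eq_le h nrm_ge0.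
have [||x Mx|y My yP] := riesz dot_norm (phi := fun x => dot (r x) g)
    (c := nrm g / complex.Im k') sM clM.
- by rewrite divr_ge0 ?nrm_ge0 // ltW.
- move=> a x y Mx My; rewrite -dotZl -dotDl; congr (dot _ g); apply/esym/r_uniq.
    have := sA.2 a _ _ (rP _ Mx) (rP _ My); congr (A _); congr (_, _) => /=.
    by rewrite scalerBr scalerDr !scalerA (mulrC a) opprD addrACA.
  exact: sM.2.
- rewrite (le_trans (dot_cauchy_schwarz dot_norm _ _)) // mulrC -mulrA.
  rewrite ler_wpM2l ?nrm_ge0 // mulrC ler_pdivlMr // mulrC.
  by have := op_lower_bound (rP _ Mx) k'0; rewrite subrK.
exists y => //; split=> //= [|u v Auv].
  by apply: subspaceD => //; apply: subspaceZ.
have [Mu Mv] := AM Auv.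
have Mvu : M (v + k' *: u) by apply: subspaceD => //; apply: subspaceZ.
have := yP _ Mvu; rewrite -(r_uniq _ u) ?addrK // dotDr dotZr dotDl dotZl /k'.
by rewrite mulNr => ->; rewrite subrK.
Qed.

(** The adjoint of [A^2] is contained in the square of [A^*]. Formally
    [g + f = (A^* - i)(A^* + i) f], so the solution [y] of [(A^* - i) y = g + f] is the candidate
    for [(A^* + i) f]. *)
Lemma adj_square_sub f g : M f -> M g ->
  (forall u v w, A (u, v) -> A (v, w) -> dot w f = dot u g) ->
  exists2 y, As (f, y) & As (y, g).
Proof.
move=> Mf Mg h.
have i0 : 0 < complex.Im i by rewrite Im_i.
have [y Ay] := adj_range i0 (subspaceD sM Mg Mf).
have My : M y by case: Ay.
have Afy : As (f, y - i *: f).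
  split=> //= [|x z Axz]; first by apply: subspaceB => //; exact: subspaceZ.
  have [Mx Mz] := AM Axz.
  (* Every [x] in the domain of [A] is [(A + i) w] with [w] in the domain of [A^2], because
     [A w = x - i w]. *)
  have [w Aw] := range_plus i0 Mx.
  have Az : A (x - i *: w, z - i *: (x - i *: w)).
    by apply: op_diff => //; apply: op_scale.
  have := h _ _ _ Aw Az; have := adj_dot Ay Aw.
  rewrite !dotDl !dotDr !dotNl !dotNr !dotZl !dotZr i_conj !dotDl !dotNl !dotZl => e1 e2.
  have -> : dot z f = dot w g + i * dot x f - i * i * dot w f by rewrite -e2; ring.
  have -> : dot w g = dot x y - i * dot w y - dot w f + i * dot w y by rewrite e1; ring.
  by rewrite i_sqr; ring.
exists (y - i *: f) => //.
have := adj_diff Ay (adj_scale i Afy); congr (As (_, _)).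
by vec dot_norm; rewrite -[X in X = _]addr0; have := i_sqr => h2; ring: h2.
Qed.

(** If the square of [A^*] maps [h] to [- h], then [A^* h + i h] lies in the kernel of [A^* - i],
    which is zero. *)
Lemma bspaceE : bspace dot M A = defect.
Proof.
apply/seteqP; split=> h.
  move=> [w /= A1 A2].
  have := adj_add A2 (adj_scale i A1).
  have -> : -1 *: h + i *: w = i *: (w + i *: h).
    by rewrite scalerDr scalerA i_sqr scaleN1r addrC.
  move/defA/eqP; rewrite addr_eq0 => /eqP wE; move: A1.
  by rewrite wE -scaleNr.
move=> Nh; exists (- i *: h) => //=.
by have := adj_scale (- i) Nh; rewrite scalerA mulrNN i_sqr.
Qed.

(** Follows the factorization [(A - k)(A + k)]: solve [(A^* - k) y = g], split [y = u + h], solve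
    [(A + k) w = u]. The defect part of [g] is then [(A^* - k) h = - (i + k) h]. *)
Lemma range_square k g : 0 < complex.Im k -> M g -> exists w v v' n,
  [/\ A (w, v), A (v, v'), defect n & g = v' - k ^+ 2 *: w + n].
Proof.
move=> k0 Mg; have [y Ay] := adj_range k0 Mg.
have [u [v [h [Auv Nh yE gE]]]] := adj_decomp Ay.
have [Mu _] := AM Auv.
have [w Aw] := range_plus k0 Mu.
exists w, (u - k *: w), (v - k *: (u - k *: w)), (- (i + k) *: h); split=> //.
- by apply: op_diff => //; apply: op_scale.
- by apply: subspaceZ => //; exact: defect_subspace.
rewrite -[LHS](addrK (k *: y)) gE yE.
by vec dot_norm.
Qed.

End SymmetricOperator.

(** * Nonnegativity in the metric of e^Q *)

(* The properties of [J = e^Q] making [(J f, g)] an equivalent inner product. *)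
Record metric_operator (R : realType) (E : completeNormedModType R[i])
    (dot : {dot E for Num.conj}) (J : E -> E) (cJ dJ : R) : Prop :=
  MetricOperator {
    mo_dot_norm : forall x, dot x x = `|x| ^+ 2;
    mo_linear : forall (a : R[i]) x y, J (a *: x + y) = a *: J x + J y;
    mo_ge0 : 0 <= cJ;
    mo_bounded : forall x, nrm (J x) <= cJ * nrm x;
    mo_selfadjoint : forall x y, dot (J x) y = dot x (J y);
    mo_gt0 : 0 < dJ;
    mo_coercive : forall x, dJ * nrm x ^+ 2 <= complex.Re (dot (J x) x)
  }.

Section EquivalentInnerProduct.
Variables (R : realType) (E : completeNormedModType R[i]).
Variables (dot : {dot E for Num.conj}) (J : E -> E) (cJ dJ : R).
Hypothesis J_mo : metric_operator dot J cJ dJ.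

Let dot_norm := mo_dot_norm J_mo.
Let J_lin := mo_linear J_mo.
Let cJ0 := mo_ge0 J_mo.
Let J_bnd := mo_bounded J_mo.
Let J_sa := mo_selfadjoint J_mo.
Let dJ_gt0 := mo_gt0 J_mo.
Let J_pos := mo_coercive J_mo.
Implicit Types (x y u v w : E) (a : R[i]).

Definition jdot x y := dot (J x) y.
Local Notation b := jdot.

Lemma jdot_linl a x y z : b (a *: x + y) z = a * b x z + b y z.
Proof. by rewrite /b J_lin dotDl dotZl. Qed.

Lemma metric_operator0 : J 0 = 0.
Proof.
have := J_lin 1 0 0; rewrite !scale1r addr0 => /eqP.
by rewrite -subr_eq0 opprD addrA subrr sub0r oppr_eq0 => /eqP.
Qed.

Lemma jdot0l z : b 0 z = 0.
Proof. by rewrite /b metric_operator0 dot0l. Qed.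

Lemma jdotDl x y z : b (x + y) z = b x z + b y z.
Proof. by have := jdot_linl 1 x y z; rewrite scale1r mul1r. Qed.

Lemma jdotZl a x z : b (a *: x) z = a * b x z.
Proof. by have := jdot_linl a x 0 z; rewrite addr0 jdot0l addr0. Qed.

Lemma jdotNl x z : b (- x) z = - b x z.
Proof. by rewrite -scaleN1r jdotZl mulN1r. Qed.

Lemma jdotC x y : b y x = (b x y)^*.
Proof. by rewrite /b J_sa -dotC. Qed.

Lemma jdotDr x y z : b z (x + y) = b z x + b z y.
Proof. exact: dotDr. Qed.

Lemma jdotZr a x z : b z (a *: x) = a^* * b z x.
Proof. exact: dotZr. Qed.

Lemma jdotNr x z : b z (- x) = - b z x.
Proof. exact: dotNr. Qed.

Definition jdotE := (jdotDl, jdotDr, jdotNl, jdotNr, jdotZl, jdotZr).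

Lemma Im_jdot x : complex.Im (b x x) = 0.
Proof. by have := congr1 (@complex.Im _) (jdotC x x); rewrite ImJ; lra. Qed.

Lemma jdot_ge0 x : 0 <= complex.Re (b x x).
Proof. by apply: le_trans (J_pos x); rewrite mulr_ge0 ?sqr_ge0 // ltW. Qed.

Lemma metric_operator_eq0 x : J x = 0 -> x = 0.
Proof.
move=> Jx; apply: nrm_sqr_le0; have := J_pos x; rewrite Jx dot0l /=.
by rewrite pmulr_rle0.
Qed.

Lemma jdot_bound x y : cabs (b x y) <= cJ * nrm x * nrm y.
Proof.
apply: (le_trans (dot_cauchy_schwarz dot_norm _ _)).
by rewrite ler_wpM2r ?nrm_ge0.
Qed.

Variable H : set (E * E).
Hypothesis H_sa : selfadjoint b setT H.

Lemma H_sym u v u' v' : H (u, v) -> H (u', v') -> b v u' = b u v'.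
Proof.
move=> Huv; case: H_sa => _ _ <- [_ _ h]; exact: h.
Qed.

Lemma Im_H u v : H (u, v) -> complex.Im (b v u) = 0.
Proof.
move=> Huv; have := H_sym Huv Huv; rewrite (jdotC v u).
by move=> /(congr1 (@complex.Im _)); rewrite ImJ; lra.
Qed.

Hypothesis H_spec : forall z : R[i], ~ resolvent_set setT H z ->
  complex.Im z = 0 /\ 0 <= complex.Re z.

Lemma resolvent_of z : complex.Im z != 0 \/ complex.Re z < 0 ->
  exists W, is_resolvent setT H z W.
Proof.
move=> hz; apply: contrapT => /H_spec[z0 z1].
by case: hz => [|]; [rewrite z0 eqxx | rewrite ltNge z1].
Qed.

(* Otherwise the infimum [m < 0] of the numerical range of a resolvent [W] at a
   negative point would belong to the spectrum of [W]. *)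
Lemma H_nonneg u v : H (u, v) -> 0 <= complex.Re (b v u).
Proof.
move=> Huv; rewrite leNgt; apply/negP => neg.
have un0 : u != 0 by apply: contraTneq neg => ->; rewrite /b dot0r ltxx.
have bpos x : x != 0 -> 0 < complex.Re (b x x).
  by move=> x0; apply: lt_le_trans (J_pos x); rewrite mulr_gt0 ?exprn_gt0 ?nrm_gt0.
have buu := bpos _ un0.
(* With this shift, [x = (H + t) u] gives [b(W x, x) = b(H u, u) + t b(u, u) = b(H u, u) / 2 <
   0]. *)
pose t := - complex.Re (b v u) / (2 * complex.Re (b u u)).
have t0 : 0 < t by rewrite divr_gt0 ?oppr_gt0 ?mulr_gt0.
have [W [bW WH WV]] : exists W, is_resolvent setT H (- t%:C) W.
  by apply: resolvent_of; right; rewrite /= oppr_lt0.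
have /bounded_inP[_ Wl [cW cW0 Wc]] := bW.
have Wx0 : W (v + t%:C *: u) = u by have := WV _ _ Huv; rewrite scaleNr opprK.
have WH' x : H (W x, x - t%:C *: W x) by rewrite -scaleNr; exact: WH.
have W_sa x y : b (W x) y = b x (W y).
  have := H_sym (WH' x) (WH' y); rewrite !jdotE conjC_realC.
  by move/addIr.
pose q x := complex.Re (b x x); pose r x := complex.Re (b (W x) x).
have q_ge0 x : 0 <= q x by exact: jdot_ge0.
have q_lo x : nrm x ^+ 2 <= q x / dJ by rewrite ler_pdivlMr // mulrC J_pos.
have q_hi x : q x <= cJ * nrm x ^+ 2.
  apply: (le_trans (Re_le_cabs _)); apply: (le_trans (jdot_bound _ _)).
  by rewrite expr2 mulrA.
pose K1 := cJ * cW / dJ.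
have K1_ge0 : 0 <= K1 by rewrite divr_ge0 ?mulr_ge0 // ltW.
have r_bound x : `|r x| <= K1 * q x.
  have rc : `|r x| <= cabs (b (W x) x).
    rewrite ler_norml Re_le_cabs andbT lerNl.
    by rewrite -ReN -cabsN Re_le_cabs.
  apply: (le_trans rc); apply: (le_trans (jdot_bound _ _)).
  apply: (@le_trans _ _ (cJ * cW * nrm x ^+ 2)).
    rewrite expr2 mulrA ler_wpM2r ?nrm_ge0 // -mulrA ler_wpM2l //; exact: Wc.
  have -> : K1 * q x = cJ * cW * (q x / dJ) by rewrite /K1; ring.
  by rewrite ler_wpM2l ?mulr_ge0.
pose D := [set s : R | exists2 x, x != 0 & s = r x / q x].
have D_inf : has_inf D.
  split; first by exists (r u / q u), u.
  exists (- K1) => s [x x0 ->]; rewrite ler_pdivlMr ?bpos //.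
  by have /ler_normlP[h _] := r_bound x; lra.
have r0 : r 0 = 0 by rewrite /r /b dot0r.
have q0 : q 0 = 0 by rewrite /q /b dot0r.
have [m mE] : exists m, m = inf D by exists (inf D).
have r_ge x : m * q x <= r x.
  have [->|x0] := eqVneq x 0; first by rewrite r0 q0 mulr0.
  by rewrite -ler_pdivlMr ?bpos // mE; apply: ge_inf; [exact: D_inf.2|exists x].
have m_neg : m < 0.
  have := r_ge (v + t%:C *: u); have x_neg : r (v + t%:C *: u) < 0.
    rewrite /r Wx0 jdotDr jdotZr (jdotC v u) conjC_realC !ReImE /= mul0r subr0.
    have -> : t * complex.Re (b u u) = - complex.Re (b v u) / 2.
      by rewrite /t; field; rewrite gt_eqF.
    by move: neg; lra.
  move=> h; rewrite ltNge; apply/negP => m0.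
  by have := mulr_ge0 m0 (q_ge0 (v + t%:C *: u)); lra.
(* [m] is in the spectrum of [W] only if [1/m - t] is in that of [H]. This point is negative, so
   [W - m] is bounded below: [|x| <= L |(W - m) x|]. *)
have [Ws [bWs WsH WsV]] : exists W, is_resolvent setT H (- (t - m^-1)%:C) W.
  apply: resolvent_of; right; rewrite /= oppr_lt0 subr_gt0.
  by rewrite (lt_trans _ t0) // invr_lt0.
have /bounded_inP[_ _ [cs cs0 Wsc]] := bWs.
pose y x := W x - m%:C *: x.
pose L := (cs / `|m| + 1) / `|m|.
have m_gt0 : 0 < `|m| by rewrite normr_gt0 lt_eqF.
have L0 : 0 <= L by rewrite divr_ge0 ?addr_ge0 ?divr_ge0.
have mC0 : m%:C != 0 :> R[i].
  by apply: contraTneq m_neg => /(congr1 (@complex.Re _)) /= ->; rewrite ltxx.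
have x_le x : nrm x <= L * nrm (y x).
  have xE : x = (m%:C)^-1 *: (W x - y x).
    by rewrite /y opprB addrC subrK scalerA mulVf // scale1r.
  have pE : W x = Ws ((- m%:C^-1) *: y x).
    rewrite -[LHS](WsV _ _ (WH' x)); congr (Ws _).
    rewrite {1}xE; vec dot_norm.
    have -> : (t - m^-1)%:C = t%:C - m%:C^-1 :> R[i].
      by rewrite rmorphB fmorphV.
    by ring.
  rewrite {1}xE nrmZ cabsV cabs_real /L mulrAC [leRHS]mulrC.
  rewrite ler_wpM2l ?invr_ge0 // (le_trans (nrmD _ _)) // nrmN mulrDl mul1r lerD2r.
  rewrite pE (le_trans (Wsc _ _)) // nrmZ cabsN cabsV cabs_real.
  by rewrite mulrA.
pose K := K1 - m; pose Z := cJ * L ^+ 2 / dJ * K + 1.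
have K0 : 0 < K by rewrite subr_gt0 (lt_le_trans m_neg).
have Z0 : 0 < Z.
  apply: (ltr_wpDl _ ltr01); apply: (mulr_ge0 _ (ltW K0)).
  by apply: (divr_ge0 _ (ltW dJ_gt0)); apply: (mulr_ge0 _ (sqr_ge0 _)).
(* Cauchy-Schwarz for the nonnegative form [b((W - m) x1, x2)] at [x] and [y x] turns the lower
   bound of [W - m] into one for its form. Then [m + 1/Z] is still a lower bound of the quotients in
   [D], against [m = inf D]. *)
have q_le x : q x <= Z * (r x - m * q x).
  have sE x1 : complex.Re (b (y x1) x1) = r x1 - m * q x1.
    by rewrite /y !jdotE !ReImE /= mul0r subr0.
  have CS : q (y x) ^+ 2 <= (r x - m * q x) * (K * q (y x)).
    have := @sesqui_cauchy_schwarz _ _ (fun x1 x2 => b (y x1) x2) _ _ _ x (y x).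
    rewrite cabs_sqr Im_jdot expr0n addr0 -/(q _) !sE => h.
    apply: le_trans (h _ _ _) _ => [a x1 x2 x3|x1 x2|x1|].
    - by rewrite /y Wl // !jdotE; ring.
    - by rewrite /y !jdotE rmorphB /= rmorphM /= conjC_realC -!jdotC W_sa.
    - by rewrite sE subr_ge0.
    rewrite ler_wpM2l ?subr_ge0 // /K mulrBl lerD2r.
    by have /ler_normlP[] := r_bound (y x).
  have qy : q (y x) <= K * (r x - m * q x).
    have [->|yn0] := eqVneq (q (y x)) 0.
      by apply: (mulr_ge0 (ltW K0)); rewrite subr_ge0.
    have qy0 : 0 < q (y x) by rewrite lt_def yn0 q_ge0.
    by rewrite -(ler_pM2r qy0) -expr2; move: CS; lra.
  have qx : q x <= cJ * L ^+ 2 / dJ * q (y x).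
    apply: (le_trans (q_hi x)).
    have -> : cJ * L ^+ 2 / dJ * q (y x) = cJ * (L ^+ 2 * (q (y x) / dJ)) by ring.
    rewrite ler_wpM2l // (le_trans _ (ler_wpM2l (sqr_ge0 L) (q_lo _))) //.
    rewrite -exprMn ler_pXn2r ?nnegrE ?nrm_ge0 //.
    by apply: (mulr_ge0 L0); exact: nrm_ge0.
  apply: (le_trans qx); rewrite /Z mulrDl mul1r.
  have h : 0 <= cJ * L ^+ 2 / dJ by apply: (divr_ge0 _ (ltW dJ_gt0)); apply: (mulr_ge0 _ (sqr_ge0 _)).
  rewrite (le_trans (ler_wpM2l h qy)) // mulrA lerDl subr_ge0 //.
have : m + Z^-1 <= m.
  rewrite {2}mE; apply: lb_le_inf; first exact: D_inf.1.
  move=> s [x x0 ->]; rewrite ler_pdivlMr ?bpos //.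
  have := q_le x; rewrite -ler_pdivrMl // => h.
  by rewrite mulrDl; lra.
by rewrite gerDl leNgt invr_gt0 Z0.
Qed.

End EquivalentInnerProduct.

(** * Boundary values of the perturbed operator *)

Section PerturbedOperator.
Variables (R : realType) (E : completeNormedModType R[i]).
Variables (dot : {dot E for Num.conj}) (M : set E) (A : set (E * E)).
Hypothesis A_ms : maximal_symmetric_in dot M A.
Variables (J : E -> E) (cJ dJ : R).
Hypothesis J_mo : metric_operator dot J cJ dJ.
Hypothesis JM : forall f, M f -> M (J f).
Hypothesis JA : intertwines J A A.
Variable H : set (E * E).
Hypothesis H_sa : selfadjoint (jdot dot J) setT H.
Hypothesis H_spec : forall z : R[i], ~ resolvent_set setT H z ->
  complex.Im z = 0 /\ 0 <= complex.Re z.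
Hypothesis H_ext : opcomp A A `<=` H.
Hypothesis H_adj_ext : opcomp A A `<=` adjoint dot setT H.

Let dot_norm := ms_dot_norm A_ms.
Let sM := ms_subspace A_ms.
Let clM := ms_closed A_ms.
Let AM u v (Auv : A (u, v)) : M u /\ M v := ms_in A_ms Auv.
Let sA := ms_op_subspace A_ms.
Let symA := ms_symmetric A_ms.
Local Notation As := (adjoint dot M A).
Local Notation i := ('i : R[i]).
Local Notation b := (jdot dot J).
Local Notation N := (defect dot M A).
Local Notation pM := (proj dot M).
Local Notation pN := (proj dot N).
Let sN : is_subspace N := defect_subspace A_ms.
Let clN : closed N := defect_closed A_ms.
Let jdotE := (jdotDl J_mo, jdotDr, jdotNl J_mo, jdotNr, jdotZl J_mo, jdotZr).
Implicit Types (k : R[i]) (u v w f g h n p : E).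

Lemma perturbed_subspace : is_subspace H.
Proof. by case: H_sa => [[]]. Qed.

Lemma metric_operatorZ (a : R[i]) f : J (a *: f) = a *: J f.
Proof. by have := mo_linear J_mo a f 0; rewrite (metric_operator0 J_mo) !addr0. Qed.

Lemma J_adj p q : As (p, q) -> As (J p, J q).
Proof.
move=> Apq; have [/= Mp Mq _] := Apq; split=> /= [||u v Auv]; try exact: JM.
by rewrite -!(mo_selfadjoint J_mo) (adj_dot Apq (JA Auv)).
Qed.

Lemma J_defect h : N h -> N (J h).
Proof. by rewrite /defect -metric_operatorZ; exact: J_adj. Qed.

Lemma jdot_projM m f : M m -> b m (pM f) = b m f.
Proof. by move=> Mm; rewrite /jdot (dot_projr dot_norm) //; exact: JM. Qed.

Lemma jdot_projN n f : N n -> b n (pN f) = b n f.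
Proof. by move=> Nn; rewrite /jdot (dot_projr dot_norm) //; exact: J_defect. Qed.

(** [H^*] extends [A^2], so the projection of [u] lies in the domain of the adjoint of [A^2], and
    [adj_square_sub] applies. *)
Lemma proj_adj u v : H (u, v) -> exists2 g, As (pM u, g) & As (g, pM v).
Proof.
move=> Huv; apply: (adj_square_sub A_ms) => [||u0 v0 w0 A0 A1].
- exact: proj_in.
- exact: proj_in.
have [Mu0 _] := AM A0; have [_ Mw0] := AM A1.
rewrite !(dot_projr dot_norm) //.
have [_ _ h] : adjoint dot setT H (u0, w0) by apply: H_adj_ext; exists v0.
by rewrite [LHS]dotC [RHS]dotC (h _ _ Huv).
Qed.

(* [A(D(A^2))] is dense in [ran(A^* )] because [ker A^* = ker A]. *)
Lemma adj_range_approx f g : As (f, g) ->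
  closure [set y | exists w w', A (w, y) /\ A (y, w')] g.
Proof.
move=> Afg; apply: (closure_approx dot_norm _ clM sM) => [|y [w [w' [/AM[]]]] //||p Mp hp].
- split=> [|a y y' [w [w' [h1 h2]]] [x [x' [h3 h4]]]].
    by exists 0, 0; split; exact: sA.1.
  exists (a *: w + x), (a *: w' + x').
  by split; [exact: (sA.2 a _ _ h1 h3)|exact: (sA.2 a _ _ h2 h4)].
- by case: Afg.
have i0 : 0 < complex.Im i by rewrite Im_i.
(* [p] is [(A^* - i) y0], and its orthogonality to the given set yields [A^* y0 = 0]. Hence
   [p = - i y0] with [y0] in the kernel of [A], which is orthogonal to the range of [A^*]. *)
have [y0 Ay0] := adj_range A_ms i0 Mp.
have My0 : M y0 by case: Ay0.
have Ay00 : As (y0, 0).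
  split=> //= [|x z Axz]; first exact: sM.1.
  have [Mx _] := AM Axz.
  have [w Aw] := range_plus A_ms i0 Mx.
  have Ay : A (x - i *: w, z - i *: (x - i *: w)).
    by apply: (op_diff A_ms) => //; apply: (op_scale A_ms).
  have : dot (x - i *: w) p = 0 by apply: hp; exists w, (z - i *: (x - i *: w)).
  have := adj_dot Ay0 Ay.
  move: (x - i *: w) => y; rewrite dotDl dotNl dotZl dotDr dotZr i_conj => e1 e2.
  by rewrite dot0r; move: e1; rewrite e2 => /(canRL (subrK _)) ->; ring.
have pE : p = - i *: y0.
  by apply/eqP; rewrite scaleNr -addr_eq0; apply/eqP; exact: adj_fun Ay0 Ay00.
have := adj_dotr Afg (adj_ker0 A_ms Ay00); rewrite dot0r pE dotZr => <-.
by rewrite mulr0.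
Qed.

(* [H >= 0] applied to [u - w] with [w] in [D(A^2)] and [A w] close to [A^* P_M u]. *)
Lemma energy_lower_bound u v g : H (u, v) -> As (pM u, g) ->
  complex.Re (b g g) <= complex.Re (b v u).
Proof.
move=> Huv Ag; apply/ler_addgt0Pr => e e0.
have cJ0 : 0 < cJ + 1 by rewrite ltr_wpDl //; exact: mo_ge0 J_mo.
have d0 : 0 < Num.min 1 (e / (cJ + 1)) by rewrite lt_min ltr01 divr_gt0.
have [y [w [w' [A1 A2]]] yg] := (closure_nrm _ _).1 (adj_range_approx Ag) _ d0.
have Hw : H (w, w') by apply: H_ext; exists y.
have Huw : H (u - w, v - w').
  by have := perturbed_subspace.2 (-1) _ _ Hw Huv; rewrite scaleN1r addrC.
have := H_nonneg J_mo H_sa H_spec Huw.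
(* In real parts, [b(v - w', u - w) = b(v, u) - 2 b(y, g) + b(y, y) = b(v, u) - b(g, g) + b(g - y, g
   - y)]. *)
have e1 : b v w = (b w' u)^* by rewrite -(jdotC J_mo) (H_sym H_sa Huv Hw).
have e2 : b w' u = b y g.
  have [_ Mw'] := AM A2.
  by rewrite -jdot_projM // /jdot (adj_dot Ag (JA A2)).
have e3 : b w' w = b y y by rewrite /jdot (op_sym A_ms (JA A2) A1).
have : complex.Re (b (g - y) (g - y)) <= e.
  apply: (le_trans (Re_le_cabs _)); apply: (le_trans (jdot_bound J_mo _ _)).
  move: yg; rewrite lt_min => /andP[y1 y2].
  have := nrm_ge0 (g - y); have := mo_ge0 J_mo.
  move: y2; rewrite ltr_pdivlMr // => y2 c0 n0; nra.
rewrite !jdotE e1 e2 e3 (jdotC J_mo y g) !ReImE.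
by lra.
Qed.

(** * Boundary values of the projected resolvent at a fixed [k] *)

Section FixedParameter.
Variable k : R[i].
Hypothesis k_gt0 : 0 < complex.Im k.
Variable W : E -> E.
Hypothesis HW : is_resolvent setT H (k ^+ 2) W.

Lemma resolventD f : H (W f, f + k ^+ 2 *: W f).
Proof. by case: HW => _ h _; exact: h. Qed.

Lemma resolventK u v : H (u, v) -> W (v - k ^+ 2 *: u) = u.
Proof. by case: HW => _ _ h; exact: h. Qed.

Lemma resolvent_linear (a : R[i]) f g : W (a *: f + g) = a *: W f + W g.
Proof. by case: HW => [[_ h _] _ _]; exact: h. Qed.

Lemma kpi_neq0 : k + i != 0.
Proof.
apply/eqP => /(congr1 (@complex.Im _)); rewrite ImD Im_i /= => h.
by move: k_gt0; lra.
Qed.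

Lemma i2_neq0 : 2 * i != 0.
Proof. by rewrite mulf_neq0 ?pnatr_eq0 ?i_neq0. Qed.

Definition compress n := pN (W n).
Local Notation F := compress.

Lemma compressE n : F n = pN (W n).
Proof. by []. Qed.

(* The boundary values [Gamma_0 f] and [Gamma_1 f] of [f = P_M (H - k^2)^-1 n]. *)
Definition trace0 n := (2 * i)^-1 *: ((k + i) *: F n + (k + i)^-1 *: n).
Definition trace1 n := n + (1 + k ^+ 2) *: F n.

Lemma compress_linear (a : R[i]) n n' : F (a *: n + n') = a *: F n + F n'.
Proof. by rewrite /F resolvent_linear (proj_linear dot_norm). Qed.

(** Let [f = P_M W n] and [g = A^* f]. Since [A^* g = k^2 f + n], the vector
    [g + k f + (k + i)^-1 n] satisfies the eigenvalue equation of [A^*] for [k] and vanishes, which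
    is the last equation. Pairing [f = u + h] and [g = v - i h] with the defect space gives
    [2i h = P_N (i f - g)], the formula of [trace0]. *)
Lemma resolvent_proj n : N n -> exists u v,
  [/\ A (u, v), pM (W n) = u + trace0 n,
      As (pM (W n), v - i *: trace0 n),
      As (v - i *: trace0 n, k ^+ 2 *: pM (W n) + n) &
      v - i *: trace0 n = - k *: pM (W n) - (k + i)^-1 *: n].
Proof.
move=> Nn; have Mn := defect_in Nn.
have [g Ag Ag'] := proj_adj (resolventD n).
rewrite addrC (proj_linear dot_norm sM clM) (proj_id dot_norm sM clM Mn) in Ag'.
have gE : g = - k *: pM (W n) - (k + i)^-1 *: n.
  set f := pM (W n) in Ag Ag' *.
  have Ay := adj_add A_ms (adj_add A_ms Ag' (adj_scale A_ms k Ag))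
    (adj_scale A_ms (k + i)^-1 Nn).
  have : g + k *: f + (k + i)^-1 *: n = 0.
    apply: (adj_eigen A_ms _ k_gt0).
    suff -> : k *: (g + k *: f + (k + i)^-1 *: n) =
      k ^+ 2 *: f + n + k *: g + (k + i)^-1 *: (- i *: n) by [].
    by vec dot_norm; field; exact: kpi_neq0.
  by move/eqP; rewrite addr_eq0 => /eqP e; rewrite scaleNr -e; vec dot_norm.
have [u [v [h [Auv Nh fE gE']]]] := adj_decomp A_ms Ag.
suff hE : h = trace0 n by exists u, v; rewrite -hE -gE'.
apply: (subspace_ext dot_norm sN) => // [|m Nm].
  rewrite /trace0; apply: subspaceZ => //; apply: subspaceD => //; apply: subspaceZ => //.
  exact: (proj_in dot_norm sN clN).
have e1 : dot g m = i * dot (pM (W n)) m - 2 * i * dot h m.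
  by rewrite fE gE' !dotDl dotNl dotZl (defect_dot Nm Auv); ring.
have Mm := defect_in Nm.
move: e1; rewrite gE !(dotDl, dotNl, dotZl) (dot_proj dot_norm sM clM) // => e1.
rewrite /compress (dot_proj dot_norm sN clN) //.
apply: (mulfI i2_neq0); rewrite mulrA divff ?i2_neq0 // mul1r.
have -> : 2 * i * dot h m = i * dot (W n) m - (- k * dot (W n) m - (k + i)^-1 * dot n m).
  by rewrite e1; ring.
by ring.
Qed.

Lemma trace0_defect n : N n -> N (trace0 n).
Proof.
move=> Nn; apply: subspaceZ => //; apply: subspaceD => //; apply: subspaceZ => //.
exact: (proj_in dot_norm sN clN).
Qed.

(** Here [v = A u] and [w = A^* A u], so that [Gamma_0 f = h] and [Gamma_1 f = P_N (w + u)]. *)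
Definition boundary_decomp f u v w h := [/\ A (u, v), As (v, w), N h & f = u + h].

Lemma Gamma0P f h : Gamma0 dot M A (f, h) <-> exists u v w, boundary_decomp f u v w h.
Proof.
rewrite /Gamma0 (bspaceE A_ms); split=> [[u /= [[w [v Avw Auv]] Nh fE]]|].
  by exists u, v, w.
by move=> [u [v [w [Auv Avw Nh fE]]]]; exists u; split=> //=; exists w, v.
Qed.

Lemma Gamma1P f g : Gamma1 dot M A (f, g) <->
  exists u v w h, boundary_decomp f u v w h /\ g = pN (w + u).
Proof.
rewrite /Gamma1 (bspaceE A_ms); split=> [[u [w [h /= [[v Auv Avw] Nh fE gE]]]]|].
  by exists u, v, w, h; split=> //; apply: (proj_uniq dot_norm sN clN).
move=> [u [v [w [h [[Auv Avw Nh fE] ->]]]]].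
by exists u, w, h; split=> //=; [exists v|exact: (projP dot_norm sN clN)].
Qed.

(** On the defect space [<A x, x>] would be [- i |x|^2], but it is real. *)
Lemma defect_domain x y : A (x, y) -> N x -> x = 0.
Proof.
move=> Axy Nx; have := op_sym A_ms Axy Axy.
rewrite (adj_fun A_ms (symA Axy) Nx) dotZl dotZr !(dot_nrm dot_norm).
move/(congr1 (@complex.Im _)); rewrite !ReImE /= => e.
by apply: nrm_sqr_le0; lra.
Qed.

Lemma boundary_decomp_uniq f u v w h u' v' w' h' :
  boundary_decomp f u v w h -> boundary_decomp f u' v' w' h' ->
  [/\ u = u', v = v', w = w' & h = h'].
Proof.
move=> [Auv Avw Nh fE] [Auv' Avw' Nh' fE'].
have hE : h' - h = u - u'.
  by rewrite -[h'](addKr u') -fE' fE; vec dot_norm.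
have Ax := op_diff A_ms Auv Auv'.
have Nx : N (u - u') by rewrite -hE; exact: subspaceB.
have x0 : u - u' = 0 := defect_domain Ax Nx.
have uu : u = u' by apply/eqP; rewrite -subr_eq0 x0.
have vv : v = v' by apply: (op_fun A_ms Auv); rewrite uu.
have hh : h = h' by apply/esym/eqP; rewrite -subr_eq0 hE x0.
by split=> //; apply: (adj_fun A_ms Avw); rewrite vv.
Qed.

(** With [f = u + h] the projected resolvent and [v = A^* f + i h], one gets
    [A^* v = k^2 f + n + h], hence [w + u = (1 + k^2) f + n]. *)
Lemma resolvent_traces n : N n -> exists u v w,
  boundary_decomp (pM (W n)) u v w (trace0 n) /\ trace1 n = pN (w + u).
Proof.
move=> Nn; have [u [v [Auv fE Af Ag _]]] := resolvent_proj Nn.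
have Nh := trace0_defect Nn.
pose w := k ^+ 2 *: pM (W n) + n + trace0 n.
have Avw : As (v, w).
  have := adj_add A_ms Ag (adj_scale A_ms i Nh); congr (As (_, _)).
    by vec dot_norm.
  by rewrite /w scalerA mulrN i_sqr opprK scale1r.
exists u, v, w; split=> //.
have -> : w + u = (1 + k ^+ 2) *: pM (W n) + n.
  by rewrite /w -[u](addrK (trace0 n)) -fE; vec dot_norm.
rewrite (proj_linear dot_norm sN clN) (proj_id dot_norm sN clN Nn) addrC.
congr (_ + _ *: _); apply: (subspace_ext dot_norm sN) => [||m Nm].
- exact: (proj_in dot_norm sN clN).
- exact: (proj_in dot_norm sN clN).
rewrite /compress !(dot_proj dot_norm sN clN) // (dot_proj dot_norm sM clM) //.
exact: (defect_in Nm).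
Qed.

Lemma compress_bounded : bounded_in N compress.
Proof.
have [/bounded_inP[_ _ [c c0 Wc]] _ _] := HW.
apply/bounded_inP; split=> [f _|a f g _ _|].
- exact: (proj_in dot_norm sN clN).
- exact: compress_linear.
exists c => // f _; apply: le_trans (Wc f I).
exact: (nrm_proj dot_norm sN clN).
Qed.

Lemma trace0_bounded : bounded_in N trace0.
Proof.
have := bounded_in_comb ((2 * i)^-1 * (k + i)) ((2 * i)^-1 * (k + i)^-1) sN
  compress_bounded (bounded_in_id N).
by apply: eq_bounded_in => // f _; rewrite /trace0 scalerDr !scalerA.
Qed.

Lemma trace1_bounded : bounded_in N trace1.
Proof.
have := bounded_in_comb 1 (1 + k ^+ 2) sN (bounded_in_id N) compress_bounded.
by apply: eq_bounded_in => // f _; rewrite /trace1 scale1r.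
Qed.

Lemma jdot_compress n m : N m -> b (F n) m = b (W n) m.
Proof.
by move=> Nm; rewrite (jdotC J_mo) jdot_projN // -(jdotC J_mo).
Qed.

(* In the metric of [J], [trace1] is the compression of [(H + 1)(H - k^2)^-1],
   whose numerical range is separated from [0] by a half-plane since [k^2] is
   not in [0, +oo[ and [H >= 0]. *)
Lemma trace1_coercive :
  exists2 d : R, 0 < d & forall n, N n -> d * nrm n ^+ 2 <= cabs (b (trace1 n) n).
Proof.
have [z zE] : exists z, z = k ^+ 2 by exists (k ^+ 2).
have [r r_def] : exists r, r = complex.Re k ^+ 2 + complex.Im k ^+ 2.
  by exists (complex.Re k ^+ 2 + complex.Im k ^+ 2).
have Rez : complex.Re z = complex.Re k ^+ 2 - complex.Im k ^+ 2.
  by rewrite zE !expr2 ReM.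
have rE : cabs z = r by rewrite zE expr2 cabsM -expr2 cabs_sqr.
have q0 : 0 < complex.Im k ^+ 2 by exact: exprn_gt0.
have r0 : 0 < r by rewrite r_def ltr_wpDl ?sqr_ge0.
have rz : 0 < r - complex.Re z by rewrite Rez r_def; lra.
(* [|r - z| <= 2r], and [dJ |n|^2 <= b(n, n) <= 2a + 2 r^2 c <= 2(1 + r)(a + r c)], where
   [a = b(H u, H u)] and [c = b(u, u)]. *)
pose d := (r - complex.Re z) / (2 * r) * (2 * (1 + r))^-1 * dJ.
have d0 : 0 < d.
  have r1 : 0 < 1 + r by lra.
  by rewrite !(mulr_gt0, divr_gt0) ?invr_gt0 ?mulr_gt0 //; exact: mo_gt0 J_mo.
exists d => // n Nn; have [u uE] : exists u, u = W n by exists (W n).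
have [v vE] : exists v, v = n + z *: u by exists (n + z *: u).
have Huv : H (u, v) by rewrite vE uE zE; exact: resolventD.
have nE : n = v - z *: u by rewrite vE addrK.
have E1 : b (trace1 n) n = b (v + u) (v - z *: u).
  have -> : v + u = n + (1 + z) *: u by rewrite vE; vec dot_norm.
  by rewrite -nE /trace1 -zE !jdotE jdot_compress // uE.
have := H_nonneg J_mo H_sa H_spec Huv; have := Im_H J_mo H_sa Huv.
have := jdot_ge0 J_mo v; have := Im_jdot J_mo v.
have := jdot_ge0 J_mo u; have := Im_jdot J_mo u.
have vu : b u v = (b v u)^* by exact: (jdotC J_mo).
set a := complex.Re (b v v); set bt := complex.Re (b v u); set c := complex.Re (b u u).
move=> Iu c0 Iv a0 Ivu bt0.
have nn : dJ * nrm n ^+ 2 <= 2 * a + 2 * r * r * c.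
  apply: (le_trans (mo_coercive J_mo n)); rewrite -/(jdot dot J n n).
  have := jdot_ge0 J_mo (v + z *: u).
  rewrite nE !jdotE vu !ReImE Iu Ivu -/a -/bt -/c.
  have : cabs z ^+ 2 = complex.Re z ^+ 2 + complex.Im z ^+ 2 by exact: cabs_sqr.
  rewrite rE; move: (complex.Re z) (complex.Im z) => x y e.
  have e' : r * r * c = (x * x + y * y) * c by rewrite -!expr2 e.
  by lra.
(* Multiplication by [r - z], with [r = |z|], rotates the half-plane: the real part of the product
   is [(r - Re z)(a + (1 + r) b(H u, u) + r c)], and [r - Re z = 2 (Im k)^2 > 0]. *)
have X : (r - complex.Re z) * (a + r * c) <= 2 * r * cabs (b (trace1 n) n).
  have : cabs (r%:C - z) <= 2 * r.
    by rewrite (le_trans (cabsD _ _)) // cabs_real cabsN rE gtr0_norm //; lra.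
  have := Re_le_cabs ((r%:C - z) * b (trace1 n) n); rewrite cabsM => h1 h2.
  apply: (le_trans _ (le_trans h1 (ler_wpM2r (cabs_ge0 _) h2))).
  rewrite E1 !jdotE vu !ReImE Iu Iv Ivu -/a -/bt -/c /=.
  have : cabs z ^+ 2 = complex.Re z ^+ 2 + complex.Im z ^+ 2 by exact: cabs_sqr.
  rewrite rE; clear nn; move: rz bt0 a0 c0 r0; rewrite -/bt -/a -/c.
  move: (complex.Re z) (complex.Im z) a bt c => x y aa bb cc rx bb0 aa0 cc0 rr e.
  have h3 : y * y * (bb + cc) = (r * r - x * x) * (bb + cc).
    by rewrite -[r * r]expr2 e; ring.
  have h4 : 0 <= (r - x) * (bb + r * bb).
    by rewrite mulr_ge0 ?(ltW rx) // addr_ge0 // mulr_ge0 // ltW.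
  by lra.
have r1 : 0 < 1 + r by lra.
have dE : d * nrm n ^+ 2 =
    (r - complex.Re z) / (2 * r) * ((2 * (1 + r))^-1 * (dJ * nrm n ^+ 2)).
  by rewrite /d; ring.
have s0 : 0 <= (r - complex.Re z) / (2 * r) by rewrite divr_ge0 ?mulr_ge0 // ltW.
have s1 : 0 <= (2 * (1 + r))^-1 by rewrite invr_ge0 mulr_ge0 // ltW.
rewrite dE; apply: (@le_trans _ _ ((r - complex.Re z) / (2 * r) * (a + r * c))).
  rewrite ler_wpM2l // (le_trans (ler_wpM2l s1 nn)) // mulrC ler_pdivrMr ?mulr_gt0 //.
  have h5 : 0 <= r * a by rewrite mulr_ge0 // ltW.
  have h6 : 0 <= r * c by rewrite mulr_ge0 // ltW.
  by lra.
by rewrite mulrAC ler_pdivrMr ?mulr_gt0 // mulrC [leRHS]mulrC -[leLHS]mulrC.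
Qed.

Lemma trace0_linear (a : R[i]) n n' :
  trace0 (a *: n + n') = a *: trace0 n + trace0 n'.
Proof. by rewrite /trace0 compress_linear; vec dot_norm. Qed.

Lemma trace1_linear (a : R[i]) n n' :
  trace1 (a *: n + n') = a *: trace1 n + trace1 n'.
Proof. by rewrite /trace1 compress_linear; vec dot_norm. Qed.

Lemma compress0 : F 0 = 0.
Proof. by have := compress_linear (-1) 0 0; rewrite scaler0 addr0 scaleN1r addNr. Qed.

Lemma trace0_scale (a : R[i]) n : trace0 (a *: n) = a *: trace0 n.
Proof.
by rewrite -[a *: n]addr0 trace0_linear {2}/trace0 compress0 !(scaler0, addr0).
Qed.

Lemma trace1_scale (a : R[i]) n : trace1 (a *: n) = a *: trace1 n.
Proof.
by rewrite -[a *: n]addr0 trace1_linear {2}/trace1 compress0 !(scaler0, addr0).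
Qed.

Lemma trace1_defect n : N n -> N (trace1 n).
Proof.
move=> Nn; apply: subspaceD => //; apply: subspaceZ => //.
exact: (proj_in dot_norm sN clN).
Qed.

(** Coercivity holds in the metric, so Lax-Milgram is applied to [J] after [trace1]; [J] is
    injective and maps [N] to itself, which lets it be cancelled. *)
Lemma trace1_inverse : exists X : E -> E,
  [/\ bounded_in N X, forall n, N n -> X (trace1 n) = n &
      forall n, N n -> trace1 (X n) = n].
Proof.
have [d d0 coer] := trace1_coercive.
have bJ : bounded_in N J.
  apply/bounded_inP; split=> [f|a f g _ _|]; first exact: J_defect.
    exact: (mo_linear J_mo).
  by exists cJ => [|f _]; [exact: mo_ge0 J_mo|exact: (mo_bounded J_mo)].
have [low surj] := lax_milgram dot_norm sN clN
  (bounded_in_comp bJ trace1_bounded) d0 coer.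
have inj n n' : N n -> N n' -> trace1 n = trace1 n' -> n = n'.
  move=> Nn Nn' e; apply/eqP; rewrite -subr_eq0; apply/eqP/nrm_eq0/eqP.
  have Nd : N (n - n') by exact: subspaceB.
  have := low _ Nd; have -> : trace1 (n - n') = 0.
    by rewrite addrC -scaleN1r trace1_linear e scaleN1r addNr.
  by rewrite (metric_operator0 J_mo) nrm0 pmulr_rle0 // eq_le nrm_ge0 andbT.
have [X XP] : {X : E -> E & forall n, N n -> N (X n) /\ trace1 (X n) = n}.
  apply: (@boolp.choice E E (fun n x => N n -> N x /\ trace1 x = n)) => n.
  have [Nn|nNn] := pselect (N n); last by exists 0.
  have [x Nx Jx] := surj _ (J_defect Nn).
  exists x => _; split=> //; apply/eqP; rewrite -subr_eq0; apply/eqP.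
  apply: (metric_operator_eq0 J_mo); rewrite addrC -scaleN1r (mo_linear J_mo) Jx.
  by rewrite scaleN1r addNr.
exists X; split=> [|n Nn|n /XP[] //]; last first.
  by apply: inj => //; [exact: (XP _ (trace1_defect Nn)).1|exact: (XP _ (trace1_defect Nn)).2].
apply/bounded_inP; split=> [f /XP[] //|a f g Nf Ng|].
  have [Nf' ef] := XP _ Nf; have [Ng' eg] := XP _ Ng.
  apply: inj; rewrite ?trace1_linear ?ef ?eg; [|exact: sN.2|].
    by apply: (XP _ _).1; exact: sN.2.
  by apply: (XP _ _).2; exact: sN.2.
exists (cJ / d) => [|f Nf]; first by rewrite divr_ge0 ?(mo_ge0 J_mo) // ltW.
have [Nf' ef] := XP _ Nf; have := low _ Nf'; rewrite ef => h.
rewrite mulrAC ler_pdivlMr // [leLHS]mulrC; apply: (le_trans h).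
exact: (mo_bounded J_mo).
Qed.

Lemma one_plus_ik : 2 * (1 + i * k) = 2 * i * (k - i).
Proof. by have h := i_sqr R; ring: h. Qed.

Lemma one_minus_ik : 2 * (1 - i * k) = - (2 * i) * (k + i).
Proof. by have h := i_sqr R; ring: h. Qed.

Lemma one_plus_k2 : 1 + k ^+ 2 = (k + i) * (k - i).
Proof. by have h := i_sqr R; ring: h. Qed.

(** The terms in [compress n] cancel, as [2(1 + ik) = 2i(k - i)] and [1 + k^2 = (k + i)(k - i)]. *)
Lemma trace_plus n :
  trace1 n - (2 * (1 + i * k)) *: trace0 n = (2 * i / (k + i)) *: n.
Proof.
rewrite /trace1 /trace0 one_plus_ik one_plus_k2; vec dot_norm.
by field; rewrite kpi_neq0 i_neq0.
Qed.

(** [S(k)] freed from inverses: by [trace_minus] and [trace_plus], the quotient defining [S(k)]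
    sends [n] to this vector. *)
Definition scattering n := n + (2 * k * (k + i)) *: trace0 n.

Lemma trace_minus n :
  trace1 n - (2 * (1 - i * k)) *: trace0 n = (2 * i / (k + i)) *: scattering n.
Proof.
rewrite /scattering /trace1 one_minus_ik one_plus_k2 scalerDr scalerA.
have -> : 2 * i / (k + i) * (2 * k * (k + i)) = 4 * i * k.
  by field; exact: kpi_neq0.
rewrite /trace0; vec dot_norm.
by have h := i_sqr R; field: h; rewrite ?kpi_neq0 ?i_neq0.
Qed.

(** Here [k] enters through polynomials and the compressed resolvent only, which suits adjunction,
    conjugation and differentiation. *)
Lemma scatteringE n :
  scattering n = (1 - i * k) *: n + (- i * (k * (k + i) ^+ 2)) *: F n.
Proof.
rewrite /scattering /trace0; vec dot_norm.
have h := i_sqr R.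
have -> : (2 * i)^-1 = - i / 2.
  by rewrite invfM invCi mulrC.
by field: h; exact: kpi_neq0.
Qed.

(** [Gamma_1] vanishes on the domain of [A^2], because [<A^2 w, m> = i^2 <w, m>] for [m] in the
    defect space. *)
Lemma proj_defect_square w v v' : A (w, v) -> A (v, v') -> pN (v' + w) = 0.
Proof.
move=> A1 A2; apply: (subspace_ext dot_norm sN) => [||m Nm].
- exact: (proj_in dot_norm sN clN).
- exact: sN.1.
rewrite (dot_proj dot_norm sN clN) // dot0l dotDl (defect_dot Nm A2).
by rewrite (defect_dot Nm A1) mulrA i_sqr mulN1r addNr.
Qed.

(** Converse of [proj_defect_square]: if [t] is the defect component of [y = A x], pairing
    [A^* y + x] with [t] leaves [- 2i |t|^2]. *)
Lemma square_of_adj x y s : A (x, y) -> As (y, s) -> pN (s + x) = 0 -> A (y, s).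
Proof.
move=> Axy Ays s0; have [a [c [t [Aac Nt yE sE]]]] := adj_decomp A_ms Ays.
suff t0 : t = 0 by rewrite yE sE t0 scaler0 subr0 addr0.
have : dot (s + x) t = 0 by rewrite -(dot_proj dot_norm sN clN) // s0 dot0l.
have e1 := defect_dot Nt Axy.
have e2 : dot x t = - i * dot y t by rewrite e1 mulrA mulNr i_sqr opprK mul1r.
have e3 : dot a t = dot y t - dot t t by rewrite yE dotDl addrK.
rewrite dotDl e2 sE dotDl dotNl dotZl (defect_dot Nt Aac) e3.
have -> : i * (dot y t - dot t t) - i * dot t t + - i * dot y t
   = - (2 * i) * dot t t by ring.
move/eqP; rewrite mulf_eq0 oppr_eq0 (negbTE i2_neq0) /= => /eqP.
exact: dot_eq0.
Qed.

Lemma boundary_adj_square f u v w h :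
  boundary_decomp f u v w h -> opdom (adj_square dot M A) f.
Proof.
move=> [Auv Avw Nh ->].
exists (w + - i *: (- i *: h)), (v + - i *: h) => /=.
  exact: (adj_add A_ms (symA Auv) Nh).
by apply: (adj_add A_ms Avw); apply: (adj_scale A_ms).
Qed.

(** By [range_square], [(H - k^2) U = (A^2 - k^2) w + n]; as [H] extends [A^2], this means
    [U = w + W n]. *)
Lemma image_domain_traces f : image_domain dot M H k f -> exists n u v w,
  [/\ N n, boundary_decomp f u v w (trace0 n) & pN (w + u) = trace1 n].
Proof.
move=> [U [X [HUX /= Mg Uf]]].
have [w [v [v' [n [A1 A2 Nn gE]]]]] := range_square A_ms k_gt0 Mg.
have Hw : H (w, v') by apply: H_ext; exists v.
have UE : U = 1 *: w + W n.
  rewrite -[LHS](resolventK HUX) gE -[v' - _]scale1r resolvent_linear.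
  by rewrite (resolventK Hw).
have [Mw _] := AM A1.
have fE : f = w + pM (W n).
  rewrite (proj_uniq dot_norm sM clM Uf) UE (proj_linear dot_norm sM clM) scale1r.
  by rewrite (proj_id dot_norm sM clM Mw).
have [u0 [v0 [w0 [[B1 B2 B3 B4] B5]]]] := resolvent_traces Nn.
exists n, (w + u0), (v + v0), (v' + w0); split=> //.
  split=> //; first exact: (op_add A_ms).
    exact: (adj_add A_ms (symA A2) B2).
  by rewrite fE B4 addrA.
rewrite addrACA -[v' + w]scale1r (proj_linear dot_norm sN clN).
by rewrite (proj_defect_square A1 A2) scaler0 add0r B5.
Qed.

Lemma image_domain_resolvent n w v v' : N n -> A (w, v) -> A (v, v') ->
  image_domain dot M H k (w + pM (W n)).
Proof.
move=> Nn A1 A2; have Hw : H (w, v') by apply: H_ext; exists v.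
have [[Mw _] [_ Mv']] := (AM A1, AM A2).
exists (w + W n), (v' + (n + k ^+ 2 *: W n)); split=> /=.
- by have := perturbed_subspace.2 1 _ _ Hw (resolventD n); rewrite scale1r.
- have -> : v' + (n + k ^+ 2 *: W n) - k ^+ 2 *: (w + W n) = v' - k ^+ 2 *: w + n.
    by vec dot_norm.
  by apply: subspaceD; [|apply: subspaceB => //; apply: subspaceZ|exact: (defect_in Nn)].
have := projP dot_norm sM clM (w + W n).
by rewrite -[in pM _](scale1r w) (proj_linear dot_norm sM clM) scale1r (proj_id dot_norm sM clM Mw).
Qed.

(** For the inclusion not given by [image_domain_traces], let [g = Gamma_1 f]. Subtracting from [f]
    the projected resolvent of [X g] leaves a vector with both boundary values zero, which is in the
    domain of [A^2] by [square_of_adj]. *)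
Lemma boundary_param_of_inverse (X : E -> E) : bounded_in N X ->
  (forall n, N n -> X (trace1 n) = n) -> (forall n, N n -> trace1 (X n) = n) ->
  is_boundary_param dot M A H k (fun f => trace0 (X f)).
Proof.
move=> bX X1 X2; split.
  rewrite (bspaceE A_ms); exact: (bounded_in_comp trace0_bounded bX).
apply/seteqP; split=> [f /image_domain_traces|f].
  move=> [n [u [v [w [Nn D e]]]]]; split; first exact: boundary_adj_square D.
  exists (trace1 n); split; first by apply/Gamma1P; exists u, v, w, (trace0 n).
  by apply/Gamma0P; exists u, v, w; rewrite X1.
move=> [_ [g [/Gamma1P[u [v [w [h [D gE]]]]] /Gamma0P[u' [v' [w' D']]]]]].
have [_ _ _ hE] := boundary_decomp_uniq D D'.
have Ng : N g by rewrite gE; exact: (proj_in dot_norm sN clN).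
have Nn : N (X g) by case: bX => h1 _ _; exact: h1.
have [u1 [v1 [w1 [[B1 B2 B3 B4] B5]]]] := resolvent_traces Nn.
have [D1 D2 D3 D4] := D.
have Ax := op_diff A_ms D1 B1.
have Ay := adj_diff A_ms D2 B2.
have -> : f = u - u1 + pM (W (X g)) by rewrite D4 B4 hE addrA subrK.
apply: (image_domain_resolvent Nn Ax); apply: (square_of_adj Ax Ay).
have -> : w - w1 + (u - u1) = -1 *: (w1 + u1) + (w + u) by vec dot_norm.
by rewrite (proj_linear dot_norm sN clN) -gE -B5 X2 // scaleN1r addNr.
Qed.

Lemma Lambda_plus_k : Lambda_plus H k.
Proof. by split=> //; exists W. Qed.

Lemma Smatrix_exists : exists S, is_Smatrix dot M A H k S.
Proof.
have [X [bX X1 X2]] := trace1_inverse.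
pose T f := trace0 (X f).
(* The inverse of [I - 2(1 + ik) T], read off [trace_plus]. *)
pose WT f := ((k + i) / (2 * i)) *: trace1 f.
have XN f : N f -> N (X f) by case: bX => h _ _; exact: h.
have c0 : (k + i) / (2 * i) * (2 * i / (k + i)) = 1.
  by field; rewrite kpi_neq0 i_neq0.
exists (fun f => WT f - (2 * (1 - i * k)) *: T (WT f)); split.
  exact: Lambda_plus_k.
exists T, WT; split=> //; first exact: boundary_param_of_inverse.
have TWT f : N f -> T (WT f) = ((k + i) / (2 * i)) *: trace0 f.
  move=> Nf; rewrite /T /WT -trace0_scale -trace1_scale X1 //.
  exact: subspaceZ.
rewrite (bspaceE A_ms); split.
- have := bounded_in_comb ((k + i) / (2 * i)) 0 sN trace1_bounded (bounded_in_id N).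
  by apply: eq_bounded_in => // f _; rewrite scale0r addr0.
- move=> f Nf; split=> /=; first by apply: subspaceZ => //; exact: trace1_defect.
  rewrite TWT // scale0r addr0.
  have -> : WT f - (2 * (1 + i * k)) *: (((k + i) / (2 * i)) *: trace0 f) =
    ((k + i) / (2 * i)) *: (trace1 f - (2 * (1 + i * k)) *: trace0 f).
    by rewrite /WT; vec dot_norm.
  by rewrite trace_plus scalerA c0 scale1r.
- move=> u v [/= Nu ->]; rewrite scale0r subr0 /WT /T -{1}(X2 _ Nu) trace_plus.
  by rewrite trace1_scale X2 // scalerA c0 scale1r.
Qed.

(** Uniqueness: the boundary values of the projected resolvent force [T] on every [trace1 m], and
    [m = (k + i)/(2i) n] is chosen so that [trace1 m] is the inverse factor applied to [n]. *)
Lemma SmatrixE S n : is_Smatrix dot M A H k S -> N n -> S n = scattering n.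
Proof.
move=> [_ [T [X]]]; rewrite /is_boundary_param (bspaceE A_ms).
move=> [[_ imE] [_ _ XK] SE] Nn.
have T1 m : N m -> T (trace1 m) = trace0 m.
  move=> Nm; have [u [v [w [D e]]]] := resolvent_traces Nm.
  have : image_domain dot M H k (pM (W m)).
    by rewrite -[pM _]add0r; apply: (image_domain_resolvent (v := 0) (v' := 0) Nm); exact: sA.1.
  rewrite imE => -[_ [g [/Gamma1P[u1 [v1 [w1 [h1 [D1 gE]]]]] /Gamma0P[u2 [v2 [w2 D2]]]]]].
  have [uu _ ww hh] := boundary_decomp_uniq D D1.
  have [_ _ _ hh'] := boundary_decomp_uniq D D2.
  by rewrite hh' gE -uu -ww -e.
pose m := ((k + i) / (2 * i)) *: n.
have Nm : N m by exact: subspaceZ.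
have c0 : 2 * i / (k + i) * ((k + i) / (2 * i)) = 1.
  by field; rewrite kpi_neq0 i_neq0.
have Xn : X n = trace1 m.
  have := XK (trace1 m) (trace1 m - (2 * (1 + i * k)) *: T (trace1 m)).
  rewrite T1 // trace_plus scalerA c0 scale1r scale0r subr0; apply.
  by split=> /=; [exact: trace1_defect|rewrite T1 // trace_plus scalerA c0 scale1r].
rewrite SE // Xn T1 // trace_minus /m.
have scat_scale (a : R[i]) x : scattering (a *: x) = a *: scattering x.
  by rewrite /scattering trace0_scale scalerDr !scalerA (mulrC a).
by rewrite scat_scale scalerA c0 scale1r.
Qed.

Lemma scattering_defect n : N n -> N (scattering n).
Proof.
by move=> Nn; apply: subspaceD => //; apply: subspaceZ => //; exact: trace0_defect.
Qed.

(* The energy of [u = (H - k^2)^-1 n] outside [M] is [<Hu, u> - |A^* P_M u|^2 >= 0];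
   by Green's identity it only depends on the traces of [P_M u]. *)
Lemma scattering_contraction n : N n ->
  complex.Re (b (scattering n) (scattering n)) <= complex.Re (b n n).
Proof.
move=> Nn; have [u [v [Auv fE Af Ag gE]]] := resolvent_proj Nn.
have Mn := defect_in Nn.
have [h hE] : exists h, h = trace0 n by exists (trace0 n).
have Nh : N h by rewrite hE; exact: trace0_defect.
rewrite /scattering -hE; rewrite -hE in fE Af Ag gE.
have [w wE] : exists w, w = W n by exists (W n).
have Hw : H (w, n + k ^+ 2 *: w) by rewrite wE; exact: resolventD.
rewrite -wE in fE Af Ag gE.
(* The defect component of [g = A^* f]: since [g = - k u + h1] with [u] in the domain of [A],
   Green's identity applies to the pair [g], [f]. *)
pose h1 := - k *: h - (k + i)^-1 *: n.
have Nh1 : N h1 by apply: subspaceB => //; apply: subspaceZ.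
have vE : v = i *: h - k *: (u + h) - (k + i)^-1 *: n.
  by rewrite -[LHS](subrK (i *: h)) gE fE; vec dot_norm.
have J_sub x y : J x - J y = J (x - y).
  by rewrite addrC -scaleN1r -(mo_linear J_mo) scaleN1r addrC.
have J_add x y : J x + J y = J (x + y).
  by rewrite -[J x]scale1r -(mo_linear J_mo) scale1r.
have [f f_def] : exists f, f = pM w by exists (pM w).
have [g g_def] : exists g, g = v - i *: h by exists (v - i *: h).
have Mf : M f by rewrite f_def; exact: (proj_in dot_norm sM clM).
rewrite -f_def -g_def in fE Af Ag gE.
have green_f : b (k ^+ 2 *: f + n) f - b g g = - (2 * i) * b h1 h.
  have := green A_ms (JA (op_scale A_ms (- k) Auv)) (J_defect Nh1) Auv Nh.
  rewrite -metric_operatorZ J_sub J_add -fE -g_def.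
  have -> : - k *: v - i *: h1 = k ^+ 2 *: f + n.
    by rewrite /h1 vE fE; vec dot_norm; field; exact: kpi_neq0.
  have -> : - k *: u + h1 = g by rewrite gE /h1 fE; vec dot_norm.
  by [].
have Eg := energy_lower_bound Hw (eq_rect _ (fun x => As (x, g)) Af _ f_def).
have bfw : b f w = b f f by rewrite -(jdot_projM w Mf) -f_def.
have bwf : b w f = b f f by rewrite (jdotC J_mo) bfw -(jdotC J_mo).
have bnw : b n w = b n f by rewrite f_def jdot_projM.
(* [V] is the squared metric norm of the part of [w] outside [M]; [J] preserves [M], so [f] and
   [w - f] are orthogonal in the metric. *)
have [V Vd] : exists V, V = b (w - f) (w - f) by exists (b (w - f) (w - f)).
have bww : b w w = b f f + V by rewrite Vd !jdotE bfw bwf; ring.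
have Vi : complex.Im V = 0 by rewrite Vd; exact: Im_jdot J_mo _.
have V0 : 0 <= complex.Re V by rewrite Vd; exact: jdot_ge0 J_mo _.
have [q qd] : exists q, q = b h h by exists (b h h).
have qi : complex.Im q = 0 by rewrite qd; exact: Im_jdot J_mo _.
have q0 : 0 <= complex.Re q by rewrite qd; exact: jdot_ge0 J_mo _.
have [c cd] : exists c, c = (k + i)^-1 * b n h by exists ((k + i)^-1 * b n h).
have bnh : b n h = (k + i) * c by rewrite cd mulVKf ?kpi_neq0.
(* The balance fed to [passivity_le0], with [D1 = b(H w, w)] and [D2 = b(g, g)]; [Eg] is the
   inequality between their real parts. *)
have eqD : b (n + k ^+ 2 *: w) w - b g g = k ^+ 2 * V + 2 * i * (k * q + c).
  have -> : b (n + k ^+ 2 *: w) w = k ^+ 2 * V + b (k ^+ 2 *: f + n) f.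
    by rewrite !jdotE bww bnw; ring.
  rewrite -addrA green_f /h1 !jdotE -qd -cd; ring.
have ImD0 := Im_H J_mo H_sa Hw.
have Img := Im_jdot J_mo g.
have [s sE] : exists s, s = 2 * k * (k + i) by exists (2 * k * (k + i)).
have -> : b (n + (2 * k * (k + i)) *: h) (n + (2 * k * (k + i)) *: h) =
    b n n + (s^* * ((k + i) * c) + s * ((k + i) * c)^* + s * (s^* * q)).
  by rewrite -sE !jdotE (jdotC J_mo n h) bnh -qd; ring.
rewrite ReD gerDl sE; rewrite expr2 in eqD ImD0 Eg.
exact: passivity_le0 k_gt0 Vi V0 qi q0 ImD0 Img Eg eqD.
Qed.

End FixedParameter.
End PerturbedOperator.

(** * The scattering matrix *)

Section ScatteringMatrix.
Variables (R : realType) (E : completeNormedModType R[i]).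
Variables (dot : {dot E for Num.conj}) (M : set E) (A : set (E * E)).
Hypothesis A_ms : maximal_symmetric_in dot M A.
Variables (J : E -> E) (cJ dJ : R).
Hypothesis J_mo : metric_operator dot J cJ dJ.
Hypothesis JM : forall f, M f -> M (J f).
Hypothesis JA : intertwines J A A.
Variable H : set (E * E).
Hypothesis H_sa : selfadjoint (jdot dot J) setT H.
Hypothesis H_spec : forall z : R[i], ~ resolvent_set setT H z ->
  complex.Im z = 0 /\ 0 <= complex.Re z.
Hypothesis H_ext : opcomp A A `<=` H.
Hypothesis H_adj_ext : opcomp A A `<=` adjoint dot setT H.

Let dot_norm := ms_dot_norm A_ms.
Local Notation As := (adjoint dot M A).
Local Notation i := ('i : R[i]).
Local Notation b := (jdot dot J).
Local Notation N := (defect dot M A).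
Local Notation pN := (proj dot N).
Let sN : is_subspace N := defect_subspace A_ms.
Let clN : closed N := defect_closed A_ms.
Let jdotE := (jdotDl J_mo, jdotDr, jdotNl J_mo, jdotNr, jdotZl J_mo, jdotZr).
Local Notation scattering := (scattering dot M A).
Local Notation compress := (compress dot M A).
Implicit Types (k : R[i]) (u v w f g h n p : E).

Lemma resolvent_exists k : 0 < complex.Im k ->
  exists W, is_resolvent setT H (k ^+ 2) W.
Proof.
move=> k0; apply: (resolvent_of H_spec); rewrite !expr2 !ReImE.
have [->|p0] := eqVneq (complex.Re k) 0; last first.
  by left; rewrite mulrC -mulr2n mulrn_eq0 /= mulf_neq0 // gt_eqF.
by right; rewrite mul0r sub0r oppr_lt0 mulr_gt0.
Qed.

(** The square of [- conj k] is the conjugate of [k^2], so [W'] is the adjoint of [W] in the metric;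
    the coefficients [1 - ik] and [- ik (k + i)^2] at [- conj k] are the conjugates of those at
    [k]. *)
Lemma scattering_adjoint k W W' f g : 0 < complex.Im k ->
  is_resolvent setT H (k ^+ 2) W -> is_resolvent setT H ((- k^*) ^+ 2) W' ->
  N f -> N g -> b (scattering (- k^*) W' f) g = b f (scattering k W g).
Proof.
move=> k0 HW HW' Nf Ng.
have k'0 : 0 < complex.Im (- k^*) by rewrite ImN ImJ opprK.
have e : b (W' f) g = b f (W g).
  have := H_sym H_sa (resolventD HW' f) (resolventD HW g).
  rewrite !jdotE rmorphXn /= sqrrN => /eqP.
  rewrite -subr_eq0 opprD addrACA subrr addr0 subr_eq0 => /eqP.
  by move=> ->.
rewrite (scatteringE A_ms k'0) (scatteringE A_ms k0) !jdotE.
rewrite (jdot_compress A_ms J_mo JM JA) // (jdotC J_mo (compress _ g) f).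
rewrite (jdot_compress A_ms J_mo JM JA) // -(jdotC J_mo) e.
rewrite !(rmorphB, rmorphM, rmorphN, rmorphXn, rmorphD, rmorph1) /= conjCi.
by ring.
Qed.

Lemma J_reduces : reduces dot N (graph_on setT J).
Proof.
move=> u v p q [_ /= ->] /(proj_uniq dot_norm sN clN) -> /(proj_uniq dot_norm sN clN) ->.
split=> //=; apply: (subspace_ext dot_norm sN) => [||m Nm].
- exact: (proj_in dot_norm sN clN).
- by apply: (J_defect J_mo JM JA); exact: (proj_in dot_norm sN clN).
rewrite (dot_proj dot_norm sN clN) // !(mo_selfadjoint J_mo).
by rewrite (dot_proj dot_norm sN clN) //; exact: (J_defect J_mo JM JA).
Qed.

(** * Antilinear symmetries of the scattering matrix *)

Section Conjugation.
Variable Th : E -> E.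
Hypothesis Th_lin : forall (a : R[i]) x y, Th (a *: x + y) = a^* *: Th x + Th y.
Hypothesis ThK : forall x, Th (Th x) = x.
Hypothesis Th_dot : forall x y, dot (Th x) (Th y) = dot y x.
Hypothesis ThM : forall x, M x -> M (Th x).
Hypothesis ThA : forall u v, A (u, v) -> A (Th u, - Th v).
Hypothesis ThH : intertwines Th H H.

Lemma antilinear0 : Th 0 = 0.
Proof.
have := Th_lin (-1) 0 0; rewrite scaler0 addr0 rmorphN rmorph1 scaleN1r.
by rewrite addNr.
Qed.

Lemma antilinearZ (a : R[i]) x : Th (a *: x) = a^* *: Th x.
Proof. by have := Th_lin a x 0; rewrite antilinear0 !addr0. Qed.

Lemma Th_dotl x y : dot (Th x) y = dot (Th y) x.
Proof. by rewrite -[in LHS](ThK y) Th_dot. Qed.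

(** [Th] anticommutes with [A] and conjugates [i]: the two signs cancel. *)
Lemma Th_defect h : N h -> N (Th h).
Proof.
move=> Nh; split=> /= [||u v Auv]; first exact: ThM (defect_in Nh).
  by apply: subspaceZ (ms_subspace A_ms) _; exact: ThM (defect_in Nh).
have := adj_dotr Nh (ThA Auv); rewrite dotNr dotZl mulNr => /oppr_inj e.
by rewrite dotZr rmorphN /= i_conj opprK dotC Th_dotl -dotC e [in RHS]dotC Th_dotl -dotC.
Qed.

Lemma Th_proj x : pN (Th x) = Th (pN x).
Proof.
apply/esym/(proj_uniq dot_norm sN clN); split=> /= [|m Nm].
  by apply: Th_defect; exact: (proj_in dot_norm sN clN).
have -> : Th x - Th (pN x) = Th (x - pN x).
  have -> : x - pN x = -1 *: pN x + x by rewrite scaleN1r addrC.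
  by rewrite Th_lin rmorphN rmorph1 scaleN1r addrC.
by rewrite Th_dotl dotC (projP dot_norm sN clN x).2 ?rmorph0 //; exact: Th_defect.
Qed.

Lemma Th_reduces : reduces dot N (graph_on setT Th).
Proof.
move=> u v p q [_ /= ->] /(proj_uniq dot_norm sN clN) -> /(proj_uniq dot_norm sN clN) ->.
by split=> //=; rewrite Th_proj.
Qed.

(** [Th] commutes with [H] and conjugates scalars, so it exchanges the resolvents at [k^2] and at
    its conjugate; the coefficients in [scatteringE] are exchanged likewise. *)
Lemma scattering_Th k W W' f : 0 < complex.Im k ->
  is_resolvent setT H (k ^+ 2) W -> is_resolvent setT H ((- k^*) ^+ 2) W' ->
  Th (scattering (- k^*) W' f) = scattering k W (Th f).
Proof.
move=> k0 HW HW'; have k'0 : 0 < complex.Im (- k^*) by rewrite ImN ImJ opprK.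
have e : W (Th f) = Th (W' f).
  have := resolventK HW (ThH (resolventD HW' f)).
  by rewrite [f + _]addrC Th_lin rmorphXn /= rmorphN /= conjCK sqrrN [_ + Th f]addrC addrK.
rewrite (scatteringE A_ms k'0) (scatteringE A_ms k0) Th_lin antilinearZ.
rewrite !compressE e Th_proj; congr (_ *: _ + _ *: _);
  by rewrite !(rmorphB, rmorphM, rmorphN, rmorphD, rmorphXn, rmorph1) /= conjCK conjCi; ring.
Qed.

End Conjugation.

(* With [d = (k + h)^2 - k^2], the resolvent identity gives
   [W_h = W + d W^2 + d^2 W_h W^2]. *)
Lemma scattering_analytic (S : R[i] -> E -> E) :
  (forall k W n, 0 < complex.Im k -> is_resolvent setT H (k ^+ 2) W -> N n ->
     S k n = scattering k W n) ->
  analytic_in N (@upper_half_plane R) S.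
Proof.
move=> SE k Uk; have k0 : 0 < complex.Im k := Uk; have [W HW] := resolvent_exists k0.
have bF := compress_bounded A_ms HW.
have bS : bounded_in N (S k).
  have := bounded_in_comb (1 - i * k) (- i * (k * (k + i) ^+ 2)) sN (bounded_in_id N) bF.
  by apply: eq_bounded_in => // f Nf; rewrite (SE _ _ _ k0 HW Nf) (scatteringE A_ms k0).
split=> //.
have [/bounded_inP[_ Wl [c c0 Wc]] _ _] := HW.
have bWW : bounded_in N (fun f => compress W (W f)).
  apply/bounded_inP; split=> [f _|a f g _ _|].
  - exact: (proj_in dot_norm sN clN).
  - by rewrite Wl // (compress_linear A_ms HW).
  exists (c * c) => [|f _]; first exact: mulr_ge0.
  rewrite (le_trans (nrm_proj dot_norm sN clN _)) // (le_trans (Wc _ _)) //.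
  by rewrite -mulrA ler_wpM2l // Wc.
(* [S'] is the formal derivative of [(1 - ik) - ik (k + i)^2 F(k)]: [c1] is the derivative of the
   coefficient of [F(k)], and [c2] carries the derivative [2k W^2] of the resolvent. *)
pose c1 : R[i] := - i * (3 * k ^+ 2 + 4 * i * k - 1).
pose c2 : R[i] := - i * (k * (k + i) ^+ 2) * (2 * k).
pose S' f := - i *: f + (c1 *: compress W f + c2 *: compress W (W f)).
exists S'.
  have := bounded_in_comb (- i) 1 sN (bounded_in_id N) (bounded_in_comb c1 c2 sN bF bWW).
  by apply: eq_bounded_in => // f _; rewrite scale1r.
(* [K] dominates [|k|], [|k + h|] and [|k + h + i|] when [|h| <= 1]; [L] collects the bounds on the
   remainder coefficients [r1], [r2], [r3]. *)
pose K : R := cabs k + 3.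
have K3 : 3 <= K by rewrite lerDr cabs_ge0.
pose L : R := 3 * K * c + (2 * K * (20 * K ^+ 2) + K ^+ 3) * c ^+ 2
  + K ^+ 3 * (2 * K) ^+ 2 * (2 * c ^+ 3).
have K0 : 0 <= K by lra.
have L0 : 0 <= L.
  by rewrite /L; do ?[exact: K0|exact: ler0n|apply: exprn_ge0|apply: mulr_ge0|apply: addr_ge0].
move=> e e0; have eE : e = (complex.Re e)%:C by rewrite RRe_real // gtr0_real.
have er0 : 0 < complex.Re e by rewrite -ltcR -eE.
(* The four bounds on [|h|] give [|h| <= 1], keep [k + h] in the half-plane, make [|d| c <= 1/2],
   and make [L |h| <= e]. *)
pose del : R := Num.min (Num.min 1 (complex.Im k / 2))
  (Num.min ((4 * K * (c + 1))^-1) (complex.Re e / (L + 1))).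
have K4 : 0 < 4 * K * (c + 1) by apply: mulr_gt0; [lra|exact: ltr_wpDl].
have del0 : 0 < del.
  by rewrite !lt_min ltr01 divr_gt0 //= invr_gt0 K4 divr_gt0 // ltr_wpDl.
exists del%:C => /=; first by rewrite ltcR.
move=> h /=; rewrite sub0r normrN cabsE ltcR !lt_min => /andP[/andP[h1 h2] /andP[h3 h4]] hn0 f Nf.
have kh0 : 0 < complex.Im (k + h).
  have := Re_le_cabs (i * h); rewrite cabsM /cabs normCi mul1r -/(cabs h) !ReImE.
  by lra.
have [Wh HWh] := resolvent_exists kh0.
have [/bounded_inP[_ Whl [ch ch0 Whc]] _ _] := HWh.
rewrite !nrmE eE -rmorphM lecR.
rewrite (SE _ _ _ kh0 HWh Nf) (SE _ _ _ k0 HW Nf) (scatteringE A_ms kh0) (scatteringE A_ms k0).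
pose d : R[i] := h * (2 * k + h).
have res_id g : Wh g = d *: Wh (W g) + W g.
  have := resolventK HWh (resolventD HW g).
  have -> : g + k ^+ 2 *: W g - (k + h) ^+ 2 *: W g = (- d) *: W g + g.
    by rewrite /d; vec dot_norm.
  rewrite Whl // => e1.
  by rewrite -[LHS](addKr ((- d) *: Wh (W g))) e1 scaleNr opprK.
have d_le : cabs d <= 2 * K * cabs h.
  rewrite /d cabsM mulrC ler_wpM2r ?cabs_ge0 // (le_trans (cabsD _ _)) //.
  by rewrite cabsM {1}/cabs normr_nat /= /K; have := cabs_ge0 k; lra.
have dc_le : cabs d * c <= 1 / 2.
  move: h3; rewrite -[X in _ < X]mul1r ltr_pdivlMr // => h3.
  apply: (le_trans (ler_wpM2r c0 d_le)).
  have : 0 <= cabs h * K by rewrite mulr_ge0 ?cabs_ge0.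
  by move: h3; nra.
(* The term [d W (Wh g)] is absorbed on the left since [|d| c <= 1/2]. *)
have Wh_bound g : nrm (Wh g) <= 2 * c * nrm g.
  have e1 : Wh g = d *: W (Wh g) + W g.
    rewrite -[LHS](resolventK HW (resolventD HWh g)) -Wl //; congr (W _).
    by rewrite /d; vec dot_norm.
  have := nrmD (d *: W (Wh g)) (W g); rewrite -e1 nrmZ => h5.
  have h6 := ler_wpM2l (cabs_ge0 d) (Wc (Wh g) I).
  have h7 := ler_wpM2r (nrm_ge0 (Wh g)) dc_le.
  by have := Wc g I; lra.
have exp2 : Wh f = d ^+ 2 *: Wh (W (W f)) + (d *: W (W f) + W f).
  by rewrite {1}res_id {1}(res_id (W f)) scalerDr scalerA addrA expr2.
have Fh : compress Wh f =
    d ^+ 2 *: compress Wh (W (W f)) + (d *: compress W (W f) + compress W f).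
  by rewrite compressE exp2 !(proj_linear dot_norm sN clN).
have pN_le g x : nrm g <= x -> nrm (pN g) <= x.
  by apply: le_trans; exact: (nrm_proj dot_norm sN clN).
have X1 : nrm (compress W f) <= c * nrm f by apply: pN_le; exact: Wc.
have WW : nrm (W (W f)) <= c ^+ 2 * nrm f.
  by rewrite (le_trans (Wc _ I)) // expr2 -mulrA ler_wpM2l // Wc.
have X2 : nrm (compress W (W f)) <= c ^+ 2 * nrm f by exact: pN_le.
have X3 : nrm (compress Wh (W (W f))) <= 2 * c ^+ 3 * nrm f.
  apply: pN_le; apply: (le_trans (Wh_bound _)).
  have -> : 2 * c ^+ 3 * nrm f = 2 * c * (c ^+ 2 * nrm f) by ring.
  by rewrite ler_wpM2l // mulr_ge0.
(* With [p(k) = k (k + i)^2], [s2] is [(p(k + h) - p(k)) / h] and [s3] is [p(k + h)]; [r1], [r2],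
   [r3] are what remains of the difference quotient minus [S'] once a factor [h] is taken out. *)
pose r1 : R[i] := - i * (3 * k + h + 2 * i).
pose s2 : R[i] := 3 * k ^+ 2 + 3 * k * h + h ^+ 2 + 2 * i * (2 * k + h) - 1.
pose s3 : R[i] := (k + h) * (k + h + i) ^+ 2.
pose r2 : R[i] := - i * (2 * k * s2 + s3).
pose r3 : R[i] := - i * s3 * (2 * k + h) ^+ 2.
rewrite Fh /S'.
move: (compress W f) (compress W (W f)) (compress Wh (W (W f))) X1 X2 X3.
move=> Y1 Y2 Y3 X1 X2 X3.
rewrite [X in nrm X](_ : _ = h *: (r1 *: Y1 + (r2 *: Y2 + r3 *: Y3))); last first.
  rewrite /c1 /c2 /r1 /r2 /r3 /s2 /s3 /d; vec dot_norm.
  by have hi := i_sqr R; field: hi; exact: hn0.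
have ci : cabs (- i) = 1 by rewrite cabsN /cabs normCi.
have cn (j : nat) : cabs (j%:R : R[i]) = j%:R.
  by rewrite /cabs normr_nat; elim: j => // j IH; rewrite !mulrS ReD IH.
have ck : cabs k <= K - 3 by rewrite /K addrK.
have k3 : 0 <= K - 3 by rewrite subr_ge0.
have ch1 : cabs h <= 1 by exact: ltW.
have ch_ge0 := cabs_ge0 h.
have cD (x y : R[i]) r s : cabs x <= r -> cabs y <= s -> cabs (x + y) <= r + s.
  by move=> xr ys; apply: (le_trans (cabsD _ _)); exact: lerD.
have cM (x y : R[i]) r s : cabs x <= r -> cabs y <= s -> cabs (x * y) <= r * s.
  by move=> xr ys; rewrite cabsM; apply: ler_pM => //; exact: cabs_ge0.
have cX (x : R[i]) r : cabs x <= r -> cabs (x ^+ 2) <= r ^+ 2.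
  by rewrite !expr2 => xr; exact: cM.
have ci1 : cabs i <= 1 by rewrite -cabsN ci.
have cNi : cabs (- i) <= 1 by rewrite ci.
have c11 : cabs (- 1 : R[i]) <= 1 by rewrite cabsN (cn 1).
have cn' (j : nat) : cabs (j%:R : R[i]) <= j%:R by rewrite cn.
have r1_le : cabs r1 <= 3 * K.
  apply: (le_trans (cM _ _ _ _ cNi (cD _ _ _ _ (cD _ _ _ _ (cM _ _ _ _ (cn' 3) ck) ch1)
    (cM _ _ _ _ (cn' 2) ci1)))).
  by lra.
have s2_le : cabs s2 <= 20 * K ^+ 2.
  apply: (le_trans (cD _ _ _ _ (cD _ _ _ _ (cD _ _ _ _ (cD _ _ _ _
    (cM _ _ _ _ (cn' 3) (cX _ _ ck)) (cM _ _ _ _ (cM _ _ _ _ (cn' 3) ck) ch1))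
    (cX _ _ ch1)) (cM _ _ _ _ (cM _ _ _ _ (cn' 2) ci1)
    (cD _ _ _ _ (cM _ _ _ _ (cn' 2) ck) ch1))) c11)).
  by move: (K) K3 => y y3; nra.
have s3_le : cabs s3 <= K ^+ 3.
  rewrite exprS; apply: cM.
    by apply: (le_trans (cD _ _ _ _ ck ch1)); lra.
  by apply: cX; apply: (le_trans (cD _ _ _ _ (cD _ _ _ _ ck ch1) ci1)); lra.
have k2_le : cabs (2 * k + h) <= 2 * K.
  by apply: (le_trans (cD _ _ _ _ (cM _ _ _ _ (cn' 2) ck) ch1)); lra.
have ckK : cabs k <= K by lra.
have r2_le : cabs r2 <= 2 * K * (20 * K ^+ 2) + K ^+ 3.
  rewrite /r2 cabsM ci mul1r; apply: cD => //; apply: (cM) => //.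
  exact: (cM _ _ _ _ (cn' 2) ckK).
have r3_le : cabs r3 <= K ^+ 3 * (2 * K) ^+ 2.
  by rewrite /r3; apply: cM; [rewrite cabsM ci mul1r|exact: cX].
have nf := nrm_ge0 f.
have : nrm (r1 *: Y1 + (r2 *: Y2 + r3 *: Y3)) <= L * nrm f.
  apply: (le_trans (nrmD _ _)); rewrite nrmZ /L -addrA mulrDl; apply: lerD.
    rewrite -[leRHS]mulrA; apply: ler_pM => //; [exact: cabs_ge0|exact: nrm_ge0].
  apply: (le_trans (nrmD _ _)); rewrite !nrmZ mulrDl; apply: lerD.
    rewrite -[leRHS]mulrA; apply: ler_pM => //; [exact: cabs_ge0|exact: nrm_ge0].
  rewrite -[leRHS]mulrA; apply: ler_pM => //; [exact: cabs_ge0|exact: nrm_ge0].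
rewrite nrmZ => h5.
apply: (le_trans (ler_wpM2l ch_ge0 h5)); rewrite mulrA ler_wpM2r //.
move: h4; rewrite ltr_pdivlMr ?ltr_wpDl // => h4.
by move: ch_ge0 h4; lra.
Qed.

End ScatteringMatrix.

(** * The operator exponential *)

Section TriangularSums.

(** The square of index pairs is cut along [p + q < n]: the triangle is a partial sum of the Cauchy
    product, the corner is the error term. *)
Lemma square_sum_split (V : zmodType) (G : nat -> nat -> V) n :
  \sum_(0 <= p < n) \sum_(0 <= q < n) G p q =
  \sum_(0 <= m < n) \sum_(0 <= p < m.+1) G p (m - p)%N +
  \sum_(0 <= p < n) \sum_(n - p <= q < n) G p q.
Proof.
have -> : \sum_(0 <= m < n) \sum_(0 <= p < m.+1) G p (m - p)%N =
    \sum_(0 <= p < n) \sum_(0 <= q < n - p) G p q.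
  have -> : \sum_(0 <= m < n) \sum_(0 <= p < m.+1) G p (m - p)%N =
      \sum_(0 <= m < n) \sum_(0 <= p < n | (p <= m)%N) G p (m - p)%N.
    apply: eq_big_nat => m /andP[_ mn].
    by rewrite (big_nat_widen _ _ n) //.
  rewrite (exchange_big_dep_nat predT) //=; apply: eq_big_nat => p /andP[_ pn].
  transitivity (\sum_(p <= m < n) G p (m - p)%N).
    by rewrite (big_nat_widenl p 0).
  rewrite -{1}[p]add0n big_addn.
  by apply: eq_bigr => q _; rewrite addnK.
rewrite -big_split /=; apply: eq_big_nat => p _.
by rewrite -big_cat_nat //= leq_subr.
Qed.

Lemma exp_coeffD (F : numFieldType) (x y : F) m :
  (x + y) ^+ m / m`!%:R =
  \sum_(0 <= p < m.+1) x ^+ p / p`!%:R * (y ^+ (m - p) / (m - p)`!%:R).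
Proof.
rewrite addrC exprDn mulr_suml big_mkord; apply: eq_bigr => p _.
have pm : (p <= m)%N by rewrite -ltnS.
have f0 j : (j`!%:R : F) != 0 by rewrite pnatr_eq0 -lt0n fact_gt0.
have := bin_fact pm => /(congr1 (fun j => j%:R : F)); rewrite /= !natrM => e.
rewrite -mulr_natr -e; field; rewrite !f0 /=.
by apply: contra_eq_neq e => /= ->; rewrite mul0r eq_sym f0.
Qed.

End TriangularSums.

Section Exponential.
Variables (R : realType) (E : completeNormedModType R[i]).
Variable dot : {dot E for Num.conj}.
Hypothesis dot_norm : forall x, dot x x = `|x| ^+ 2.
Variables (Q : E -> E) (c : R).
Hypothesis c0 : 0 <= c.
Hypothesis Q_lin : forall (a : R[i]) x y, Q (a *: x + y) = a *: Q x + Q y.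
Hypothesis Q_bnd : forall x, nrm (Q x) <= c * nrm x.
Implicit Types (a d : R[i]) (f g : E).

(** The parameter [a] gives access to the square root [e^(Q/2)] and to its inverse. *)
Definition exp_op a f := expop (fun x => a *: Q x) f.

Definition exp_sum a n f : E := \sum_(0 <= j < n) (a ^+ j / j`!%:R) *: iter j Q f.

Definition exp_scalar (r : R) n : R := \sum_(0 <= j < n) r ^+ j / j`!%:R.

Lemma iterQ_bound j f : nrm (iter j Q f) <= c ^+ j * nrm f.
Proof.
elim: j => [|j IH] /=; first by rewrite expr0 mul1r.
by rewrite (le_trans (Q_bnd _)) // exprS -mulrA ler_wpM2l.
Qed.

Lemma Q_scale a f : Q (a *: f) = a *: Q f.
Proof.
have Q0 : Q 0 = 0 by have := Q_lin (-1) 0 0; rewrite scaler0 addr0 scaleN1r addNr.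
by have := Q_lin a f 0; rewrite Q0 !addr0.
Qed.

Lemma iterQ_lin a j f g : iter j Q (a *: f + g) = a *: iter j Q f + iter j Q g.
Proof. by elim: j => //= j ->; rewrite Q_lin. Qed.

Lemma exp_sumE a n f :
  series (fun j => (j`!%:R : R[i])^-1 *: iter j (fun x => a *: Q x) f) n = exp_sum a n f.
Proof.
apply: eq_bigr => j _; have -> : iter j (fun x => a *: Q x) f = a ^+ j *: iter j Q f.
  by elim: j => [|j /= ->]; rewrite ?scale1r // Q_scale scalerA exprS.
by rewrite scalerA mulrC.
Qed.

Lemma cabs_fact j : cabs (j`!%:R : R[i]) = j`!%:R.
Proof. by rewrite /cabs normr_nat; elim: (j`!) => // n IH; rewrite !mulrS ReD IH. Qed.

Lemma exp_term_bound a j f :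
  nrm ((a ^+ j / j`!%:R) *: iter j Q f) <= (cabs a * c) ^+ j / j`!%:R * nrm f.
Proof.
rewrite nrmZ cabsM cabsV cabs_fact.
have -> : cabs (a ^+ j) = cabs a ^+ j.
  by elim: j => [|j IH]; rewrite ?exprS ?cabsM ?IH // !expr0 /cabs normr1.
rewrite exprMn mulrAC -[leRHS]mulrA mulrAC [leRHS]mulrA mulrAC.
have h : 0 <= cabs a ^+ j / j`!%:R by rewrite divr_ge0 ?exprn_ge0 ?cabs_ge0.
have := ler_wpM2l h (iterQ_bound j f).
by rewrite !mulrA ![_ / j`!%:R * _]mulrAC.
Qed.

Lemma nrm_sum (I : Type) (r : seq I) (F : I -> E) (G : I -> R) :
  (forall j, nrm (F j) <= G j) -> nrm (\sum_(j <- r) F j) <= \sum_(j <- r) G j.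
Proof.
move=> h; elim/big_ind2: _ => [||//]; first by rewrite nrm0.
by move=> x1 x2 y1 y2 h1 h2; rewrite (le_trans (nrmD _ _)) // lerD.
Qed.

Lemma exp_scalar_cvg r : exp_scalar r n @[n --> \oo] --> expR r.
Proof. exact: (@is_cvg_series_exp_coeff R r). Qed.

Lemma exp_scalar_le r n : 0 <= r -> exp_scalar r n <= expR r.
Proof.
move=> r0; apply: (nondecreasing_cvgn_le (u_ := exp_scalar r)).
  apply/nondecreasing_seqP => m.
  by rewrite /exp_scalar big_nat_recr //= lerDl divr_ge0 ?exprn_ge0.
exact: (is_cvg_series_exp_coeff r).
Qed.

Lemma exp_sum_bound a n f : nrm (exp_sum a n f) <= expR (cabs a * c) * nrm f.
Proof.
have r0 : 0 <= cabs a * c by rewrite mulr_ge0 ?cabs_ge0.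
apply: (@le_trans _ _ (exp_scalar (cabs a * c) n * nrm f)).
  by rewrite /exp_scalar mulr_suml; apply: nrm_sum => j; exact: exp_term_bound.
by rewrite ler_wpM2r ?nrm_ge0 // exp_scalar_le.
Qed.

Lemma exp_sum_cvg a f : exp_sum a n f @[n --> \oo] --> exp_op a f.
Proof.
have [l hl] : exists l : E, (fun n => exp_sum a n f) @ \oo --> l.
  apply: complete_nrm => e e0.
  pose r := cabs a * c.
  have e10 : 0 < e / (nrm f + 1) by rewrite divr_gt0 // ltr_wpDl ?nrm_ge0.
  have /cauchy_cvgP/cauchy_seriesP := is_cvg_series_exp_coeff r.
  move=> /(_ _ e10)[[A B] /= [[N1 _ hN1] [N2 _ hN2]] hAB].
  exists (maxn N1 N2) => m n.
  wlog mn : m n / (m <= n)%N => [h Nm Nn|Nm Nn].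
    have [|/ltnW] := leqP m n => mn; first exact: h.
    by rewrite nrmB; exact: h.
  have := hAB (m, n) (conj (hN1 m _) (hN2 n _)).
  rewrite /= (leq_trans (leq_maxl _ _) Nm) (leq_trans (leq_maxr _ _) Nn) => /(_ isT isT) h.
  rewrite nrmB /exp_sum (big_cat_nat _ mn) //= [X in nrm X]addrC addrA addNr add0r.
  apply: (@le_lt_trans _ _ (\sum_(m <= j < n) (r ^+ j / j`!%:R * nrm f))).
    by apply: nrm_sum => j; exact: exp_term_bound.
  rewrite -mulr_suml.
  have := le_lt_trans (ler_norm _) h; rewrite ltr_pdivlMr ?ltr_wpDl ?nrm_ge0 //.
  apply: le_lt_trans; rewrite ler_wpM2l ?lerDl //.
  by apply: sumr_ge0 => j _; rewrite divr_ge0 ?exprn_ge0 ?mulr_ge0 ?cabs_ge0.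
have -> : exp_op a f = l; last exact: hl.
rewrite /exp_op /expop; have -> : series (fun n => (n`!%:R : R[i])^-1 *:
    iter n (fun x => a *: Q x) f) = (fun n => exp_sum a n f).
  by apply/funext => n; exact: exp_sumE.
exact/cvg_lim.
Qed.

Lemma iterQ_sum j (r : seq nat) (F : nat -> E) :
  iter j Q (\sum_(q <- r) F q) = \sum_(q <- r) iter j Q (F q).
Proof.
apply: (big_morph (iter j Q)) => [x y|].
  by have := iterQ_lin 1 j x y; rewrite !scale1r.
by have := iterQ_lin (-1) j 0 0; rewrite scaler0 addr0 scaleN1r addNr.
Qed.

(** The corner left by [square_sum_split] is dominated term by term by the corner of the product of
    the scalar series, which equals the bracket on the right. *)
Lemma exp_sum_comp a d n f : nrm (exp_sum a n (exp_sum d n f) - exp_sum (a + d) n f) <=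
  (exp_scalar (cabs a * c) n * exp_scalar (cabs d * c) n -
   exp_scalar (cabs a * c + cabs d * c) n) * nrm f.
Proof.
have iterZ j (x : R[i]) g : iter j Q (x *: g) = x *: iter j Q g.
  by elim: j => //= j ->; rewrite Q_scale.
have -> : exp_sum a n (exp_sum d n f) = \sum_(0 <= p < n) \sum_(0 <= q < n)
    (a ^+ p / p`!%:R * (d ^+ q / q`!%:R)) *: iter (p + q) Q f.
  apply: eq_bigr => p _; rewrite iterQ_sum scaler_sumr; apply: eq_bigr => q _.
  by rewrite iterZ scalerA iterD.
rewrite square_sum_split.
have -> : exp_sum (a + d) n f = \sum_(0 <= m < n) \sum_(0 <= p < m.+1)
    (a ^+ p / p`!%:R * (d ^+ (m - p) / (m - p)`!%:R)) *: iter (p + (m - p)) Q f.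
  apply: eq_bigr => m _; rewrite exp_coeffD scaler_suml.
  by apply: eq_big_nat => p /andP[_ pm]; rewrite subnKC.
rewrite [X in nrm X]addrC addKr.
have -> : exp_scalar (cabs a * c) n * exp_scalar (cabs d * c) n -
    exp_scalar (cabs a * c + cabs d * c) n =
    \sum_(0 <= p < n) \sum_(n - p <= q < n)
      (cabs a * c) ^+ p / p`!%:R * ((cabs d * c) ^+ q / q`!%:R).
  have -> : exp_scalar (cabs a * c) n * exp_scalar (cabs d * c) n =
    \sum_(0 <= p < n) \sum_(0 <= q < n)
      (cabs a * c) ^+ p / p`!%:R * ((cabs d * c) ^+ q / q`!%:R).
    by rewrite mulr_suml; apply: eq_bigr => p _; rewrite mulr_sumr.
  rewrite square_sum_split (_ : exp_scalar _ n = \sum_(0 <= m < n) \sum_(0 <= p < m.+1)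
    (cabs a * c) ^+ p / p`!%:R * ((cabs d * c) ^+ (m - p) / (m - p)`!%:R)).
    by rewrite addrC addKr.
  by apply: eq_bigr => m _; exact: exp_coeffD.
rewrite mulr_suml; apply: nrm_sum => p; rewrite mulr_suml; apply: nrm_sum => q.
rewrite -scalerA iterD -iterZ; apply: (le_trans (exp_term_bound a p _)).
rewrite -[leRHS]mulrA ler_wpM2l //; last exact: exp_term_bound.
by rewrite divr_ge0 ?exprn_ge0 ?mulr_ge0 ?cabs_ge0.
Qed.

Lemma exp_sum_lin a n (x : R[i]) f g :
  exp_sum a n (x *: f + g) = x *: exp_sum a n f + exp_sum a n g.
Proof.
rewrite /exp_sum scaler_sumr -big_split /=; apply: eq_bigr => j _.
by rewrite iterQ_lin scalerDr !scalerA (mulrC x).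
Qed.

Lemma exp_op_near a f e : 0 < e -> exists m, forall n, (m <= n)%N ->
  nrm (exp_op a f - exp_sum a n f) < e.
Proof.
by move=> e0; apply: ((cvg_nrm (fun n => exp_sum a n f) _).1 (@exp_sum_cvg a f)).
Qed.

Lemma exp_opD a d f : exp_op a (exp_op d f) = exp_op (a + d) f.
Proof.
apply/eqP; rewrite -subr_eq0; apply/eqP; apply: nrm_small => e e0.
pose K := expR (cabs a * c).
have K0 : 0 <= K by exact: expR_ge0.
pose e1 := e / (K + 4).
have e10 : 0 < e1 by rewrite divr_gt0 // ltr_wpDl.
have eE : e = (K + 4) * e1 by rewrite mulrC divfK // gt_eqF // ltr_wpDl.
have [n1 h1] := exp_op_near d f e10.
have [n2 h2] := exp_op_near a (exp_op d f) e10.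
have [n3 h3] := exp_op_near (a + d) f e10.
have [n4 h4] : exists m, forall n, (m <= n)%N ->
    (exp_scalar (cabs a * c) n * exp_scalar (cabs d * c) n -
     exp_scalar (cabs a * c + cabs d * c) n) * nrm f < e1.
  have h : (exp_scalar (cabs a * c) n * exp_scalar (cabs d * c) n -
     exp_scalar (cabs a * c + cabs d * c) n) * nrm f @[n --> \oo] --> (0 : R).
    rewrite -[X in _ --> X](mul0r (nrm f)) -(subrr (expR (cabs a * c + cabs d * c))).
    rewrite {1}expRD; apply: cvgMl; apply: cvgB; last exact: exp_scalar_cvg.
    by apply: cvgM; exact: exp_scalar_cvg.
  have /cvgrPdist_lt/(_ _ e10)[m _ hm] := h.
  exists m => n /hm; rewrite /= sub0r normrN; exact: le_lt_trans (ler_norm _).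
pose n := maxn (maxn n1 n2) (maxn n3 n4).
have N1 : (n1 <= n)%N by rewrite !leq_max leqnn.
have N2 : (n2 <= n)%N by rewrite !leq_max leqnn !orbT.
have N3 : (n3 <= n)%N by rewrite !leq_max leqnn !orbT.
have N4 : (n4 <= n)%N by rewrite !leq_max leqnn !orbT.
set D := exp_op d f in h1 h2 *.
have -> : exp_op a D - exp_op (a + d) f = (exp_op a D - exp_sum a n D) +
    (exp_sum a n (-1 *: exp_sum d n f + D) +
     ((exp_sum a n (exp_sum d n f) - exp_sum (a + d) n f) -
      (exp_op (a + d) f - exp_sum (a + d) n f))).
  by rewrite exp_sum_lin; vec dot_norm.
rewrite eE (le_lt_trans (nrmD _ _)) //.
have := nrmD (exp_sum a n (-1 *: exp_sum d n f + D))
     ((exp_sum a n (exp_sum d n f) - exp_sum (a + d) n f) -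
      (exp_op (a + d) f - exp_sum (a + d) n f)).
have := nrmD (exp_sum a n (exp_sum d n f) - exp_sum (a + d) n f)
      (- (exp_op (a + d) f - exp_sum (a + d) n f)).
rewrite (nrmN (exp_op (a + d) f - _)).
have := exp_sum_bound a n (-1 *: exp_sum d n f + D).
rewrite scaleN1r [- _ + D]addrC -/K.
have := ler_wpM2l K0 (ltW (h1 _ N1)).
have := h2 _ N2; have := h3 _ N3; have := h4 _ N4.
have := exp_sum_comp a d n f.
by lra.
Qed.

Lemma exp_op0 f : exp_op 0 f = f.
Proof.
apply/eqP; rewrite -subr_eq0; apply/eqP; apply: nrm_small => e e0.
have [m hm] := exp_op_near 0 f e0.
have := hm m.+1 (leqnSn m); rewrite /exp_sum big_nat_recl //= big1_seq => [|j _].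
  by rewrite expr0 fact0 invr1 mulr1 scale1r addr0.
by rewrite exprS !mul0r scale0r.
Qed.

Lemma exp_op_lin a (x : R[i]) f g :
  exp_op a (x *: f + g) = x *: exp_op a f + exp_op a g.
Proof.
apply/eqP; rewrite -subr_eq0; apply/eqP; apply: nrm_small => e e0.
have x0 : 0 < cabs x + 2 by rewrite ltr_wpDl ?cabs_ge0.
have e10 : 0 < e / (cabs x + 2) by rewrite divr_gt0.
have [n1 h1] := exp_op_near a f e10; have [n2 h2] := exp_op_near a g e10.
have [n3 h3] := exp_op_near a (x *: f + g) e10.
pose n := maxn n1 (maxn n2 n3).
have N1 : (n1 <= n)%N by rewrite !leq_max leqnn.
have N2 : (n2 <= n)%N by rewrite !leq_max leqnn !orbT.
have N3 : (n3 <= n)%N by rewrite !leq_max leqnn !orbT.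
have -> : exp_op a (x *: f + g) - (x *: exp_op a f + exp_op a g) =
    (exp_op a (x *: f + g) - exp_sum a n (x *: f + g)) -
    (x *: (exp_op a f - exp_sum a n f) + (exp_op a g - exp_sum a n g)).
  by rewrite exp_sum_lin; vec dot_norm.
have -> : e = (cabs x + 2) * (e / (cabs x + 2)) by rewrite mulrC divfK // gt_eqF.
rewrite (le_lt_trans (nrmD _ _)) // nrmN.
have := nrmD (x *: (exp_op a f - exp_sum a n f)) (exp_op a g - exp_sum a n g).
rewrite nrmZ; have := ler_wpM2l (cabs_ge0 x) (ltW (h1 _ N1)).
have := h2 _ N2; have := h3 _ N3.
by move: (e / _) => e1; lra.
Qed.

Lemma exp_op_bound a f : nrm (exp_op a f) <= expR (cabs a * c) * nrm f.
Proof.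
apply/ler_addgt0Pr => e e0; have [m hm] := exp_op_near a f e0.
rewrite -[exp_op a f](subrK (exp_sum a m f)) (le_trans (nrmD _ _)) // addrC.
by apply: lerD; [exact: exp_sum_bound|rewrite ltW // hm].
Qed.

(** An isometric [Y] passes to the limit of the partial sums. With [Y = P] and [s = r = -1] it gives
    [P e^-Q = e^Q P]. *)
Lemma exp_op_intertwine (Y : E -> E) (s r : R) :
  (forall f, nrm (Y f) = nrm f) -> (forall f g, Y (f + g) = Y f + Y g) ->
  (forall (t : R) f, Y (t%:C *: f) = t%:C *: Y f) ->
  (forall f, Y (Q f) = s%:C *: Q (Y f)) ->
  forall f, Y (exp_op r%:C f) = exp_op (r * s)%:C (Y f).
Proof.
move=> Yn YD YZ YQ f.
have Y0 : Y 0 = 0 by have := YZ 0 0; rewrite !scale0r.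
have YN g : Y (- g) = - Y g.
  by apply/eqP; rewrite -addr_eq0 -YD addNr Y0.
have Yiter j g : Y (iter j Q g) = (s ^+ j)%:C *: iter j Q (Y g).
  elim: j g => [|j IH] g /=; first by rewrite scale1r.
  by rewrite YQ IH Q_scale scalerA -rmorphM exprS.
have Ysum n : Y (exp_sum r%:C n f) = exp_sum (r * s)%:C n (Y f).
  rewrite /exp_sum (big_morph Y YD Y0); apply: eq_bigr => j _.
  have e (t : R) : (t%:C) ^+ j / j`!%:R = (t ^+ j / j`!%:R)%:C :> R[i].
    by rewrite rmorphM /= rmorphXn fmorphV rmorph_nat.
  by rewrite !e YZ Yiter scalerA -rmorphM; congr (_%:C *: _); rewrite exprMn mulrAC.
apply/eqP; rewrite -subr_eq0; apply/eqP; apply: nrm_small => e e0.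
have e20 : 0 < e / 2 by rewrite divr_gt0.
have [n1 h1] := exp_op_near r%:C f e20.
have [n2 h2] := exp_op_near (r * s)%:C (Y f) e20.
pose n := maxn n1 n2.
have := h1 _ (leq_maxl n1 n2); have := h2 _ (leq_maxr n1 n2).
rewrite -/n -[nrm (exp_op r%:C f - _)]Yn YD YN Ysum => h3 h4.
have -> : Y (exp_op r%:C f) - exp_op (r * s)%:C (Y f) =
  (Y (exp_op r%:C f) - exp_sum (r * s)%:C n (Y f)) -
  (exp_op (r * s)%:C (Y f) - exp_sum (r * s)%:C n (Y f)).
  by rewrite opprB addrA subrK.
by rewrite (le_lt_trans (nrmD _ _)) // nrmN; lra.
Qed.

Hypothesis Q_sa : forall f g, dot (Q f) g = dot f (Q g).

Lemma exp_op_selfadjoint (r : R) f g :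
  dot (exp_op r%:C f) g = dot f (exp_op r%:C g).
Proof.
have iter_sa j f' g' : dot (iter j Q f') g' = dot f' (iter j Q g').
  by elim: j f' g' => // j IH f' g'; rewrite iterS Q_sa IH -iterSr.
have sum_sa n : dot (exp_sum r%:C n f) g = dot f (exp_sum r%:C n g).
  rewrite /exp_sum; elim: n => [|n IH]; first by rewrite !big_nil dot0l dot0r.
  rewrite !big_nat_recr //= dotDl dotDr IH dotZl dotZr; congr (_ + _ * _).
    have -> : (r%:C) ^+ n / n`!%:R = (r ^+ n / n`!%:R)%:C :> R[i].
      by rewrite rmorphM /= rmorphXn fmorphV rmorph_nat.
    by rewrite conjC_realC.
  exact: iter_sa.
apply/eqP; rewrite -subr_eq0; apply/eqP; apply: cabs_eq0; apply/eqP.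
rewrite eq_le cabs_ge0 andbT; apply/ler_addgt0Pr => e e0; rewrite add0r.
pose K := nrm f + nrm g + 1.
have K0 : 0 < K by rewrite ltr_wpDl // addr_ge0 ?nrm_ge0.
have e10 : 0 < e / K by rewrite divr_gt0.
have [n1 h1] := exp_op_near r%:C f e10; have [n2 h2] := exp_op_near r%:C g e10.
pose n := maxn n1 n2.
have := h1 _ (leq_maxl n1 n2); have := h2 _ (leq_maxr n1 n2); rewrite -/n => h3 h4.
have -> : dot (exp_op r%:C f) g - dot f (exp_op r%:C g) =
  dot (exp_op r%:C f - exp_sum r%:C n f) g - dot f (exp_op r%:C g - exp_sum r%:C n g).
  by rewrite dotDl dotDr dotNl dotNr sum_sa; ring.
rewrite (le_trans (cabsD _ _)) // cabsN.
apply: (le_trans (lerD (dot_cauchy_schwarz dot_norm _ _) (dot_cauchy_schwarz dot_norm _ _))).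
have eE : e = e / K * K by rewrite divfK // gt_eqF.
rewrite [leRHS]eE.
have := ler_wpM2r (nrm_ge0 g) (ltW h4); have := ler_wpM2l (nrm_ge0 f) (ltW h3).
by rewrite /K in e10 *; move: (e / _) e10 => e1 e10; lra.
Qed.

(** [<e^Q f, f> = |e^(Q/2) f|^2], and [K] bounds the inverse [e^(-Q/2)]. *)
Lemma exp_op_coercive : exists2 d : R, 0 < d &
  forall f, d * nrm f ^+ 2 <= complex.Re (dot (exp_op 1 f) f).
Proof.
pose h : R := 2^-1; pose K := expR (cabs (- h%:C : R[i]) * c).
have K0 : 0 < K by exact: expR_gt0.
exists (K ^- 2) => [|f]; first by rewrite invr_gt0 exprn_gt0.
have -> : exp_op 1 f = exp_op h%:C (exp_op h%:C f).
  rewrite exp_opD -rmorphD; congr (exp_op _ f).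
  by rewrite /h -[2^-1]mul1r -splitr.
rewrite exp_op_selfadjoint (Re_dot_nrm dot_norm) mulrC ler_pdivrMr ?exprn_gt0 //.
rewrite -exprMn ler_pXn2r ?nnegrE ?mulr_ge0 ?nrm_ge0 ?(ltW K0) //.
rewrite mulrC -{1}[f]exp_op0 -(addNr (h%:C : R[i])) -exp_opD; exact: exp_op_bound.
Qed.

End Exponential.

(** * Operators commuting with a semigroup of isometries *)

Section DiniComparison.
Variables (R : realType) (phi : R -> R).
Hypothesis phi0 : phi 0 <= 0.
Hypothesis phi_dini : forall s e : R, 0 <= s -> 0 < e -> exists2 d, 0 < d &
  forall h, 0 < h -> h < d -> phi (s + h) <= phi s + e * h.
Hypothesis phi_left : forall s e : R, 0 < s -> 0 < e -> exists2 d, 0 < d &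
  forall r, 0 <= r -> s - d < r -> r <= s -> phi s <= phi r + e.

(** For each slope [e > 0], the supremum [c] of the [s] with [phi s <= e s] satisfies this
    inequality too, by left semicontinuity, and the Dini bound would allow a larger [s] if
    [c < t]. *)
Lemma dini_le0 t : 0 <= t -> phi t <= 0.
Proof.
move=> t0; apply/ler_addgt0Pr => e' e'0; rewrite add0r.
pose e := e' / (t + 1).
have t10 : 0 < t + 1 by rewrite ltr_wpDl.
have e0 : 0 < e by rewrite divr_gt0.
pose S := [set s : R | [/\ 0 <= s, s <= t & phi s <= e * s]].
have S0 : S 0 by split; rewrite ?mulr0.
have supS : has_sup S by split; [exists 0|exists t => s []].
pose c := sup S.
have c0 : 0 <= c by apply: ub_le_sup => //; exact: supS.2.
have ct : c <= t by apply: ge_sup; [exact: supS.1|move=> s []].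
have Sc : phi c <= e * c.
  have [c_eq0|cn0] := eqVneq c 0; first by rewrite c_eq0 mulr0.
  have c_gt0 : 0 < c by rewrite lt_def cn0.
  apply/ler_addgt0Pr => x x0; have [d d0 dP] := phi_left c_gt0 x0.
  have [s [s0 st sP] cs] := sup_adherent d0 supS.
  have sc : s <= c by apply: ub_le_sup => //; exact: supS.2.
  apply: (le_trans (dP s s0 cs sc)); rewrite lerD2r (le_trans sP) //.
  by rewrite ler_wpM2l // ltW.
have [ct'|tc] := ltP c t; last first.
  have -> : t = c by apply/eqP; rewrite eq_le tc ct.
  apply: (le_trans Sc); apply: (@le_trans _ _ (e * (t + 1))).
    by rewrite ler_wpM2l ?(ltW e0) // (le_trans ct) // lerDl.
  by rewrite /e divfK // gt_eqF.
have [d d0 dP] := phi_dini c0 e0.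
pose h := Num.min (d / 2) (t - c).
have h0 : 0 < h by rewrite lt_min divr_gt0 //= subr_gt0.
have hd : h < d by rewrite gt_min ltr_pdivrMr // mulrDr mulr1 ltrDl d0.
have : S (c + h).
  split; first by rewrite addr_ge0 // ltW.
    by rewrite -lerBrDl ge_min lexx orbT.
  by rewrite mulrDr (le_trans (dP h h0 hd)) // lerD2r.
move=> /(ub_le_sup supS.2); rewrite -/c gerDl.
by rewrite leNgt h0.
Qed.

End DiniComparison.

Section Semigroup.
Variables (R : realType) (E : completeNormedModType R[i]).
Variable dot : {dot E for Num.conj}.
Hypothesis dot_norm : forall x, dot x x = `|x| ^+ 2.
Variables (V : R -> {linear E -> E}) (G : set (E * E)).
Hypothesis V_gen : isometric_semigroup V G.
Implicit Types (f u v x y : E) (s t h e : R).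

Lemma cvg_at_right_nrm (F : R -> E) (l : E) : F t @[t --> (0 : R)^'+] --> l ->
  forall e, 0 < e -> exists2 d, 0 < d & forall t, 0 < t -> t < d -> nrm (l - F t) < e.
Proof.
move=> Fl e e0.
have /Fl : nbhs l [set y | nrm (l - y) < e] by apply/near_nrm; exists e.
move=> /nbhs_normP[d /= d0 dP].
by exists d => // t t0 td; apply: dP => //=; rewrite sub0r normrN gtr0_norm.
Qed.

Lemma semigroup_nrm t f : 0 <= t -> nrm (V t f) = nrm f.
Proof. by case: V_gen => _ _ h _ _ t0; rewrite /nrm h. Qed.

Lemma semigroupD s t f : 0 <= s -> 0 <= t -> V (s + t) f = V s (V t f).
Proof. by case: V_gen => _ h _ _ _; exact: h. Qed.

Lemma semigroup_gen s u v : 0 <= s -> G (u, v) -> G (V s u, V s v).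
Proof.
case: V_gen => _ _ _ _ Gcvg s0 /Gcvg h; apply/Gcvg.
move=> B /near_nrm[e e0 eB]; have [d d0 dP] := cvg_at_right_nrm h e0.
apply/nbhs_normP; exists d => //= t /=; rewrite sub0r normrN => td t0.
apply: eB; rewrite gtr0_norm // in td.
rewrite -semigroupD ?(ltW t0) // [t + s]addrC semigroupD ?(ltW t0) //.
have -> : V s v - (t%:C)^-1 *: (V s (V t u) - V s u) =
    V s (v - (t%:C)^-1 *: (V t u - u)).
  by rewrite !(linearB, linearZ).
by rewrite semigroup_nrm //; exact: dP.
Qed.

Lemma semigroup_small f e : 0 < e -> exists2 d, 0 < d &
  forall t, 0 <= t -> t < d -> nrm (V t f - f) < e.
Proof.
case: V_gen => V0 _ _ Vc _ e0; have [d d0 dP] := cvg_at_right_nrm (Vc f) e0.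
exists d => // t; rewrite le_eqVlt => /predU1P[<- _|t0 td].
  by rewrite V0 subrr nrm0.
by rewrite nrmB; exact: dP.
Qed.

Section Commutation.
Variables (X : E -> E) (c : R).
Hypothesis c0 : 0 <= c.
Hypothesis XD : forall x y, X (x + y) = X x + X y.
Hypothesis XZ : forall (r : R) x, X (r%:C *: x) = r%:C *: X x.
Hypothesis X_bnd : forall x, nrm (X x) <= c * nrm x.
Hypothesis XG : intertwines X G G.

Lemma real_linearB x y : X (x - y) = X x - X y.
Proof.
have XN z : X (- z) = - X z by have := XZ (-1) z; rewrite rmorphN rmorph1 !scaleN1r.
by rewrite XD XN.
Qed.

(** Both terms have right derivative [X y'] at [h = 0]. *)
Lemma commute_dini y y' e : G (y, y') -> 0 < e -> exists2 d, 0 < d &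
  forall h, 0 < h -> h < d -> nrm (X (V h y) - V h (X y)) <= e * h.
Proof.
move=> Gy e0; have [_ _ _ _ Gcvg] := V_gen.
have c1 : 0 < c + 1 by rewrite ltr_wpDl.
have [e1 e10 eE] : exists2 e1, 0 < e1 & e = (c + 1) * e1.
  by exists (e / (c + 1)); [rewrite divr_gt0|rewrite mulrC divfK // gt_eqF].
have [d1 d10 h1] := cvg_at_right_nrm ((Gcvg _ _).1 Gy) e10.
have [d2 d20 h2] := cvg_at_right_nrm ((Gcvg _ _).1 (XG Gy)) e10.
exists (Num.min d1 d2) => [|h h0]; first by rewrite lt_min d10.
rewrite lt_min => /andP[hd1 hd2].
have hn0 : h%:C != 0 :> R[i].
  by apply/eqP => /(congr1 (@complex.Re _)) /= hE; rewrite hE ltxx in h0.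
have -> : X (V h y) - V h (X y) =
    h%:C *: (- X (y' - (h%:C)^-1 *: (V h y - y)) +
             (X y' - (h%:C)^-1 *: (V h (X y) - X y))).
  rewrite -fmorphV real_linearB XZ real_linearB fmorphV; vec dot_norm.
  by field.
rewrite nrmZ cabs_real gtr0_norm // mulrC ler_wpM2r ?(ltW h0) //.
rewrite (le_trans (nrmD _ _)) // nrmN.
have := h2 _ h0 hd2; have := X_bnd (y' - (h%:C)^-1 *: (V h y - y)).
have := ler_wpM2l c0 (ltW (h1 _ h0 hd1)).
by rewrite eE; lra.
Qed.

(** The norm of [X V(s) u - V(s) X u] has nonpositive right Dini derivative: [V(h)] preserves the
    norm of the difference already present, and what is added is [o(h)] by [commute_dini] at
    [V(s) u]. *)
Lemma commute_semigroup_domain t u v : 0 <= t -> G (u, v) -> X (V t u) = V t (X u).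
Proof.
move=> t0 Guv; apply/eqP; rewrite -subr_eq0; apply/eqP; apply: nrm_eq0.
apply/eqP; rewrite eq_le nrm_ge0 andbT.
have [V0 _ _ _ _] := V_gen.
apply: (@dini_le0 _ (fun s => nrm (X (V s u) - V s (X u)))) t0 => [|s e s0 e0|s e s0 e0].
- by rewrite !V0 subrr nrm0.
- have [d d0 dP] := commute_dini (semigroup_gen s0 Guv) e0.
  exists d => // h h0 hd.
  rewrite [s + h]addrC !semigroupD ?(ltW h0) //.
  have -> : X (V h (V s u)) - V h (V s (X u)) =
    (X (V h (V s u)) - V h (X (V s u))) + V h (X (V s u) - V s (X u)).
    by rewrite linearB addrA subrK.
  rewrite (le_trans (nrmD _ _)) // semigroup_nrm ?(ltW h0) // addrC lerD2l.
  exact: dP.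
have c2 : 0 < c + 2 by rewrite ltr_wpDl.
have [e1 e10 eE] : exists2 e1, 0 < e1 & e = (c + 2) * e1.
  by exists (e / (c + 2)); [rewrite divr_gt0|rewrite mulrC divfK // gt_eqF].
have [d1 d10 h1] := semigroup_small u e10.
have [d2 d20 h2] := semigroup_small (X u) e10.
exists (Num.min d1 d2) => [|r r0]; first by rewrite lt_min d10.
rewrite ltrBlDl -ltrBlDr lt_min => /andP[rd1 rd2] rs.
have sr0 : 0 <= s - r by rewrite subr_ge0.
have Vs f : V s f = V r (V (s - r) f) by rewrite -semigroupD // addrC subrK.
have -> : X (V s u) - V s (X u) = (X (V r u) - V r (X u)) +
   (X (V r (V (s - r) u - u)) - V r (V (s - r) (X u) - X u)).
  by rewrite !Vs !linearB real_linearB; vec dot_norm.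
rewrite (le_trans (nrmD _ _)) // lerD2l (le_trans (nrmD _ _)) // nrmN.
rewrite semigroup_nrm //.
have := X_bnd (V r (V (s - r) u - u)); rewrite semigroup_nrm //.
have := ler_wpM2l c0 (ltW (h1 _ sr0 rd1)); have := h2 _ sr0 rd2.
by rewrite eE; lra.
Qed.

Hypothesis G_dense : closure (opdom G) = setT.

Lemma commute_semigroup t f : 0 <= t -> X (V t f) = V t (X f).
Proof.
move=> t0; apply/eqP; rewrite -subr_eq0; apply/eqP; apply: nrm_small => e e0.
have d0 : 0 < 2 * c + 1 by rewrite ltr_wpDl // mulr_ge0.
have : closure (opdom G) f by rewrite G_dense.
move=> /closure_nrm/(_ (e / (2 * c + 1)))[|u [v Guv] fu]; first by rewrite divr_gt0.
have -> : X (V t f) - V t (X f) = X (V t (f - u)) - V t (X (f - u)).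
  by rewrite linearB !real_linearB linearB (commute_semigroup_domain t0 Guv); vec dot_norm.
rewrite (le_lt_trans (nrmD _ _)) // nrmN semigroup_nrm //.
have := X_bnd (V t (f - u)); rewrite semigroup_nrm // => h1; have h2 := X_bnd (f - u).
move: fu; rewrite ltr_pdivlMr // => fu.
by have := nrm_ge0 (f - u); lra.
Qed.

End Commutation.
End Semigroup.

(** * The shifted operator B_rho *)

Section ShiftedOperator.
Variables (R : realType) (E : completeNormedModType R[i]).
Variable dot : {dot E for Num.conj}.
Hypothesis dot_norm : forall x, dot x x = `|x| ^+ 2.
Variables (V : R -> {linear E -> E}) (B : set (E * E)) (rho : R).
Hypothesis V_gen : isometric_semigroup V (opscale 'i B).
Hypothesis rho_ge0 : 0 <= rho.
Hypothesis B_cdd : closed_densely_defined B.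
Local Notation M := (sub_range V rho).
Local Notation A := (sub_op V rho B).
Implicit Types (u v x y : E).

Lemma shift_nrm x : nrm (V rho x) = nrm x.
Proof. exact: semigroup_nrm V_gen _ _ rho_ge0. Qed.

Lemma isometry_dot x y : dot (V rho x) (V rho y) = dot x y.
Proof.
have ReV u v : complex.Re (dot (V rho u) (V rho v)) = complex.Re (dot u v).
  have := nrm_sqrD dot_norm (V rho u) (V rho v).
  by rewrite -linearD !shift_nrm (nrm_sqrD dot_norm); lra.
apply: complex_ext; first exact: ReV.
have := ReV ('i *: x) y; rewrite linearZ !dotZl !ReImE /=.
by lra.
Qed.

Lemma op_single u v v' : B (u, v) -> B (u, v') -> v = v'.
Proof.
case: B_cdd => [[sB B0] _ _] h h'; apply/eqP; rewrite -subr_eq0; apply/eqP/B0.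
have := sB.2 (-1) _ _ h' h; rewrite scaleN1r addrC.
by rewrite (_ : _ - _ = (0, v - v')) //; congr (_, _); rewrite subrr.
Qed.

(** [V rho] maps the graph of [B] into itself, so [B_rho] is the copy of [B] under this isometry;
    the properties of [B] are transported this way. *)
Lemma sub_opP u v : A (u, v) <->
  exists u' v', [/\ B (u', v'), u = V rho u' & v = V rho v'].
Proof.
have VB u' v' : B (u', v') -> B (V rho u', V rho v').
  move=> Buv; have : opscale 'i B (u', 'i *: v') by exists v'.
  move=> /(semigroup_gen V_gen rho_ge0)[w Bw] /=; rewrite linearZ /=.
  by move/(scalerI (neq0Ci _)) => ->.
split=> [[/= Buv [u' [v' Buv'] uE]]|[u' [v' [Buv' -> ->]]]].
  exists u', v'; split=> //; apply: (op_single Buv); rewrite -uE; exact: VB.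
by split=> /=; [exact: VB|exists u' => //; exists v'].
Qed.

Lemma range_subspace : is_subspace M.
Proof.
split=> [|a _ _ [x _ <-] [y _ <-]]; first by exists 0 => //; rewrite linear0.
by exists (a *: x + y) => //; rewrite linearP.
Qed.

(** An isometry is bounded below by 1, so [closed_range] applies to its graph within the closure of
    the range. *)
Lemma range_closed : closed M.
Proof.
have sM := closure_subspace range_subspace.
move=> y cly.
suff [u /= ->] : exists u, [set p : E * E | p.2 = V rho p.1] (u, y) by exists u.
apply: (@closed_range _ _ dot dot_norm [set p : E * E | p.2 = V rho p.1]
  (closure M) 1) (y) cly => // [|||u v /= ->|u v /= ->|p clp hp].
- by split=> [|a [u v] [u' v'] /= -> ->]; rewrite /= ?linear0 ?linearP.
- apply: closed_graph_nrm => u v /= h; apply/eqP; rewrite -subr_eq0; apply/eqP.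
  apply: nrm_small => e e0; have [[p q] /= [-> up vq]] := h (e / 2) ltac:(by rewrite divr_gt0).
  have -> : v - V rho u = (v - V rho p) - V rho (u - p) by rewrite linearB; vec dot_norm.
  by rewrite (le_lt_trans (nrmD _ _)) // nrmN shift_nrm; lra.
- exact: closed_closure.
- by apply: subset_closure; exists u.
- by rewrite mul1r shift_nrm.
apply: (dot_eq0 dot_norm); apply: (closure_orthogonal dot_norm) clp => _ [u _ <-].
exact: (hp u).
Qed.

Hypothesis B_sym : B `<=` adjoint dot setT B.
Hypothesis B_def : opker (adjoint dot setT B) 'i = [set 0].

Lemma sub_op_maximal_symmetric : maximal_symmetric_in dot M A.
Proof.
have [[sB B0] clB dB] := B_cdd.
split=> //.
- exact: range_subspace.
- exact: range_closed.
- by move=> u v /sub_opP[u' [v' [_ -> ->]]]; split; [exists u'|exists v'].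
- split=> [|a [u v] [x y] /sub_opP[u' [v' [h1 -> ->]]] /sub_opP[x' [y' [h2 -> ->]]]].
    by apply/sub_opP; exists 0, 0; rewrite linear0; split=> //; exact: sB.1.
  apply/sub_opP; exists (a *: u' + x'), (a *: v' + y').
  by rewrite !linearP; split=> //; exact: (sB.2 a _ _ h1 h2).
- apply: closed_graph_nrm => u v h.
  have [u' Tu uE] : M u.
    apply: (closed_nrm range_closed) => e /h[[p q] [/sub_opP[p' [q' [_ pE _]]] /= up _]].
    by exists p => //; exists p'.
  have [v' Tv vE] : M v.
    apply: (closed_nrm range_closed) => e /h[[p q] [/sub_opP[p' [q' [_ _ qE]]] /= _ vq]].
    by exists q => //; exists q'.
  apply/sub_opP; exists u', v'; split=> //.
  apply: (closed_pair_nrm clB) => e /h[[p q] [/sub_opP[p' [q' [h1 -> ->]]] /= up vq]].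
  exists (p', q'); split=> //=.
    by rewrite -shift_nrm linearB uE.
  by rewrite -shift_nrm linearB vE.
- move=> _ [x _ <-]; apply/closure_nrm => e e0.
  have : closure (opdom B) x by rewrite dB.
  move=> /closure_nrm/(_ e e0)[u [v Buv] xu].
  exists (V rho u); last by rewrite -linearB shift_nrm.
  by exists (V rho v); apply/sub_opP; exists u, v.
- move=> [u v] /sub_opP[u' [v' [h1 -> ->]]]; split=> /=; [by exists u'|by exists v'|].
  move=> x y /sub_opP[x' [y' [h2 -> ->]]]; rewrite !isometry_dot.
  by have [_ _ h] := B_sym h1; exact: h.
- move=> p [/= [q _ pE] _ h]; rewrite -pE in h *.
  suff -> : q = 0 by rewrite linear0.
  have : opker (adjoint dot setT B) 'i q.
    split=> //= u v Buv; have := h (V rho u) (V rho v); rewrite /= -linearZ /= !isometry_dot.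
    by apply; apply/sub_opP; exists u, v.
  by rewrite B_def.
Qed.

Section Intertwining.
Variables (X : E -> E) (c s : R) .
Hypothesis c0 : 0 <= c.
Hypothesis XD : forall x y, X (x + y) = X x + X y.
Hypothesis XZ : forall (r : R) x, X (r%:C *: x) = r%:C *: X x.
Hypothesis X_bnd : forall x, nrm (X x) <= c * nrm x.
Hypothesis XB : forall u v, B (u, v) -> B (X u, s%:C *: X v).
Hypothesis Xi : forall x, X ('i *: x) = s%:C *: ('i *: X x).

(** The factor [s] is the same in the hypotheses on [B] and on [i], so [X] commutes with the
    generator [iB]. The value [s = 1] serves for [e^Q], and [s = -1] for [PT]. *)
Lemma commute_shift x : X (V rho x) = V rho (X x).
Proof.
have [_ _ dB] := B_cdd.
apply: (commute_semigroup dot_norm V_gen c0 XD XZ X_bnd) rho_ge0.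
  move=> u w [v /= Buv ->]; exists (s%:C *: X v); first exact: XB.
  by rewrite /= Xi !scalerA mulrC.
rewrite -subTset -dB; apply: closureS => u [v Buv].
by exists ('i *: v), v.
Qed.

Lemma intertwine_range x : M x -> M (X x).
Proof. by move=> [y _ <-]; exists (X y) => //; rewrite commute_shift. Qed.

Lemma intertwine_sub_op u v : A (u, v) -> A (X u, s%:C *: X v).
Proof.
move=> /sub_opP[u' [v' [h -> ->]]]; apply/sub_opP.
by exists (X u'), (s%:C *: X v'); rewrite linearZ !commute_shift; split=> //; exact: XB.
Qed.

End Intertwining.
End ShiftedOperator.

(** * Transfer of the symmetries from [B] to [B_rho], and the three relations for [S(k)] *)

Unset Implicit Arguments.

Theorem theorem3p9 (R : realType) (E : completeNormedModType R[i])
    (dot : {dot E for Num.conj})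
    (dot_norm : forall x, dot x x = `|x| ^+ 2)
    (B : set (E * E))
    (B_max : maximal_symmetric dot B) (B_simple : simple_op dot B)
    (B_def_minus : opker (adjoint dot setT B) 'i = [set 0])
    (B_def_plus : opker (adjoint dot setT B) (- 'i) <> [set 0])
    (V : R -> {linear E -> E})
    (V_gen : isometric_semigroup V (opscale 'i B))
    (P : {linear E -> E})
    (P_inv : forall f, P (P f) = f)
    (P_unitary : forall f g, dot (P f) (P g) = dot f g)
    (T : {linear E -> E | (Num.conj \; *:%R)})
    (T_inv : forall f, T (T f) = f)
    (T_conj : forall f g, dot (T f) (T g) = dot g f)
    (PT_comm : forall f, P (T f) = T (P f))
    (PB : intertwines P B B)
    (TB : intertwines T B (opscale (-1) B))
    (Q : {linear E -> E})
    (Q_bounded : bounded_in setT Q)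
    (Q_selfadjoint : forall f g, dot (Q f) g = dot f (Q g))
    (PQ : forall f, P (Q f) = - Q (P f))
    (TQ : forall f, T (Q f) = - Q (T f))
    (CB : intertwines (fun f => expop (fun g => - Q g) (P f)) B B)
    (rho : R) (rho_ge0 : 0 <= rho)
    (H : set (E * E))
    (H_pert : rho_perturbed dot (sub_op V rho B) H)
    (H_PT : intertwines (fun f => P (T f)) H H)
    (H_spec : forall z : R[i], ~ resolvent_set setT H z ->
       complex.Im z = 0 /\ 0 <= complex.Re z)
    (H_pspec : ~ point_spectrum H 0)
    (H_selfadjoint : selfadjoint (fun f g => dot (expop Q f) g) setT H) :
  let Mr := sub_range V rho in
  let Br := sub_op V rho B in
  let N := bspace dot Mr Br in
  let eQ := expop Q in
  let PT := fun f => P (T f) in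
  [/\ reduces dot N (graph_on setT eQ),
      reduces dot N (graph_on setT PT),
      forall k, upper_half_plane k -> exists S, is_Smatrix dot Mr Br H k S &
      forall S : R[i] -> E -> E,
        (forall k, upper_half_plane k -> is_Smatrix dot Mr Br H k (S k)) ->
        analytic_in N (@upper_half_plane R) S /\
        forall k, upper_half_plane k ->
          [/\ (* (i) *)
              forall f, N f ->
                adjoint dot N (graph_on N (S k)) (eQ f, eQ (S (- k^*) f)),
              (* (ii) *)
              forall f, N f ->
                dot (eQ (S (- k^*) (S k f))) f <= dot (eQ f) f &
              (* (iii) *)
              forall f, N f -> PT (S (- k^*) f) = S k (PT f)]].
Proof.
move=> Mr Br N eQ PT.
have [B_cdd B_sym _] := B_max.
have A_ms : maximal_symmetric_in dot Mr Br.
  exact: (sub_op_maximal_symmetric dot_norm V_gen rho_ge0 B_cdd B_sym B_def_minus).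
have /bounded_inP[_ _ [c c0 Qc']] := Q_bounded.
have Qc x : nrm (Q x) <= c * nrm x by exact: Qc'.
have Ql (a : R[i]) x y : Q (a *: x + y) = a *: Q x + Q y by rewrite linearP.
have eQE f : eQ f = exp_op Q 1 f.
  by rewrite /eQ /exp_op; congr (expop _ f); apply/funext => x; rewrite scale1r.
have eNE f : expop (fun g => - Q g) f = exp_op Q (-1) f.
  by rewrite /exp_op; congr (expop _ f); apply/funext => x; rewrite scaleN1r.
have [d d0 eQ_coer] := exp_op_coercive dot_norm c0 Ql Qc Q_selfadjoint.
have J_mo : metric_operator dot eQ (expR (cabs (1 : R[i]) * c)) d.
  split.
  - exact: dot_norm.
  - by move=> a x y; rewrite !eQE (exp_op_lin dot_norm c0 Ql Qc).
  - exact: expR_ge0.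
  - by move=> x; rewrite eQE (exp_op_bound c0 Ql Qc).
  - by move=> x y; rewrite !eQE; exact: (exp_op_selfadjoint dot_norm c0 Ql Qc Q_selfadjoint 1 x y).
  - exact: d0.
  - by move=> x; rewrite eQE; exact: eQ_coer.
have P_nrm x : nrm (P x) = nrm x.
  apply/eqP; rewrite -(@eqrXn2 _ 2) ?nrm_ge0 //; apply/eqP.
  by rewrite -!(Re_dot_nrm dot_norm) P_unitary.
have T_nrm x : nrm (T x) = nrm x.
  apply/eqP; rewrite -(@eqrXn2 _ 2) ?nrm_ge0 //; apply/eqP.
  by rewrite -!(Re_dot_nrm dot_norm) T_conj.
(* [P] reverses the sign of [Q]. Thus [e^Q] is [P] after [C], and it commutes with [B] because both
   factors do. *)
have PeP f : P (expop (fun g => - Q g) (P f)) = eQ f.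
  rewrite eNE eQE.
  have := exp_op_intertwine c0 Ql Qc (Y := P) (s := -1) (-1) P_nrm _ _ _ (P f).
  rewrite P_inv mulrNN mulr1 rmorphN rmorph1; apply => [f' g|r f'|f'].
  - exact: linearD.
  - exact: linearZ.
  - by rewrite PQ scaleN1r.
have JB u v : B (u, v) -> B (eQ u, eQ v) by move=> /CB/PB; rewrite !PeP.
have J_lin := mo_linear J_mo.
have JD x y : eQ (x + y) = eQ x + eQ y by have := J_lin 1 x y; rewrite !scale1r.
have JZ (a : R[i]) x : eQ (a *: x) = a *: eQ x by exact: (metric_operatorZ J_mo).
have JB1 u v : B (u, v) -> B (eQ u, (1 : R)%:C *: eQ v).
  by rewrite rmorph1 scale1r; exact: JB.
have J_i x : eQ ('i *: x) = (1 : R)%:C *: ('i *: eQ x).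
  by rewrite rmorph1 scale1r.
have JM x : Mr x -> Mr (eQ x).
  apply: (intertwine_range dot_norm V_gen rho_ge0 B_cdd (mo_ge0 J_mo) JD _ (mo_bounded J_mo) JB1 J_i).
  by move=> r y; exact: JZ.
have JA : intertwines eQ Br Br.
  move=> u v h.
  have := intertwine_sub_op dot_norm V_gen rho_ge0 B_cdd (mo_ge0 J_mo) JD _ (mo_bounded J_mo) JB1 J_i h.
  by rewrite rmorph1 scale1r; apply => r y; exact: JZ.
have Th_lin (a : R[i]) x y : PT (a *: x + y) = a^* *: PT x + PT y.
  by rewrite /PT linearP /= linearP.
have ThK x : PT (PT x) = x by rewrite /PT PT_comm P_inv T_inv.
have Th_dot x y : dot (PT x) (PT y) = dot y x by rewrite /PT P_unitary T_conj.
have ThD x y : PT (x + y) = PT x + PT y.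
  by have := Th_lin 1 x y; rewrite rmorph1 !scale1r.
have Th0' : PT 0 = 0 by rewrite /PT !linear0.
have ThZ (a : R[i]) x : PT (a *: x) = a^* *: PT x.
  by have := Th_lin a x 0; rewrite Th0' !addr0.
have ThZr (r : R) x : PT (r%:C *: x) = r%:C *: PT x by rewrite ThZ conjC_realC.
have Th_bnd x : nrm (PT x) <= 1 * nrm x by rewrite /PT P_nrm T_nrm mul1r.
have ThB u v : B (u, v) -> B (PT u, (-1 : R)%:C *: PT v).
  move=> /TB[w /= Bw Tv]; have := PB _ _ Bw; congr (B (_, _)).
  by rewrite /PT Tv linearZ rmorphN rmorph1 scalerA mulrNN mulr1 scale1r.
have Th_i x : PT ('i *: x) = (-1 : R)%:C *: ('i *: PT x).
  by rewrite ThZ conjCi rmorphN rmorph1 scaleN1r scaleNr.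
have ThM x : Mr x -> Mr (PT x).
  exact: (intertwine_range dot_norm V_gen rho_ge0 B_cdd ler01 ThD ThZr Th_bnd ThB Th_i).
have ThA u v : Br (u, v) -> Br (PT u, - PT v).
  move=> /(intertwine_sub_op dot_norm V_gen rho_ge0 B_cdd ler01 ThD ThZr Th_bnd ThB Th_i).
  by rewrite rmorphN rmorph1 scaleN1r.
have [_ H_ext H_adj_ext] := H_pert.
have NE : N = defect dot Mr Br by exact: bspaceE A_ms.
have res k : upper_half_plane k -> exists W, is_resolvent setT H (k ^+ 2) W.
  exact: (resolvent_exists H_spec).
have SE S k W n : (forall k, upper_half_plane k -> is_Smatrix dot Mr Br H k (S k)) ->
    upper_half_plane k -> is_resolvent setT H (k ^+ 2) W -> N n ->
    S k n = scattering dot Mr Br k W n.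
  move=> hS k0 HW Nn; rewrite NE in Nn.
  exact: (SmatrixE A_ms H_selfadjoint H_ext H_adj_ext k0 HW (hS k k0) Nn).
split.
- by rewrite NE; exact: (J_reduces A_ms J_mo JM JA).
- by rewrite NE; exact: (Th_reduces A_ms Th_lin ThK Th_dot ThM ThA).
- move=> k k0; have [W HW] := res k k0.
  exact: (Smatrix_exists A_ms J_mo JM JA H_selfadjoint H_spec H_ext H_adj_ext k0 HW).
move=> S hS; split.
  rewrite NE; apply: (scattering_analytic A_ms H_spec) => k W n k0 HW Nn.
  by apply: SE => //; rewrite NE.
move=> k k0.
have k'0 : upper_half_plane (- k^*) by rewrite /upper_half_plane /= ImN ImJ opprK.
have [W HW] := res k k0; have [W' HW'] := res _ k'0.
have NS k1 W1 f : N f -> N (scattering dot Mr Br k1 W1 f).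
  by rewrite NE; exact: scattering_defect.
have NJ f : N f -> N (eQ f) by rewrite NE; exact: (J_defect J_mo JM JA).
(* Relation (i) in weak form; it also rewrites the left side of (ii) as [b(S(k) f, S(k) f)]. *)
have adj f g : N f -> N g -> dot (eQ (S (- k^*) f)) g = dot (eQ f) (S k g).
  move=> Nf Ng; rewrite (SE S _ _ _ hS k'0 HW' Nf) (SE S _ _ _ hS k0 HW Ng).
  rewrite NE in Nf Ng.
  exact: (scattering_adjoint A_ms J_mo JM JA H_selfadjoint k0 HW HW' Nf Ng).
split=> f Nf.
- split=> /= [||u v [/= Nu ->]]; first exact: NJ.
    by apply: NJ; rewrite (SE S _ _ _ hS k'0 HW' Nf); exact: NS.
  by rewrite dotC -adj // -dotC.
- have NSf : N (S k f) by rewrite (SE S _ _ _ hS k0 HW Nf); exact: NS.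
  (* The order of [R[i]] also asks for equal imaginary parts; both sides are real. *)
  rewrite adj // lecE -/(jdot dot eQ f f) -/(jdot dot eQ (S k f) (S k f)).
  rewrite !(Im_jdot J_mo) eqxx /= (SE S _ _ _ hS k0 HW Nf); rewrite NE in Nf.
  exact: (scattering_contraction A_ms J_mo JM JA H_selfadjoint H_spec H_ext
    H_adj_ext k0 HW Nf).
- rewrite (SE S _ _ _ hS k'0 HW' Nf).
  have NTf : N (PT f) by rewrite NE in Nf *; exact: (Th_defect A_ms ThK Th_dot ThM ThA Nf).
  rewrite (SE S _ _ _ hS k0 HW NTf).
  exact: (scattering_Th A_ms Th_lin ThK Th_dot ThM ThA H_PT f k0 HW HW').
Qed.
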